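(* Consider the linear discriminant analysis model, with $\Omega_X^*=\Omega_Y^*=\Omega^*$, and the quantities $\Delta,\Phi,\xi_X,\xi_Y,V,\hat\Sigma,\Omega_t,\mu_{X,t},\mu_{Y,t}$ defined in the context. Assume $\|\Sigma^*\|\vee\|\Omega^*\|=O(1)$, $p^2/n=o(1)$ and $V^{-1}=O(1)$. Let $A_n$ be a set of parameters $(\mu_X,\mu_Y,\Omega)$ (with $\Sigma=\Omega^{-1}$) satisfying, for some $\delta_n=o(1)$, $$A_n\subset\Big\{\sqrt n\big(\|\mu_X-\mu_X^*\|^2+\|\mu_Y-\mu_Y^*\|^2+\|\Sigma-\Sigma^*\|^2\big)\vee\sqrt p\big(\|\mu_X-\mu_X^*\|+\|\mu_Y-\mu_Y^*\|+\|\Sigma-\Sigma^*\|\big)\le\delta_n\Big\}.$$ If for a given prior $\Pi$ the following two conditions are satisfied: 1. $\Pi(A_n|X^n,Y^n)=1-o_P(1)$; 2. for any fixed $t\in\mathbb{R}$, $$\frac{\int_{A_n}\exp\big(l_n(\mu_{X,t},\mu_{Y,t},\Omega_t)\big)\,d\Pi(\mu_X,\mu_Y,\Omega)}{\int_{A_n}\exp\big(l_n(\mu_X,\mu_Y,\Omega)\big)\,d\Pi(\mu_X,\mu_Y,\Omega)}=1+o_P(1);$$ then $$\sup_{t\in\mathbb{R}}\left|\Pi\Big(\sqrt n\,V^{-1}\big(\Delta(\mu_X,\mu_Y,\Omega)-\hat\Delta\big)\le t\,\Big|\,X^n,Y^n\Big)-\mathbb{P}(Z\le t)\right|=o_P(1),$$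 where $Z\sim N(0,1)$ and $\hat\Delta=\Delta(\bar X,\bar Y,\hat\Sigma^{-1})$.
   Context: $X^n=(X_1,\dots,X_n)$ and $Y^n=(Y_1,\dots,Y_n)$ are independent i.i.d. samples with $X_i\sim N(\mu_X^*,\Omega^{*-1})$, $Y_i\sim N(\mu_Y^*,\Omega^{*-1})$ in $\mathbb{R}^p$; $\Sigma^*=\Omega^{*-1}$; $\bar X,\bar Y$ are the sample means. $z\in\mathbb{R}^p$ is a fixed (non-random) vector. The log-likelihood is $l_n(\mu_X,\mu_Y,\Omega)=l_X(\mu_X,\Omega)+l_Y(\mu_Y,\Omega)$, where $$l_X(\mu_X,\Omega)=\frac n2\log\det(\Omega)-\frac n2\mathrm{tr}(\Omega\tilde\Sigma_X),\qquad \tilde\Sigma_X=\frac1n\sum_{i=1}^n(X_i-\mu_X)(X_i-\mu_X)^T,$$ and $l_Y$ is defined likewise from $Y^n$. The posterior is $\Pi(B|X^n,Y^n)=\int_Be^{l_n}d\Pi/\int e^{l_n}d\Pi$. The LDA functional is $$\Delta(\mu_X,\mu_Y,\Omega)=-(z-\mu_X)^T\Omega(z-\mu_X)+(z-\mu_Y)^T\Omega(z-\mu_Y).$$ Define $$\Phi=\tfrac12\Omega^*\big((z-\mu_X^* )(z-\mu_X^* )^T-(z-\mu_Y^* )(z-\mu_Y^* )^T\big)\Omega^*,\quad \xi_X=2(z-\mu_X^* ),\quad \xi_Y=2(\mu_Y^*-z),$$ $$V^2=4\big\|\Sigma^{*1/2}\Phi\Sigma^{*1/2}\big\|_F^2+\xi_X^T\Omega^*\xi_X+\xi_Y^T\Omega^*\xi_Y,\quad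 V>0,$$ $$\Omega_t=\Omega+\frac{2t}{\sqrt n\,V}\Phi,\quad \mu_{X,t}=\mu_X-\frac{t}{\sqrt n\,V}\xi_X,\quad \mu_{Y,t}=\mu_Y-\frac{t}{\sqrt n\,V}\xi_Y,$$ $$\hat\Sigma=\frac12\Big(\frac1n\sum_{i=1}^n(X_i-\bar X)(X_i-\bar X)^T+\frac1n\sum_{i=1}^n(Y_i-\bar Y)(Y_i-\bar Y)^T\Big).$$ Asymptotics are as $n,p\to\infty$ jointly (all quantities may depend on $n$); $o_P$ is under the sampling distribution of $(X^n,Y^n)$. $\|\cdot\|$ is the spectral norm (Euclidean norm for vectors), $\|\cdot\|_F$ the Frobenius norm, $a\vee b=\max(a,b)$. *)

(* Defs.v *)
From HB Require Import structures.
From mathcomp Require Import all_boot all_order all_algebra.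
From mathcomp Require Import all_classical all_reals all_analysis.
Set Implicit Arguments.
Unset Strict Implicit.
Unset Printing Implicit Defensive.
Import Order.TTheory GRing.Theory Num.Theory.
Import numFieldNormedType.Exports.
Local Open Scope classical_set_scope.
Local Open Scope ring_scope.

Definition borel (R : realType) (E : normedModType R) :=
  g_sigma_algebraType (@open E).

Section Matrices.
Variable R : realType.

Definition qform p (M : 'M[R]_p) (v : 'cV[R]_p) : R := (v^T *m M *m v) 0 0.

Definition posdef p (M : 'M[R]_p) : Prop :=
  M^T = M /\ forall v : 'cV[R]_p, v != 0 -> 0 < qform M v.

Definition possemidef p (M : 'M[R]_p) : Prop :=
  M^T = M /\ forall v : 'cV[R]_p, 0 <= qform M v.

(* The symmetric square root M^{1/2}; meaningful when M is possemidef. *)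
Definition mxsqrt p (M : 'M[R]_p) : 'M[R]_p :=
  xget 0 [set S : 'M[R]_p | possemidef S /\ S *m S = M].

(* The library norm on matrices is the entrywise maximum, hence these norms. *)
Definition euclnorm p (v : 'cV[R]_p) : R := Num.sqrt (\sum_i v i 0 ^+ 2).

Definition frobnorm p (M : 'M[R]_p) : R :=
  Num.sqrt (\sum_i \sum_j M i j ^+ 2).

Definition specnorm p (M : 'M[R]_p) : R :=
  sup [set euclnorm (M *m v) | v in [set v : 'cV[R]_p | euclnorm v <= 1]].

End Matrices.

Section Probability.
Variable R : realType.

(* X ~ N(mu, Sigma) for nonsingular Sigma: every nontrivial linear form a^T X
   is N(a^T mu, a^T Sigma a).  The second parameter of [normal_prob] is the
   standard deviation; a = 0 is left out because [normal_prob m 0] is not the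
   point mass at m. *)
Definition mvnormal d (T : measurableType d) (P : probability T R) p
    (X : T -> 'cV[R]_p) (mu : 'cV[R]_p) (Sigma : 'M[R]_p) : Prop :=
  forall a : 'cV[R]_p, a != 0 ->
  forall B : set R, measurable B ->
    P [set w | B ((a^T *m X w) 0 0)] =
    normal_prob ((a^T *m mu) 0 0) (Num.sqrt (qform Sigma a)) B.

(* The events range over the Borel sets of E. *)
Definition mutually_independent d (T : measurableType d)
    (P : probability T R) (E : normedModType R) (I : finType)
    (Z : I -> T -> borel E) : Prop :=
  forall (J : {set I}) (B : I -> set (borel E)),
    (forall i, measurable (B i)) ->
    P (\bigcap_(i in [set` J]) Z i @^-1` B i) =
    (\prod_(i in J) P (Z i @^-1` B i))%E.

(* [(P n)^*] is the outer measure of P n: it agrees with P n on events, and it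
   makes sense without a measurability proof for the posterior quantities. *)
Definition oP (d : nat -> measure_display)
    (T : forall n, measurableType (d n)) (P : forall n, probability (T n) R)
    (U : forall n, T n -> R) : Prop :=
  forall eps : R, 0 < eps ->
    ((P n)^*%mu [set w | eps < `|U n w|]) @[n --> \oo] --> 0%E.

End Probability.

Section Model.
Variable R : realType.

(* A parameter is a triple (mu_X, mu_Y, Omega), encoded as a nested pair. *)
Definition param p : Type := ('cV[R]_p * 'cV[R]_p * 'M[R]_p)%type.

Definition paramB p := borel ('cV[R]_p * 'cV[R]_p * 'M[R]_p)%type.

Definition muX p (th : param p) : 'cV[R]_p := th.1.1.
Definition muY p (th : param p) : 'cV[R]_p := th.1.2.
Definition Omega p (th : param p) : 'M[R]_p := th.2.
Definition Sigma p (th : param p) : 'M[R]_p := invmx (Omega th).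

Section Sample.
Variables (n p : nat).
Implicit Types (x y : 'I_n -> 'cV[R]_p).

Definition smean x : 'cV[R]_p := n%:R^-1 *: \sum_i x i.

Definition scov x (mu : 'cV[R]_p) : 'M[R]_p :=
  n%:R^-1 *: \sum_i (x i - mu) *m (x i - mu)^T.

(* ln r = 0 for r <= 0; this only matters for Om that is not positive definite. *)
Definition loglik1 x (mu : 'cV[R]_p) (Om : 'M[R]_p) : R :=
  n%:R / 2 * ln (\det Om) - n%:R / 2 * \tr (Om *m scov x mu).

Definition loglik x y (th : param p) : R :=
  loglik1 x (muX th) (Omega th) + loglik1 y (muY th) (Omega th).

Definition Sigma_hat x y : 'M[R]_p :=
  2^-1 *: (scov x (smean x) + scov y (smean y)).

(* [fine] sends +oo to 0 and x / 0 = 0, so this is 0 if the normalising integral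
   is infinite or zero, i.e. when the posterior is undefined. *)
Definition posterior (Pi : probability (paramB p) R) x y
    (B : set (param p)) : R :=
  fine (\int[Pi]_(th in B) (expR (loglik x y th))%:E) /
  fine (\int[Pi]_th (expR (loglik x y th))%:E).

End Sample.

Section LDA.
Variables (p : nat) (z : 'cV[R]_p).

Definition Delta (th : param p) : R :=
  - qform (Omega th) (z - muX th) + qform (Omega th) (z - muY th).

Definition Delta_hat n (x y : 'I_n -> 'cV[R]_p) : R :=
  Delta (smean x, smean y, invmx (Sigma_hat x y)).

(* ths stands for the true parameter (mu_X^*, mu_Y^*, Omega^* ). *)
Definition Phi (ths : param p) : 'M[R]_p :=
  2^-1 *: (Omega ths *m
    ((z - muX ths) *m (z - muX ths)^T - (z - muY ths) *m (z - muY ths)^T)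
    *m Omega ths).

Definition xiX (ths : param p) : 'cV[R]_p := 2 *: (z - muX ths).
Definition xiY (ths : param p) : 'cV[R]_p := 2 *: (muY ths - z).

Definition V (ths : param p) : R :=
  Num.sqrt (4 * frobnorm (mxsqrt (Sigma ths) *m Phi ths
                          *m mxsqrt (Sigma ths)) ^+ 2
            + qform (Omega ths) (xiX ths) + qform (Omega ths) (xiY ths)).

(* th |-> (mu_{X,t}, mu_{Y,t}, Omega_t), for sample size n *)
Definition lda_shift n (ths : param p) (t : R) (th : param p) : param p :=
  (muX th - (t / (Num.sqrt n%:R * V ths)) *: xiX ths,
   muY th - (t / (Num.sqrt n%:R * V ths)) *: xiY ths,
   Omega th + (2 * t / (Num.sqrt n%:R * V ths)) *: Phi ths).

End LDA.

(* The bound on (mu_X, mu_Y, Sigma) that localises A_n. *)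
Definition nbhd n p (ths : param p) (delta : R) : set (param p) :=
  [set th | posdef (Omega th) /\
    Num.max
      (Num.sqrt n%:R * (euclnorm (muX th - muX ths) ^+ 2
                        + euclnorm (muY th - muY ths) ^+ 2
                        + specnorm (Sigma th - Sigma ths) ^+ 2))
      (Num.sqrt p%:R * (euclnorm (muX th - muX ths)
                        + euclnorm (muY th - muY ths)
                        + specnorm (Sigma th - Sigma ths)))
    <= delta].

End Model.

(* Main.v *)
Require Import Defs.
From HB Require Import structures.
From mathcomp Require Import all_boot all_order all_algebra.
From mathcomp Require Import all_classical all_reals all_analysis.
From mathcomp Require Import measurable_realfun.
From mathcomp Require Import ring lra.
From mathcomp Require complex.
Set Implicit Arguments.
Unset Strict Implicit.
Unset Printing Implicit Defensive.
Import Order.TTheory GRing.Theory Num.Theory.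
Import numFieldNormedType.Exports.
Local Open Scope classical_set_scope.
Local Open Scope ring_scope.

(** Write u and v for the difference of the two true means and for twice the
    vector from their midpoint to z.  Then Phi is a multiple of the symmetrized
    outer product of Omega* u and Omega* v, so it has rank at most two.  Hence the
    ratio of the determinants of Omega_t and Omega is an explicit quadratic
    polynomial in t / (sqrt n V) ([det_rank2_update]), and V^2 is an explicit
    polynomial in three numbers ([V_sqr]); this avoids the eigenvalues of perturbed
    matrices.

    The first half of the proof is the expansion
      l_n(theta_t) - l_n(theta) = t S(theta) - t^2 / 2 + o(1),
    S(theta) = sqrt n V^-1 (Delta(theta) - Delta_hat), uniformly over theta in A_n.
    Delta is linearized at the true parameter as a function of the means and of
    Sigma ([Delta_expand]); the likelihood depends on the data through the sample
    means and Sigma_hat only ([loglik_sufficient]), and its linear response to the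
    shift is the same linear functional.  The difference of the two sides is thus
    given exactly by six terms ([loglik_shift_identity]), which are bounded one by
    one ([loglik_shift_bound]).  The error Sigma_hat - Sigma* enters with the
    factor sqrt n only through its values on the two fixed vectors Omega* u and
    Omega* v, whose squared length is of order p / n times that of these vectors
    ([scov_mul_integral]); otherwise it suffices that its operator norm tends to 0,
    which the Frobenius norm of order p / sqrt n shows ([scov_frob_integral]).  So
    second moments and Markov's inequality replace spectral concentration.

    The second half turns this into convergence of distribution functions.
    Integrating exp(t S + l_n) over A_n and using both conditions on the prior, the
    Laplace transform of S under the posterior tends to exp(t^2 / 2), for each t.
    Convergence holds in outer probability, so what is needed is a quantitative
    continuity theorem that uses finitely many t ([laplace_cdf]): an indicator of a
    half-line is squeezed, up to a small window, between linear combinations of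
    exponentials whose errors have small Gaussian expectation ([expsum_step]).
    These combinations approximate a polynomial in a slowly varying sine: products
    and Taylor series preserve approximability by exponentials ([expapproxM],
    [expapprox_sin]), and the identity is a limit of difference quotients of exp.
    Monotonicity upgrades closeness on a grid to the supremum over the half-lines
    ([gauss_cdf_grid], [gibbs_cdf_uniform]).  The theorem follows since the samples
    on which one of the finitely many conditions fails have vanishing outer
    probability. *)

(** * Square roots of positive semidefinite matrices *)
Lemma poly_interpolation (F : fieldType) (f : F -> F) (s : seq F) :
  exists q : {poly F}, {in s, forall x, q.[x] = f x}.
Proof.
elim: s => [|x s [q qs]]; first by exists 0.
have [xs|xNs] := boolP (x \in s).
  by exists q => y; rewrite inE => /orP[/eqP ->|]; apply: qs.
pose w := \prod_(y <- s) ('X - y%:P); pose c := (f x - q.[x]) / w.[x].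
have wx : w.[x] != 0 by rewrite -rootE root_prod_XsubC.
exists (q + c *: w) => y; rewrite inE hornerD hornerZ.
move=> /orP[/eqP ->|ys]; first by rewrite /c divfK // subrKC.
have /eqP -> : w.[y] == 0 by rewrite -rootE root_prod_XsubC.
by rewrite mulr0 addr0 qs.
Qed.

Lemma trmx_horner_mx (R : comNzRingType) n (M : 'M[R]_n.+1) (q : {poly R}) :
  M^T = M -> (horner_mx M q)^T = horner_mx M q.
Proof.
move=> Msym; elim/poly_ind: q => [|q c IH]; first by rewrite rmorph0 trmx0.
rewrite rmorphD rmorphM /= horner_mx_X horner_mx_C linearD /= tr_scalar_mx.
by rewrite -mulmxE trmx_mul IH Msym (comm_mx_horner q (comm_mx_refl M)).
Qed.

Section SpectralReal.
Import complex.
Variable R : realType.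
Let C : numClosedFieldType := complex.complex R.
Let iota : {rmorphism R -> C} := complex.real_complex R.

Let iota_ge0 (x : R) : (0 <= iota x) = (0 <= x).
Proof. exact: (complex.lecR 0 x). Qed.

Let iota_conj (x : R) : (iota x)^* = iota x.
Proof. by apply/CrealP/complex.complex_realP; exists x. Qed.

Local Open Scope sesquilinear_scope.
(** The complex spectral theorem suffices: the square root below depends on the
    eigenvalues only, and these are real. *)
Lemma possemidef_spectral p (M : 'M[R]_p.+1) : possemidef M ->
  exists (Q : 'M[C]_p.+1) (e : 'rV[R]_p.+1), [/\ Q \in unitmx,
   map_mx iota M = invmx Q *m diag_mx (map_mx iota e) *m Q &
   forall i, 0 <= e 0 i].
Proof.
move=> [Msym Mpsd]; set A := map_mx iota M.
have Aherm : A \is hermsymmx.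
  apply/is_hermitianmxP; rewrite expr0 scale1r.
  by apply/matrixP => i j; rewrite !mxE -{1}Msym mxE iota_conj.
have Dreal := hermitian_spectral_diag_real Aherm.
have /hermitian_normalmx/orthomx_spectralP AE := Aherm.
set Q := spectralmx A in AE; set d := spectral_diag A in AE Dreal.
have Qu : Q \in unitmx by exact: spectral_unit.
have /unitarymxP QQ : Q \is unitarymx by exact: spectral_unitarymx.
have [e de] : exists e : 'rV[R]_p.+1, d = map_mx iota e.
  exists (map_mx (@complex.Re R) d); apply/matrixP => i j; rewrite !mxE.
  exact: esym (complex.RRe_real (mxOverP Dreal i j)).
exists Q, e; split; [exact: Qu|by rewrite -de|].
move=> i; rewrite -iota_ge0.
have -> : iota (e 0 i) = d 0 i by rewrite de [RHS]mxE.
(* d_i = w A w^* for the unit eigenrow w = x + i y of A, i.e. x M x^T + y M y^T *)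
have -> : d 0 i = (row i Q *m A *m (row i Q)^t*) 0 0.
  have -> : row i Q *m A = d 0 i *: row i Q.
    rewrite -row_mul AE mulmxA mulmxA mulmxV // mul1mx.
    by rewrite mul_diag_mx; apply/rowP => k; rewrite !mxE.
  rewrite -scalemxAl [RHS]mxE.
  have := congr1 (fun B : 'M[C]_p.+1 => B i i) QQ.
  rewrite !mxE eqxx mulr1n => H.
  rewrite -[LHS]mulr1 -H; congr (_ * _); apply: eq_bigr => k _.
  by rewrite !mxE.
pose x : 'cV[R]_p.+1 := \col_k complex.Re (Q i k).
pose y : 'cV[R]_p.+1 := \col_k complex.Im (Q i k).
have wE : row i Q = (map_mx iota x)^T + 'i *: (map_mx iota y)^T.
  by apply/rowP => k; rewrite !mxE; exact: complex.complexE.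
have wcE : (row i Q)^t* = map_mx iota x - 'i *: map_mx iota y.
  rewrite wE; apply/matrixP => k l; rewrite !mxE rmorphD rmorphM /= conjCi.
  by rewrite !iota_conj mulNr.
have -> : (row i Q *m A *m (row i Q)^t*) 0 0 = iota (qform M x + qform M y).
  rewrite wcE wE !mulmxDl !mulmxBr -!scalemxAl -!scalemxAr -?scalemxAl scalerA.
  rewrite -expr2 sqrCi scaleN1r opprK.
  rewrite !map_trmx -!map_mxM.
  have -> : y^T *m M *m x = x^T *m M *m y.
    have tr1 (B : 'M[R]_1) : B^T = B by apply/matrixP => a b; rewrite mxE !ord1.
    by rewrite -[LHS]tr1 !trmx_mul Msym trmxK mulmxA.
  rewrite [RHS]rmorphD /= /qform !mxE.
  by rewrite addrA subrK.
by rewrite iota_ge0 addr_ge0.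
Qed.

(** A real polynomial in M is real and symmetric although M is diagonalized over
    the complex numbers.  Interpolating the fourth root gives T, and T *m T is
    positive semidefinite because T is symmetric. *)
Lemma possemidef_sqrt p (M : 'M[R]_p) : possemidef M ->
  exists S : 'M[R]_p, possemidef S /\ S *m S = M.
Proof.
case: p M => [|p] M Mpsd.
  exists M; split => //; by rewrite [LHS]flatmx0 [RHS]flatmx0.
have [Q [e [Qu AE e0]]] := possemidef_spectral Mpsd.
have [q qE] := poly_interpolation (fun x : R => Num.sqrt (Num.sqrt x))
  [seq e 0 i | i : 'I_p.+1].
pose T := horner_mx M q.
have Tsym : T^T = T by apply: trmx_horner_mx; case: Mpsd.
exists (T *m T); split; first split.
- by rewrite trmx_mul Tsym.
- move=> v; rewrite /qform -{1}Tsym mulmxA -trmx_mul -mulmxA.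
  by rewrite mxE sumr_ge0 // => i _; rewrite mxE -expr2 sqr_ge0.
have -> : T *m T *m (T *m T) = horner_mx M (q ^+ 4).
  by rewrite rmorphXn /= !exprS expr0 mulr1 !mulmxE !mulrA.
apply: (@map_mx_inj _ _ iota); rewrite map_horner_mx AE.
rewrite (horner_mx_uconjC _ _ Qu) horner_mx_diag.
suff -> : map_mx (horner (map_poly iota (q ^+ 4))) (map_mx iota e) =
          map_mx iota e by [].
apply/rowP => i; rewrite !mxE (horner_map iota); congr (iota _).
rewrite horner_exp qE; last by apply/mapP; exists i; rewrite ?mem_enum.
by rewrite (exprM _ 2 2) !sqr_sqrtr ?sqrtr_ge0 ?e0.
Qed.
End SpectralReal.

(** * Euclidean norms and operator bounds *)
Section Euclidean.
Variable R : realType.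

Definition dotv p (x y : 'cV[R]_p) : R := (x^T *m y) 0 0.

Section Dot.
Variable p : nat.
Implicit Types (x y w : 'cV[R]_p) (M : 'M[R]_p).

Lemma dotvE x y : dotv x y = \sum_i x i 0 * y i 0.
Proof. by rewrite /dotv mxE; apply: eq_bigr => i _; rewrite mxE. Qed.

Lemma dotvC x y : dotv x y = dotv y x.
Proof. by rewrite !dotvE; apply: eq_bigr => i _; rewrite mulrC. Qed.

Lemma dotvDl x y w : dotv (x + y) w = dotv x w + dotv y w.
Proof. by rewrite /dotv linearD mulmxDl mxE. Qed.

Lemma dotvDr x y w : dotv w (x + y) = dotv w x + dotv w y.
Proof. by rewrite dotvC dotvDl !(dotvC w). Qed.

Lemma dotvZl c x y : dotv (c *: x) y = c * dotv x y.
Proof. by rewrite /dotv linearZ -scalemxAl mxE. Qed.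

Lemma dotvZr c x y : dotv x (c *: y) = c * dotv x y.
Proof. by rewrite dotvC dotvZl dotvC. Qed.

Lemma dotvNl x y : dotv (- x) y = - dotv x y.
Proof. by rewrite -scaleN1r dotvZl mulN1r. Qed.

Lemma dotvNr x y : dotv x (- y) = - dotv x y.
Proof. by rewrite dotvC dotvNl dotvC. Qed.

Lemma dotvBl x y w : dotv (x - y) w = dotv x w - dotv y w.
Proof. by rewrite dotvDl dotvNl. Qed.

Lemma dotvBr x y w : dotv w (x - y) = dotv w x - dotv w y.
Proof. by rewrite dotvDr dotvNr. Qed.

Lemma dotv0l x : dotv 0 x = 0.
Proof. by rewrite -(scale0r x) dotvZl mul0r. Qed.

Lemma dotv_mull M x y : dotv (M *m x) y = dotv x (M^T *m y).
Proof. by rewrite /dotv trmx_mul mulmxA. Qed.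

Lemma dotv_sym M x y : M^T = M -> dotv x (M *m y) = dotv y (M *m x).
Proof. by move=> Ms; rewrite dotvC dotv_mull Ms. Qed.

Lemma qformE M x : qform M x = dotv x (M *m x).
Proof. by rewrite /qform /dotv mulmxA. Qed.

Lemma dotv_ge0 x : 0 <= dotv x x.
Proof. by rewrite dotvE sumr_ge0 // => i _; rewrite -expr2 sqr_ge0. Qed.

Lemma euclnormE x : euclnorm x = Num.sqrt (dotv x x).
Proof.
by rewrite /euclnorm dotvE; congr Num.sqrt; apply: eq_bigr => i _; rewrite expr2.
Qed.

Lemma euclnorm_sqr x : euclnorm x ^+ 2 = dotv x x.
Proof. by rewrite euclnormE sqr_sqrtr ?dotv_ge0. Qed.

Lemma euclnorm_ge0 x : 0 <= euclnorm x.
Proof. by rewrite euclnormE sqrtr_ge0. Qed.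

Lemma euclnorm0 : euclnorm (0 : 'cV[R]_p) = 0.
Proof. by rewrite euclnormE dotv0l sqrtr0. Qed.

Lemma euclnormZ c x : euclnorm (c *: x) = `|c| * euclnorm x.
Proof.
by rewrite !euclnormE dotvZl dotvZr mulrA -expr2 sqrtrM ?sqr_ge0 // sqrtr_sqr.
Qed.

Lemma euclnormN x : euclnorm (- x) = euclnorm x.
Proof. by rewrite -scaleN1r euclnormZ normrN1 mul1r. Qed.

Lemma euclnorm_eq0 x : euclnorm x = 0 -> x = 0.
Proof.
move=> x0; have : dotv x x = 0 by rewrite -euclnorm_sqr x0 expr0n.
rewrite dotvE => /eqP; rewrite psumr_eq0; last by move=> i _; rewrite -expr2 sqr_ge0.
move=> /allP x0'; apply/colP => i; rewrite mxE.
by have := x0' i (mem_index_enum _); rewrite /= -expr2 sqrf_eq0 => /eqP.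
Qed.

End Dot.

(** The source of both Cauchy-Schwarz inequalities below.  The degenerate cases
    c <= 0 are excluded or settled by taking |s| large. *)
Lemma discriminant_le (a b c : R) :
  (forall s, 0 <= a + 2 * s * b + s ^+ 2 * c) -> b ^+ 2 <= a * c.
Proof.
move=> H; have a0 : 0 <= a by have := H 0; rewrite mulr0 mul0r expr0n mul0r !addr0.
have [c0|c0|c0] := ltrgt0P c.
- have := H (- b / c); set q := _ + _ + _.
  have -> : q = (a * c - b ^+ 2) / c by rewrite /q; field; rewrite gt_eqF.
  by rewrite pmulr_lge0 ?invr_gt0 // subr_ge0.
- exfalso; pose s := a + 1 + (a + 1) / - c.
  have c0' : 0 < - c by rewrite oppr_gt0.
  have r0 : 0 <= (a + 1) / - c by rewrite divr_ge0 ?ltW // ltr_wpDl.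
  have rc : (a + 1) / - c * - c = a + 1 by rewrite divfK // gt_eqF.
  have s1 : 1 <= s by rewrite /s; lra.
  have sc : a + 1 <= s * - c by rewrite /s mulrDl rc lerDr mulr_ge0 ?ltW // ltr_wpDl.
  have : s * - c <= s * (s * - c) by rewrite ler_peMl // mulr_ge0 ?ltW // (lt_le_trans ltr01).
  have := H s; have := H (- s); rewrite !expr2; lra.
- have [->|b0] := eqVneq b 0; first by rewrite c0 mulr0 expr0n.
  have := H (- (a + 1) / (2 * b)).
  have -> : 2 * (- (a + 1) / (2 * b)) * b = - (a + 1) by field.
  by rewrite c0; lra.
Qed.

Lemma possemidef_CS p (M : 'M[R]_p) (x y : 'cV[R]_p) : possemidef M ->
  dotv x (M *m y) ^+ 2 <= dotv x (M *m x) * dotv y (M *m y).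
Proof.
move=> [Ms M0]; apply: discriminant_le => s.
have := M0 (x + s *: y); rewrite qformE mulmxDr -scalemxAr.
rewrite !(dotvDl, dotvDr, dotvZl, dotvZr) (dotv_sym y x Ms); lra.
Qed.

Lemma dotv_CS_sqr p (x y : 'cV[R]_p) : dotv x y ^+ 2 <= dotv x x * dotv y y.
Proof.
have := @possemidef_CS p 1%:M x y; rewrite !mul1mx; apply.
by split=> [|v]; rewrite ?trmx1 // qformE mul1mx dotv_ge0.
Qed.

Lemma dotv_CS p (x y : 'cV[R]_p) : `|dotv x y| <= euclnorm x * euclnorm y.
Proof.
rewrite -ler_sqr ?nnegrE ?mulr_ge0 ?euclnorm_ge0 //.
by rewrite exprMn !euclnorm_sqr real_normK ?num_real // dotv_CS_sqr.
Qed.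

Lemma euclnormD p (x y : 'cV[R]_p) : euclnorm (x + y) <= euclnorm x + euclnorm y.
Proof.
rewrite -ler_sqr ?nnegrE ?addr_ge0 ?euclnorm_ge0 //.
rewrite sqrrD !euclnorm_sqr dotvDl !dotvDr (dotvC y x).
have := ler_norm (dotv x y); have := dotv_CS x y; lra.
Qed.

Lemma euclnormB p (x y : 'cV[R]_p) : euclnorm (x - y) <= euclnorm x + euclnorm y.
Proof. by rewrite -(euclnormN y) euclnormD. Qed.

(** Both the spectral and the Frobenius norm give such a bound; stating it
    pointwise avoids suprema when operators are composed. *)
Definition opbound p (M : 'M[R]_p) (c : R) :=
  forall v : 'cV[R]_p, euclnorm (M *m v) <= c * euclnorm v.

Lemma frobnorm_sqr p (M : 'M[R]_p) : frobnorm M ^+ 2 = \sum_i \sum_j M i j ^+ 2.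
Proof.
by rewrite sqr_sqrtr // sumr_ge0 // => i _; rewrite sumr_ge0 // => j _; rewrite sqr_ge0.
Qed.

Lemma frobnorm_opbound p (M : 'M[R]_p) : opbound M (frobnorm M).
Proof.
move=> v; rewrite -ler_sqr ?nnegrE ?mulr_ge0 ?euclnorm_ge0 ?sqrtr_ge0 //.
rewrite exprMn frobnorm_sqr euclnorm_sqr dotvE mulr_suml ler_sum // => i _.
have := dotv_CS_sqr (row i M)^T v.
have -> : dotv (row i M)^T v = (M *m v) i 0.
  by rewrite dotvE mxE; apply: eq_bigr => j _; rewrite !mxE.
have -> : dotv (row i M)^T (row i M)^T = \sum_j M i j ^+ 2.
  by rewrite dotvE; apply: eq_bigr => j _; rewrite !mxE expr2.
by rewrite expr2 -euclnorm_sqr.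
Qed.

Lemma frobnorm_sqr_cols p (M : 'M[R]_p) :
  frobnorm M ^+ 2 = \sum_j euclnorm (M *m delta_mx j 0) ^+ 2.
Proof.
rewrite frobnorm_sqr exchange_big; apply: eq_bigr => j _.
rewrite euclnorm_sqr dotvE; apply: eq_bigr => i _.
have -> : (M *m (delta_mx j 0 : 'cV[R]_p)) i 0 = M i j by rewrite -colE mxE.
by rewrite expr2.
Qed.

Lemma specnorm_has_sup p (M : 'M[R]_p) :
  has_sup [set euclnorm (M *m v) | v in [set v : 'cV[R]_p | euclnorm v <= 1]].
Proof.
split; first by exists (euclnorm (M *m 0)), 0 => //=; rewrite euclnorm0.
exists (frobnorm M) => _ [v /= v1 <-]; apply: (le_trans (frobnorm_opbound M v)).
by rewrite ler_piMr ?sqrtr_ge0.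
Qed.

Lemma specnorm_ge0 p (M : 'M[R]_p) : 0 <= specnorm M.
Proof.
apply: sup_ubound; first by case: (specnorm_has_sup M).
by exists 0 => /=; rewrite ?euclnorm0 // mulmx0 euclnorm0.
Qed.

Lemma specnorm_opbound p (M : 'M[R]_p) : opbound M (specnorm M).
Proof.
move=> v; have [v0|v0] := eqVneq (euclnorm v) 0.
  by rewrite v0 mulr0 (euclnorm_eq0 v0) mulmx0 euclnorm0.
have vpos : 0 < euclnorm v by rewrite lt_neqAle eq_sym v0 euclnorm_ge0.
rewrite -ler_pdivrMr //; apply: sup_ubound; first by case: (specnorm_has_sup M).
exists ((euclnorm v)^-1 *: v); rewrite /= ?euclnormZ ?ger0_norm ?invr_ge0 ?euclnorm_ge0 //.
  by rewrite mulVf.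
by rewrite -scalemxAr euclnormZ ger0_norm ?invr_ge0 ?euclnorm_ge0 // mulrC.
Qed.

Lemma opboundW p (M : 'M[R]_p) c c' : opbound M c -> c <= c' -> opbound M c'.
Proof.
by move=> Mc cc' v; rewrite (le_trans (Mc v)) // ler_wpM2r ?euclnorm_ge0.
Qed.

Lemma opbound_dotv p (M : 'M[R]_p) c x y : opbound M c ->
  `|dotv x (M *m y)| <= c * (euclnorm x * euclnorm y).
Proof.
move=> Mc; rewrite (le_trans (dotv_CS _ _)) // mulrCA.
by rewrite ler_wpM2l ?euclnorm_ge0.
Qed.

End Euclidean.

(** * Positive definite matrices and rank-two determinants *)
Section Positive.
Variable R : realType.

Lemma posdef_semi p (M : 'M[R]_p) : posdef M -> possemidef M.
Proof.
move=> [Ms M0]; split=> // v; have [->|v0] := eqVneq v 0; last exact: ltW (M0 v v0).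
by rewrite qformE dotv0l.
Qed.

Lemma inj_unitmx p (M : 'M[R]_p) :
  (forall v : 'cV[R]_p, M *m v = 0 -> v = 0) -> M \in unitmx.
Proof.
move=> Minj; rewrite -unitmx_tr -row_free_unit -kermx_eq0; apply/eqP/row_matrixP => i.
rewrite row0; apply: trmx_inj; rewrite trmx0; apply: Minj.
apply: trmx_inj; rewrite trmx_mul trmxK trmx0 -row_mul.
by rewrite mulmx_ker row0.
Qed.

Lemma posdef_unit p (M : 'M[R]_p) : posdef M -> M \in unitmx.
Proof.
move=> [Ms M0]; apply: inj_unitmx => v Mv0; apply/eqP/negP => /negP v0.
by have := M0 v v0; rewrite qformE Mv0 dotvC dotv0l ltxx.
Qed.

Lemma posdef_det p (M : 'M[R]_p) : posdef M -> 0 < \det M.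
Proof.
move=> Mp; have [S [_ SS]] := possemidef_sqrt (posdef_semi Mp).
have := posdef_unit Mp; rewrite unitmxE unitfE -SS det_mulmx.
by rewrite -expr2 lt_neqAle sqr_ge0 andbT eq_sym.
Qed.

Lemma posdef_inv p (M : 'M[R]_p) : posdef M -> posdef (invmx M).
Proof.
move=> Mp; have Mu := posdef_unit Mp; case: Mp => Ms M0.
have iMs : (invmx M)^T = invmx M by rewrite trmx_inv Ms.
split=> // v v0; have w0 : invmx M *m v != 0.
  by apply: contraNneq v0 => w0; rewrite -[v](mulKVmx Mu) w0 mulmx0.
by have := M0 _ w0; rewrite !qformE mulKVmx // dotvC.
Qed.

Lemma mxsqrtP p (M : 'M[R]_p) : possemidef M ->
  possemidef (mxsqrt M) /\ mxsqrt M *m mxsqrt M = M.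
Proof. by move=> Mp; exact: (xgetPex 0 (possemidef_sqrt Mp)). Qed.

Lemma mxtrace_outer p (x y : 'cV[R]_p) (A : 'M[R]_p) :
  \tr (A *m (x *m y^T)) = dotv y (A *m x).
Proof. by rewrite mulmxA mxtrace_mulC /dotv /mxtrace big_ord1. Qed.

Lemma outerE p (x y w : 'cV[R]_p) : x *m y^T *m w = dotv y w *: x.
Proof.
by rewrite -mulmxA [y^T *m w]mx11_scalar mul_mx_scalar.
Qed.

(** Sylvester's identity: two block eliminations of the same matrix. *)
Lemma det_one_plus_mul p k (U : 'M[R]_(p, k)) (W : 'M[R]_(k, p)) :
  \det (1%:M + U *m W) = \det (1%:M + W *m U).
Proof.
pose B : 'M[R]_(p + k) := block_mx 1%:M (- U) W 1%:M.
have E1 : \det B = \det (1%:M + U *m W).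
  have D1 : \det (block_mx (1%:M : 'M[R]_p) U 0 (1%:M : 'M[R]_k)) = 1.
    by rewrite det_ublock !det1 mulr1.
  rewrite -[LHS]mul1r -[X in X * _]D1 -det_mulmx mulmx_block.
  rewrite !(mul1mx, mulmx1, mul0mx, mulmx0, add0r, addr0).
  by rewrite addNr det_lblock det1 mulr1.
rewrite -E1.
have D2 : \det (block_mx (1%:M : 'M[R]_p) 0 (- W) (1%:M : 'M[R]_k)) = 1.
  by rewrite det_lblock !det1 mulr1.
rewrite -[LHS]mul1r -[X in X * _]D2 -det_mulmx mulmx_block.
rewrite !(mul1mx, mulmx1, mul0mx, mulmx0, add0r, addr0).
by rewrite addNr det_ublock det1 mul1r mulmxN mulNmx opprK addrC.
Qed.

Lemma det_mx_2x2 (A : 'M[R]_2) :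
  \det A = A 0 0 * A 1 1 - A 0 1 * A 1 0.
Proof.
rewrite (expand_det_row _ 0) !big_ord_recl big_ord0 addr0.
rewrite /cofactor !det_mx11 !mxE /= expr0 mul1r expr1 mulN1r mulrN.
have e1 : lift (0 : 'I_2) (0 : 'I_1) = 1 by exact: val_inj.
have e0 : lift (lift (0 : 'I_2) (0 : 'I_1)) (0 : 'I_1) = 0 by exact: val_inj.
by rewrite e0 !e1.
Qed.

(** Updating by a symmetrized outer product perturbs the determinant by an
    explicit quadratic polynomial, because the update has rank at most two. *)
Lemma det_rank2_update p (Om S : 'M[R]_p) (x y : 'cV[R]_p) c :
  Om *m S = 1%:M -> S^T = S ->
  \det (Om + c *: (x *m y^T + y *m x^T)) =
  \det Om * ((1 + c * dotv x (S *m y)) ^+ 2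
              - c ^+ 2 * (dotv x (S *m x) * dotv y (S *m y))).
Proof.
move=> OS Ss.
pose U : 'M[R]_(p, 1 + 1) := row_mx (S *m x) (S *m y).
pose W : 'M[R]_(1 + 1, p) := c *: col_mx y^T x^T.
have -> : Om + c *: (x *m y^T + y *m x^T) = Om *m (1%:M + U *m W).
  rewrite mulmxDr mulmx1 -scalemxAr mul_row_col -scalemxAr mulmxDr !mulmxA OS.
  by rewrite !mul1mx.
rewrite det_mulmx det_one_plus_mul; congr (_ * _).
rewrite /W -scalemxAl mul_col_row (@det_mx_2x2 (_ : 'M[R]_2)).
set B := block_mx _ _ _ _.
have i0 : (0 : 'I_2) = lshift 1 (0 : 'I_1) by exact: val_inj.
have i1 : (1 : 'I_2) = rshift 1 (0 : 'I_1) by exact: val_inj.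
have B00 : B 0 0 = dotv y (S *m x) by rewrite i0 block_mxEul.
have B01 : B 0 1 = dotv y (S *m y) by rewrite {1}i0 i1 block_mxEur.
have B10 : B 1 0 = dotv x (S *m x) by rewrite {1}i0 i1 block_mxEdl.
have B11 : B 1 1 = dotv x (S *m y) by rewrite i1 block_mxEdr.
clearbody B.
have E i j : (1%:M + c *: B) i j = (i == j)%:R + c * B i j by rewrite !mxE.
rewrite !E B00 B01 B10 B11 (dotv_sym y x Ss) /= !mulr1n !mulr0n; ring.
Qed.

End Positive.

(** * Algebra of the discriminant functional *)
Section LDAAlgebra.
Variables (R : realType) (p : nat) (z : 'cV[R]_p) (ths : param R p).
Hypothesis Om_pos : posdef (Omega ths).
Let Om := Omega ths.
Let Sg := Sigma ths.

Definition mean_gap := muY ths - muX ths.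
Definition mean_mid := (z - muX ths) + (z - muY ths).
Local Notation u := mean_gap.
Local Notation v := mean_mid.

Let Oms : Om^T = Om. Proof. by case: Om_pos. Qed.
Let OmSg : Om *m Sg = 1%:M. Proof. by rewrite mulmxV // posdef_unit. Qed.
Let SgOm : Sg *m Om = 1%:M. Proof. by rewrite mulVmx // posdef_unit. Qed.
Let Sgs : Sg^T = Sg. Proof. by case: (posdef_inv Om_pos). Qed.

(** a a^T - b b^T is half the symmetrized product of a - b and a + b.  This makes
    every determinant and trace involving Phi an explicit polynomial. *)
Lemma Phi_rank2 :
  Phi z ths = 4^-1 *: ((Om *m u) *m (Om *m v)^T + (Om *m v) *m (Om *m u)^T).
Proof.
rewrite /Phi -/Om.
have -> : (z - muX ths) *m (z - muX ths)^T - (z - muY ths) *m (z - muY ths)^T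
    = 2^-1 *: (u *m v^T + v *m u^T).
  rewrite /u /v; set a := z - muX ths; set b := z - muY ths.
  have -> : muY ths - muX ths = a - b by rewrite /a /b opprB [RHS]addrC addrA subrK.
  clearbody a b; rewrite [(a - b)^T]linearB [(a + b)^T]linearD /=.
  rewrite !(mulmxDl, mulmxDr, mulmxBl, mulmxBr, mulmxN, mulNmx).
  set aa := a *m a^T; set ab := a *m b^T; set ba := b *m a^T; set bb := b *m b^T.
  clearbody aa ab ba bb; apply/matrixP => i j; rewrite !mxE; by field.
rewrite !trmx_mul Oms -scalemxAr -scalemxAl scalerA; congr (_ *: _).
  by field.
by rewrite mulmxDr mulmxDl !mulmxA.
Qed.

Lemma Phi_mul w :
  Phi z ths *m w = 4^-1 *: (dotv (Om *m v) w *: (Om *m u) + dotv (Om *m u) w *: (Om *m v)).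
Proof. by rewrite Phi_rank2 -scalemxAl mulmxDl !outerE. Qed.

Lemma Phi_sym : (Phi z ths)^T = Phi z ths.
Proof. by rewrite Phi_rank2 linearZ linearD /= !trmx_mul !trmxK addrC. Qed.

Lemma mxtrace_Phi_mul A : A^T = A ->
  \tr (Phi z ths *m A) = 2^-1 * dotv (Om *m u) (A *m (Om *m v)).
Proof.
move=> As; rewrite mxtrace_mulC Phi_rank2 -scalemxAr mulmxDr mxtraceZ mxtraceD.
by rewrite !mxtrace_outer (dotv_sym _ _ As); field.
Qed.

Lemma frobnorm_trace q (M : 'M[R]_q) : frobnorm M ^+ 2 = \tr (M *m M^T).
Proof.
rewrite frobnorm_sqr; apply: eq_bigr => i _; rewrite mxE.
by apply: eq_bigr => j _; rewrite mxE expr2.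
Qed.

(** Since Phi has rank two, V^2 is an explicit polynomial in the three
    numbers u^T Om u, u^T Om v, v^T Om v. *)
Lemma V_sqr :
  V z ths ^+ 2 = 2^-1 * (dotv u (Om *m u) * dotv v (Om *m v) + dotv u (Om *m v) ^+ 2)
                 + 2 * (dotv u (Om *m u) + dotv v (Om *m v)).
Proof.
have Omp w : 0 <= dotv w (Om *m w) by rewrite -qformE; case: (posdef_semi Om_pos).
have [[Ssym _] SS] := mxsqrtP (posdef_semi (posdef_inv Om_pos)).
rewrite -/(Sigma ths) -/Sg in Ssym SS.
rewrite /V sqr_sqrtr; last first.
  by rewrite !addr_ge0 // ?qformE ?Omp // mulr_ge0 // sqr_ge0.
have -> : frobnorm (mxsqrt Sg *m Phi z ths *m mxsqrt Sg) ^+ 2 =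
   8^-1 * (dotv u (Om *m u) * dotv v (Om *m v) + dotv u (Om *m v) ^+ 2).
  rewrite frobnorm_trace !trmx_mul Ssym Phi_sym.
  set S := mxsqrt Sg in SS *.
  have -> : S *m Phi z ths *m S *m (S *m (Phi z ths *m S)) =
    S *m (Phi z ths *m Sg *m Phi z ths *m S) by rewrite -SS !mulmxA.
  rewrite mxtrace_mulC -!mulmxA SS mxtrace_Phi_mul; last first.
    by rewrite !trmx_mul Sgs Phi_sym -mulmxA.
  rewrite -!mulmxA (mulmxA Sg Om) SgOm mul1mx Phi_mul.
  move: mean_gap mean_mid => x y; rewrite -scalemxAr mulmxDr -!scalemxAr.
  rewrite !(mulmxA Sg) SgOm !mul1mx dotvZr dotvDr !dotvZr !dotv_mull Oms.
  by field.
rewrite !qformE /xiX /xiY -/Om.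
set a := z - muX ths; set b := z - muY ths.
have -> : muY ths - z = - b by rewrite opprB.
have -> : u = a - b by rewrite /u /a /b opprB [RHS]addrC addrA subrK.
rewrite /v -/a -/b; clearbody a b; rewrite -!scalemxAr !(mulmxDr, mulmxN).
rewrite !(dotvZl, dotvZr, dotvDl, dotvDr, dotvBl, dotvBr, dotvNl, dotvNr).
by rewrite (dotv_sym b a Oms); field.
Qed.

Lemma Delta_dot th : Delta z th =
  - dotv (z - muX th) (Omega th *m (z - muX th))
  + dotv (z - muY th) (Omega th *m (z - muY th)).
Proof. by rewrite /Delta !qformE. Qed.

(** Second order expansion of Delta at the true parameter.  The linear part is
    expressed in Sigma rather than Omega, and the remainder only involves the
    perturbation of Sigma along the directions Om u and Om v. *)
Lemma Delta_expand th (D := Sigma th - Sg)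
    (k := muX th - muX ths) (l := muY th - muY ths) :
  (Omega th)^T = Omega th -> Omega th \in unitmx ->
  Delta z th - Delta z ths =
  dotv (Om *m u) (D *m (Om *m v))
  + dotv (xiX z ths) (Om *m k) + dotv (xiY z ths) (Om *m l)
  + (- dotv (D *m (Om *m u)) (Omega th *m (D *m (Om *m v)))
     - dotv (D *m (Om *m u)) (Omega th *m (k + l))
     - dotv (D *m (Om *m v)) (Omega th *m (k - l))
     - dotv k (Omega th *m k) + dotv l (Omega th *m l)).
Proof.
move=> Os Ou; set O := Omega th in Os Ou *.
have OD w : O *m (D *m (Om *m w)) = Om *m w - O *m w.
  rewrite /D mulmxBl mulmxBr mulmxA /Sigma mulmxV // mul1mx.
  by rewrite (mulmxA Sg) SgOm mul1mx.
have DO x y : dotv (D *m (Om *m x)) (O *m y) = dotv x (Om *m y) - dotv x (O *m y).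
  by rewrite (dotv_sym _ _ Os) OD dotvBr (dotv_sym x y Oms) (dotv_sym x y Os).
have ODO : dotv (D *m (Om *m u)) (O *m (D *m (Om *m v))) =
   dotv (Om *m u) (D *m (Om *m v)) - (dotv u (Om *m v) - dotv u (O *m v)).
  have Ds : D^T = D by rewrite /D linearB /= Sgs /Sigma trmx_inv Os.
  rewrite OD dotvBr dotv_mull Ds; congr (_ - _).
  by rewrite -(DO u v).
rewrite ODO !DO !Delta_dot -/O -/Om.
rewrite /xiX /xiY.
set a := z - muX ths; set b := z - muY ths.
have -> : muY ths - z = - b by rewrite opprB.
have -> : z - muX th = a - k by rewrite /a /k opprB addrA subrK.
have -> : z - muY th = b - l by rewrite /b /l opprB addrA subrK.
have uab : u = a - b by rewrite /u /a /b opprB [RHS]addrC addrA subrK.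
rewrite uab /v -/a -/b; clearbody k l a b; rewrite !(mulmxDr, mulmxN).
rewrite !(dotvZl, dotvZr, dotvDl, dotvDr, dotvBl, dotvBr, dotvNl, dotvNr).
rewrite (dotv_sym b a Oms) (dotv_sym b a Os) (dotv_sym k a Os) (dotv_sym l b Os); ring.
Qed.

End LDAAlgebra.

(** * Logarithm of the determinant ratio *)
Section Scalar.
Variable R : realType.

Lemma ln_taylor2 (x : R) : `|x| <= 2^-1 ->
  `|ln (1 + x) - x + x ^+ 2 / 2| <= 2 * `|x| ^+ 3.
Proof.
move=> x12; pose f (y : R) := ln (1 + y) - y + y ^+ 2 / 2.
pose f' (y : R) := (1 + y)^-1 - 1 + y.
have df (y : R) : `|y| <= 2^-1 -> is_derive y 1 f (f' y).
  move=> y12; have y1 : 0 < 1 + y by move: y12; rewrite ler_norml => /andP[]; lra.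
  have dln := is_derive1_ln y1; rewrite /f /f'.
  apply: (@is_derive_eq _ _ _ _ _ _ _ _).
  rewrite /GRing.scale /=; field; rewrite gt_eqF ?y1 //.
have f0 : f 0 = 0 by rewrite /f addr0 ln1 expr0n mul0r subr0 addr0.
have f'le y : `|y| <= `|x| -> `|f' y| <= 2 * `|x| ^+ 2.
  move=> yx; have y12 : `|y| <= 2^-1 by rewrite (le_trans yx).
  have y1 : 2^-1 <= 1 + y by move: y12; rewrite ler_norml => /andP[]; lra.
  have -> : f' y = y ^+ 2 / (1 + y) by rewrite /f'; field; rewrite gt_eqF //; lra.
  rewrite normrM normfV normrX (ger0_norm (x := 1 + y)); last by lra.
  rewrite mulrC ler_pM ?invr_ge0 ?exprn_ge0 //; first by lra.
    by rewrite -(invrK 2) lef_pV2 ?posrE //; lra.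
  by rewrite lerXn2r ?nnegrE.
suff [c cx] : exists2 c, `|c| <= `|x| & f x = f' c * x.
  by rewrite -/(f x) => ->; rewrite normrM exprSr mulrA ler_wpM2r // f'le.
have cf y : `|y| <= 2^-1 -> {for y, continuous f}.
  by move=> /df dfy; apply: differentiable_continuous; apply/derivable1_diffP; case: dfy.
have [x0|x0] := leP 0 x.
  have in0 y : y \in `[0, x] -> `|y| <= `|x|.
    by rewrite in_itv /= => /andP[y0 yx]; rewrite !ger0_norm.
  have [||c cx] := @MVT_segment _ f f' 0 x x0.
  - move=> y yx; apply: df; apply: le_trans x12; apply: in0.
    exact: subset_itv_oo_cc yx.
  - apply: continuous_in_subspaceT => y; rewrite inE => yx.
    by apply: cf; apply: le_trans x12; apply: in0.
  by rewrite f0 !subr0 => fc; exists c => //; exact: in0.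
have in0 y : y \in `[x, 0] -> `|y| <= `|x|.
  by rewrite in_itv /= => /andP[y0 yx]; rewrite !ler0_norm ?lerN2 // ltW.
have [||c cx] := @MVT_segment _ f f' x 0 (ltW x0).
- move=> y yx; apply: df; apply: le_trans x12; apply: in0.
  exact: subset_itv_oo_cc yx.
- apply: continuous_in_subspaceT => y; rewrite inE => yx.
  by apply: cf; apply: le_trans x12; apply: in0.
rewrite f0 !sub0r mulrN => /oppr_inj fc; exists c => //; exact: in0.
Qed.

(** The logarithm of the rank-two determinant ratio: with
    x_1, x_2 = e (al +- sqrt be) / 2 it is ln (1 + x_1) + ln (1 + x_2). *)
Lemma ln_det_ratio (e al be m : R) : 0 <= be -> `|al| <= m -> Num.sqrt be <= m ->
  `|e| * m <= 2^-1 ->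
  let q := (1 + e / 2 * al) ^+ 2 - (e / 2) ^+ 2 * be in
  0 < q /\ `|ln q - (e * al - e ^+ 2 * (al ^+ 2 + be) / 4)| <= 4 * (`|e| * m) ^+ 3.
Proof.
move=> be0 alm bem em q.
pose x1 := e * (al + Num.sqrt be) / 2; pose x2 := e * (al - Num.sqrt be) / 2.
have m0 : 0 <= m by rewrite (le_trans _ alm).
have xle (w : R) : `|w| <= 2 * m -> `|e * w / 2| <= `|e| * m.
  move=> wm; rewrite !normrM normfV (ger0_norm (x := 2)) //.
  rewrite -mulrA ler_wpM2l // ler_pdivrMr // mulrC //.
have x1le : `|x1| <= `|e| * m.
  apply: xle; rewrite (le_trans (ler_normD _ _)) //.
  by rewrite (ger0_norm (sqrtr_ge0 _)); lra.
have x2le : `|x2| <= `|e| * m.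
  apply: xle; rewrite (le_trans (ler_normB _ _)) //.
  by rewrite (ger0_norm (sqrtr_ge0 _)); lra.
have sbe := sqr_sqrtr be0.
have qE : q = (1 + x1) * (1 + x2) by rewrite /q /x1 /x2 -{1}sbe; field.
have pos (w : R) : `|w| <= `|e| * m -> 0 < 1 + w.
  by move=> /le_trans/(_ em); rewrite ler_norml => /andP[]; lra.
have p1 := pos _ x1le; have p2 := pos _ x2le.
split; first by rewrite qE mulr_gt0.
rewrite qE lnM ?posrE //.
have -> : e * al - e ^+ 2 * (al ^+ 2 + be) / 4 = x1 - x1 ^+ 2 / 2 + (x2 - x2 ^+ 2 / 2).
  by rewrite /x1 /x2 -{1}sbe; field.
have -> : ln (1 + x1) + ln (1 + x2) - (x1 - x1 ^+ 2 / 2 + (x2 - x2 ^+ 2 / 2)) =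
  (ln (1 + x1) - x1 + x1 ^+ 2 / 2) + (ln (1 + x2) - x2 + x2 ^+ 2 / 2) by ring.
rewrite (le_trans (ler_normD _ _)) //.
have c (w : R) : `|w| <= `|e| * m ->
    `|ln (1 + w) - w + w ^+ 2 / 2| <= 2 * (`|e| * m) ^+ 3.
  move=> wm; apply: le_trans (ln_taylor2 (le_trans wm em)) _.
  by rewrite ler_wpM2l // lerXn2r ?nnegrE // mulr_ge0.
by have := c _ x1le; have := c _ x2le; lra.
Qed.
End Scalar.

(** * The shifted likelihood *)
Section Likelihood.
Variables (R : realType) (n p : nat).
Hypothesis n0 : (0 < n)%N.
Implicit Types (x y : 'I_n -> 'cV[R]_p).

Let nR0 : n%:R != 0 :> R. Proof. by rewrite pnatr_eq0 -lt0n. Qed.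

Lemma scov_decomp x mu :
  scov x mu = scov x (smean x) + (smean x - mu) *m (smean x - mu)^T.
Proof.
rewrite /scov; set m := smean x; set h := m - mu.
have sm : \sum_i (x i - m) = 0.
  rewrite sumrB sumr_const card_ord -scaler_nat /m /smean scalerA mulfV // scale1r.
  by rewrite subrr.
transitivity (n%:R^-1 *: \sum_i ((x i - m) *m (x i - m)^T + (x i - m) *m h^T
               + (h *m (x i - m)^T + h *m h^T))).
  congr (_ *: _); apply: eq_bigr => i _.
  have -> : x i - mu = (x i - m) + h by rewrite /h addrA subrK.
  by clearbody h; rewrite linearD /= mulmxDl !mulmxDr.
rewrite !big_split /= -mulmx_suml -mulmx_sumr -linear_sum /= sm trmx0 mul0mx mulmx0.
rewrite addr0 add0r sumr_const card_ord scalerDr; congr (_ + _).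
by rewrite -(scaler_nat n (h *m h^T)) scalerA mulVf // scale1r.
Qed.

Lemma scov_sym x mu : (scov x mu)^T = scov x mu.
Proof.
rewrite /scov linearZ linear_sum /=; congr (_ *: _); apply: eq_bigr => i _.
by rewrite trmx_mul trmxK.
Qed.

Lemma Sigma_hat_sym x y : (Sigma_hat x y)^T = Sigma_hat x y.
Proof. by rewrite /Sigma_hat linearZ linearD /= !scov_sym. Qed.

(** Sufficiency of the two means and the pooled covariance, from scov_decomp. *)
Lemma loglik_sufficient x y th :
  loglik x y th = n%:R * ln (\det (Omega th))
   - n%:R * \tr (Omega th *m Sigma_hat x y)
   - n%:R / 2 * (dotv (smean x - muX th) (Omega th *m (smean x - muX th))
                 + dotv (smean y - muY th) (Omega th *m (smean y - muY th))).
Proof.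
rewrite /loglik /loglik1 (scov_decomp x) (scov_decomp y).
rewrite /Sigma_hat -scalemxAr mxtraceZ.
rewrite !(mulmxDr (Omega th) (scov _ _)) !mxtraceD !mxtrace_outer.
by field.
Qed.

End Likelihood.

Section ShiftIdentity.
Variables (R : realType) (n p : nat) (z : 'cV[R]_p) (ths : param R p).
Variables (x y : 'I_n -> 'cV[R]_p) (t : R).
Hypotheses (n0 : (0 < n)%N) (Om_pos : posdef (Omega ths)).
Hypothesis V0 : 0 < V z ths.
Local Notation Om := (Omega ths).
Local Notation u := (mean_gap ths).
Local Notation v := (mean_mid z ths).
Local Notation r := (Num.sqrt n%:R : R).
Local Notation e := (t / (r * V z ths)).
Local Notation xX := (xiX z ths).
Local Notation xY := (xiY z ths).

(** The determinant of Omega_t is that of Omega times a quadratic polynomial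
    determined by these two numbers at S = Sigma. *)
Definition quad_al (S : 'M[R]_p) := dotv (Om *m u) (S *m (Om *m v)).
Definition quad_be (S : 'M[R]_p) :=
  dotv (Om *m u) (S *m (Om *m u)) * dotv (Om *m v) (S *m (Om *m v)).

(** The error of the linearization of Delta at the true parameter, as a function
    of the means and of Sigma. *)
Definition Delta_rem (th : param R p) :=
  Delta z th - Delta z ths -
  (quad_al (Sigma th - Sigma ths) + dotv xX (Om *m (muX th - muX ths))
   + dotv xY (Om *m (muY th - muY ths))).

Definition plug_in : param R p := (smean x, smean y, invmx (Sigma_hat x y)).

(** In this form V^2 cancels the second order terms of the likelihood ratio. *)
Lemma V_sqr_star : V z ths ^+ 2 / 2 =
  (quad_al (Sigma ths) ^+ 2 + quad_be (Sigma ths)) / 4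
  + (dotv xX (Om *m xX) + dotv xY (Om *m xY)) / 2.
Proof.
have [Os _] := Om_pos; have Ou := posdef_unit Om_pos.
rewrite V_sqr // /quad_al /quad_be /Sigma !mulKmx // !dotv_mull Os.
rewrite /xiX /xiY /mean_gap /mean_mid.
set a := z - muX ths; set b := z - muY ths.
have -> : muY ths - z = - b by rewrite opprB.
have -> : muY ths - muX ths = a - b by rewrite /a /b opprB [RHS]addrC addrA subrK.
clearbody a b; rewrite -!scalemxAr !(mulmxDr, mulmxN).
rewrite !(dotvZl, dotvZr, dotvDl, dotvDr, dotvBl, dotvBr, dotvNl, dotvNr).
by rewrite (dotv_sym b a Os); field.
Qed.

(** Exact comparison of the shifted log-likelihood ratio with its Gaussian
    counterpart; every term on the right is negligible near the truth. *)
Lemma loglik_shift_identity th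
    (g := smean x - muX th) (f := smean y - muY th)
    (Omt := Omega (lda_shift z n ths t th))
    (q := (1 + e / 2 * quad_al (Sigma th)) ^+ 2 - (e / 2) ^+ 2 * quad_be (Sigma th)) :
  posdef (Omega th) -> Sigma_hat x y \in unitmx -> 0 < q ->
  loglik x y (lda_shift z n ths t th) - loglik x y th
  - (t * (r * (V z ths)^-1 * (Delta z th - Delta_hat z x y)) - t ^+ 2 / 2) =
  n%:R * (ln q - (e * quad_al (Sigma th)
                  - e ^+ 2 * (quad_al (Sigma th) ^+ 2 + quad_be (Sigma th)) / 4))
  - n%:R * e ^+ 2 / 4 * (quad_al (Sigma th) ^+ 2 + quad_be (Sigma th)
      - (quad_al (Sigma ths) ^+ 2 + quad_be (Sigma ths)))
  - n%:R * e * (dotv g (Phi z ths *m g) + dotv f (Phi z ths *m f))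
  - n%:R * e * (dotv xX ((Omt - Om) *m g) + dotv xY ((Omt - Om) *m f))
  - n%:R * e ^+ 2 / 2 * (dotv xX ((Omt - Om) *m xX) + dotv xY ((Omt - Om) *m xY))
  - n%:R * e * (Delta_rem th - Delta_rem plug_in).
Proof.
move=> Opos Su q0.
have [Os _] := Opos; have Ou := posdef_unit Opos.
have Phis : (Phi z ths)^T = Phi z ths by exact: Phi_sym.
have OmtE : Omt = Omega th + (2 * e) *: Phi z ths by rewrite /Omt /lda_shift /Omega /= mulrA.
have Omts : Omt^T = Omt by rewrite OmtE linearD linearZ /= Os Phis.
have r0 : 0 < r by rewrite sqrtr_gt0 ltr0n.
have nr : n%:R = r ^+ 2 by rewrite sqr_sqrtr // ler0n.
have detE : \det Omt = \det (Omega th) * q.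
  rewrite OmtE Phi_rank2 // scalerA (_ : 2 * e * 4^-1 = e / 2); last by field; rewrite !gt_eqF.
  rewrite (@det_rank2_update _ _ _ (Sigma th)) ?mulmxV // /Sigma.
  by case: (posdef_inv Opos).
have lnE : ln (\det Omt) = ln (\det (Omega th)) + ln q.
  by rewrite detE lnM // posrE posdef_det.
rewrite !loglik_sufficient // -/Omt lnE.
have -> : \tr (Omt *m Sigma_hat x y) =
   \tr (Omega th *m Sigma_hat x y) + e * quad_al (Sigma_hat x y).
  rewrite OmtE mulmxDl mxtraceD -scalemxAl mxtraceZ mxtrace_Phi_mul ?Sigma_hat_sym //.
  by rewrite /quad_al; move: (t / _) (dotv _ _) => e' q'; field.
have -> : smean x - muX (lda_shift z n ths t th) = g + e *: xX.
  by rewrite /g /lda_shift {1}/muX /= opprB addrCA addrC.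
have -> : smean y - muY (lda_shift z n ths t th) = f + e *: xY.
  by rewrite /f /lda_shift {1}/muY /= opprB addrCA addrC.
have quadE (w xi : 'cV[R]_p) : dotv (w + e *: xi) (Omt *m (w + e *: xi)) =
    dotv w (Omega th *m w) + 2 * e * dotv w (Phi z ths *m w)
    + 2 * e * dotv xi (Omt *m w) + e ^+ 2 * dotv xi (Omt *m xi).
  rewrite mulmxDr -scalemxAr !(dotvDl, dotvDr, dotvZl, dotvZr) (dotv_sym w xi Omts).
  rewrite {1}OmtE mulmxDl -scalemxAl dotvDr dotvZr.
  set w1 := dotv _ _; set w2 := dotv _ _; set w3 := dotv _ _; set w4 := dotv _ _; ring.
rewrite !quadE.
have -> : Delta z th - Delta_hat z x y =
  quad_al (Sigma th) - quad_al (Sigma_hat x y) - dotv xX (Om *m g) - dotv xY (Om *m f)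
  + Delta_rem th - Delta_rem plug_in.
  rewrite /Delta_rem /plug_in /Delta_hat.
  have -> : quad_al (Sigma (smean x, smean y, invmx (Sigma_hat x y)) - Sigma ths) =
     quad_al (Sigma_hat x y) - quad_al (Sigma ths).
    by rewrite /Sigma /= invmxK /quad_al mulmxBl dotvBr.
  have -> : quad_al (Sigma th - Sigma ths) = quad_al (Sigma th) - quad_al (Sigma ths).
    by rewrite /quad_al mulmxBl dotvBr.
  rewrite /g /f {3}/muX {3}/muY /= !(mulmxDr, mulmxN, dotvDr, dotvNr); ring.
rewrite !mulmxBl !dotvBr.
have VE : n%:R * e ^+ 2 * (V z ths ^+ 2 / 2) = t ^+ 2 / 2.
  by move: nr r0; move: (Num.sqrt (n%:R : R)) => rr; move: (n%:R : R) => N -> rr0; field; rewrite !gt_eqF.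
rewrite -VE V_sqr_star.
have -> : forall w, t * (r * (V z ths)^-1 * w) = n%:R * e * w.
  move=> w; move: nr r0; move: (Num.sqrt (n%:R : R)) => rr; move: (n%:R : R) => N -> rr0.
  by field; rewrite !gt_eqF.
move: (ln q) (ln _) (Delta_rem th) (Delta_rem plug_in) e => a1 a2 a3 a4 a5.
by field.
Qed.

End ShiftIdentity.

(** * Perturbation bounds *)
Section Perturbation.
Variables (R : realType) (p : nat) (C : R).
Hypothesis C1 : 1 <= C.

Let C0 : 0 <= C. Proof. exact: le_trans ler01 C1. Qed.

(** Cauchy-Schwarz for the form Om, applied to w and invmx Om *m w. *)
Lemma posdef_lower (Om : 'M[R]_p) w : posdef Om -> opbound (invmx Om) C ->
  euclnorm w ^+ 2 <= C * dotv w (Om *m w).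
Proof.
move=> Op SC; have Ou := posdef_unit Op; set S := invmx Om.
have := possemidef_CS w (S *m w) (posdef_semi Op).
rewrite mulKVmx // -euclnorm_sqr (dotvC (S *m w)).
have : dotv w (S *m w) <= C * euclnorm w ^+ 2.
  by rewrite expr2 (le_trans (ler_norm _)) // opbound_dotv.
have := dotv_ge0 w; rewrite -euclnorm_sqr; set E := euclnorm w ^+ 2 => E0.
have qw : 0 <= dotv w (Om *m w) by rewrite -qformE; case: (posdef_semi Op).
move=> SE; have [->|En] := eqVneq E 0; first by rewrite mulr_ge0.
have Ep : 0 < E by rewrite lt_neqAle eq_sym En.
move=> H; rewrite -(ler_pM2l Ep) -expr2 (le_trans H) //.
rewrite (_ : E * _ = dotv w (Om *m w) * (C * E)); last by ring.
by rewrite ler_wpM2l.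
Qed.

(** The vector w = invmx M *m y solves w = Om *m y - Om *m ((M - Sg) *m w), in
    which the last term is a contraction. *)
Lemma inverse_opbound (Om Sg M : 'M[R]_p) s : Om *m Sg = 1%:M -> M \in unitmx ->
  opbound Om C -> opbound (M - Sg) s -> C * s <= 2^-1 -> opbound (invmx M) (2 * C).
Proof.
move=> OS Mu OC Ds Cs y; set w := invmx M *m y.
have wE : w = Om *m y - Om *m ((M - Sg) *m w).
  by rewrite !mulmxBl mulmxBr (mulmxA Om Sg) OS mul1mx /w mulKVmx // opprB addrC subrK.
have : euclnorm w <= C * euclnorm y + 2^-1 * euclnorm w.
  rewrite {1}wE (le_trans (euclnormB _ _)) // lerD // (le_trans (OC _)) //.
  apply: le_trans (ler_wpM2l C0 (Ds w)) _.
  by rewrite mulrA ler_wpM2r ?euclnorm_ge0.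
lra.
Qed.

Lemma perturbed_unitmx (Om Sg M : 'M[R]_p) s : Om *m Sg = 1%:M ->
  opbound Om C -> opbound (M - Sg) s -> C * s <= 2^-1 -> M \in unitmx.
Proof.
move=> OS OC Ds Cs; apply: inj_unitmx => w Mw0; apply: euclnorm_eq0.
have wE : w = - (Om *m ((M - Sg) *m w)).
  by rewrite !mulmxBl Mw0 sub0r mulmxN opprK mulmxA OS mul1mx.
have : euclnorm w <= 2^-1 * euclnorm w.
  rewrite {1}wE euclnormN (le_trans (OC _)) //.
  apply: le_trans (ler_wpM2l C0 (Ds w)) _.
  by rewrite mulrA ler_wpM2r ?euclnorm_ge0.
by have := euclnorm_ge0 w; lra.
Qed.

Variables (z : 'cV[R]_p) (ths : param R p).
Hypothesis Om_pos : posdef (Omega ths).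
Hypothesis OmC : opbound (Omega ths) C.
Hypothesis SgC : opbound (Sigma ths) C.
Hypothesis V0 : 0 < V z ths.
Hypothesis VC : 1 <= C * V z ths.
Local Notation Om := (Omega ths).
Local Notation u := (mean_gap ths).
Local Notation v := (mean_mid z ths).

(** These follow from V_sqr.  They let every error bound carry a factor V, which
    may be arbitrarily large. *)
Lemma mean_bounds :
  [/\ euclnorm u <= C * V z ths, euclnorm v <= C * V z ths &
      euclnorm u * euclnorm v <= 2 * C * V z ths].
Proof.
have CV0 : 0 <= C * V z ths by rewrite mulr_ge0 // ltW.
have := V_sqr z Om_pos.
have := posdef_lower u Om_pos SgC; have := posdef_lower v Om_pos SgC.
set qu := dotv u _; set qv := dotv v (Om *m v); set quv := dotv u _ => Hv Hu VE.
have quv0 := sqr_ge0 quv.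
have qu0 : 0 <= qu by rewrite /qu -qformE; case: (posdef_semi Om_pos).
have qv0 : 0 <= qv by rewrite /qv -qformE; case: (posdef_semi Om_pos).
have qq := mulr_ge0 qu0 qv0.
have le1 (w : R) : 0 <= w -> C * w <= C ^+ 2 * w.
  by move=> w0; rewrite ler_wpM2r // expr2 ler_peMl.
split; rewrite -ler_sqr ?nnegrE ?mulr_ge0 ?euclnorm_ge0 ?(ltW V0) //.
- rewrite (le_trans Hu) // exprMn (le_trans (le1 _ qu0)) //.
  by rewrite ler_wpM2l ?sqr_ge0 // VE; lra.
- rewrite (le_trans Hv) // exprMn (le_trans (le1 _ qv0)) //.
  by rewrite ler_wpM2l ?sqr_ge0 // VE; lra.
rewrite exprMn (le_trans (ler_pM _ _ Hu Hv)) ?sqr_ge0 //.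
rewrite (_ : C * qu * (C * qv) = C ^+ 2 * (qu * qv)); last by ring.
rewrite (_ : (2 * C * V z ths) ^+ 2 = C ^+ 2 * (4 * V z ths ^+ 2)); last by ring.
by rewrite ler_wpM2l ?sqr_ge0 // VE; lra.
Qed.

(** Each term of the remainder in Delta_expand has two factors of size rho; the
    norms of u and v are absorbed by V. *)
Lemma Delta_rem_bound th rho (D := Sigma th - Sigma ths) :
  0 <= rho ->
  (Omega th)^T = Omega th -> Omega th \in unitmx -> opbound (Omega th) (2 * C) ->
  euclnorm (D *m (Om *m u)) <= rho * euclnorm u ->
  euclnorm (D *m (Om *m v)) <= rho * euclnorm v ->
  euclnorm (muX th - muX ths) <= rho -> euclnorm (muY th - muY ths) <= rho ->
  `|Delta_rem z ths th| <= 16 * C ^+ 2 * rho ^+ 2 * V z ths.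
Proof.
move=> rho0 Os Ou OC Du Dv kr lr.
rewrite /Delta_rem Delta_expand // -/D.
set k := muX th - muX ths; set l := muY th - muY ths; rewrite /quad_al -/D.
set lin := (X in `|X + _ - _|). rewrite (addrC lin) addrK /lin {lin}.
have [uC vC uvC] := mean_bounds.
have bd (a b : 'cV[R]_p) ca cb : euclnorm a <= ca -> euclnorm b <= cb ->
    `|dotv a (Omega th *m b)| <= 2 * C * (ca * cb).
  move=> ha hb; rewrite (le_trans (opbound_dotv a b OC)) //.
  by rewrite ler_wpM2l ?mulr_ge0 // ler_pM ?euclnorm_ge0.
have klD : euclnorm (k + l) <= 2 * rho.
  by rewrite (le_trans (euclnormD _ _)) // mulr2n mulrDl mul1r lerD.
have klB : euclnorm (k - l) <= 2 * rho.
  by rewrite (le_trans (euclnormB _ _)) // mulr2n mulrDl mul1r lerD.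
have b1 := bd _ _ _ _ Du Dv; have b2 := bd _ _ _ _ Du klD.
have b3 := bd _ _ _ _ Dv klB; have b4 := bd _ _ _ _ kr kr; have b5 := bd _ _ _ _ lr lr.
set e1 := dotv _ _ in b1 *; set e2 := dotv _ _ in b2 *; set e3 := dotv _ _ in b3 *.
rewrite -/k in b4; rewrite -/l in b5.
set e4 := dotv k _ in b4 *; set e5 := dotv l _ in b5 *.
have -> : `| - e1 - e2 - e3 - e4 + e5| = `| (e1 + e2 + e3 + e4) + - e5|.
  by rewrite -normrN; congr (`| _ |); ring.
have T : `|(e1 + e2 + e3 + e4) + - e5| <= `|e1| + `|e2| + `|e3| + `|e4| + `|e5|.
  rewrite (le_trans (ler_normB _ _)) // lerD //.
  by rewrite (le_trans (ler_normD _ _)) // lerD // (le_trans (ler_normD _ _)) // lerD // ler_normD.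
apply: (le_trans T).
set uu := euclnorm u in uC uvC b1 b2; set vv := euclnorm v in vC uvC b1 b3.
have r2 := sqr_ge0 rho.
pose K := 2 * C * rho ^+ 2; have K0 : 0 <= K by rewrite /K !mulr_ge0.
have c1 : `|e1| <= K * (2 * C * V z ths).
  apply: le_trans b1 _; rewrite (_ : 2 * C * _ = K * (uu * vv)); last by rewrite /K; ring.
  by rewrite ler_wpM2l.
have c2 : `|e2| <= K * (2 * (C * V z ths)).
  apply: le_trans b2 _; rewrite (_ : 2 * C * _ = K * (2 * uu)); last by rewrite /K; ring.
  by rewrite ler_wpM2l // ler_wpM2l.
have c3 : `|e3| <= K * (2 * (C * V z ths)).
  apply: le_trans b3 _; rewrite (_ : 2 * C * _ = K * (2 * vv)); last by rewrite /K; ring.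
  by rewrite ler_wpM2l // ler_wpM2l.
have cK (w : R) : w <= 2 * C * (rho * rho) -> w <= K * (C * V z ths).
  by move=> /le_trans; apply; rewrite -expr2 -/K ler_peMr.
have c4 := cK _ b4; have c5 := cK _ b5.
have -> : 16 * C ^+ 2 * rho ^+ 2 * V z ths = K * (8 * (C * V z ths)) by rewrite /K; ring.
lra.
Qed.

End Perturbation.

(** * Size of the terms of the likelihood expansion *)
Ltac nneg := by do ?[done|apply: sqr_ge0|apply: exprn_ge0|apply: normr_ge0
                      |apply: addr_ge0|apply: mulr_ge0].

Section ShiftBound.
Variable R : realType.

(** The six summands bound, up to the common rate, the six terms on the right of
    loglik_shift_identity. *)
Definition shift_const (C t : R) : R :=
  4 * (4 * C ^+ 4 * `|t|) ^+ 3 + 6 * C ^+ 7 * t ^+ 2 + 2 * C ^+ 3 * `|t|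
  + 4 * C * `|t| * (2 * C ^+ 2 + 2 * C ^+ 3 * `|t|)
  + 4 * C ^+ 2 * t ^+ 2 * (2 * C ^+ 2 + 2 * C ^+ 3 * `|t|)
  + 16 * C ^+ 2 * `|t| * (4 * C ^+ 2 + 1).

(* s and m measure the distance of th to the truth; h, w and rho are the errors
   of the sample means, of Sigma_hat as an operator, and of Sigma_hat along the
   two directions Om u and Om v.  Only rho gets multiplied by sqrt n: the
   operator norm of the covariance error merely has to be small. *)
Variables (C t : R) (n p : nat) (z : 'cV[R]_p) (ths : param R p).
Variables (x y : 'I_n -> 'cV[R]_p) (th : param R p) (s m h w rho kap : R).
Hypotheses (C1 : 1 <= C) (n0 : (0 < n)%N).
Hypotheses (Om_pos : posdef (Omega ths)).
Hypotheses (OmC : opbound (Omega ths) C) (SgC : opbound (Sigma ths) C).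
Hypotheses (V0 : 0 < V z ths) (VC : 1 <= C * V z ths).
Hypothesis Opos : posdef (Omega th).
Local Notation Om := (Omega ths).
Local Notation D := (Sigma th - Sigma ths).
Local Notation W := (Sigma_hat x y - Sigma ths).
Local Notation u := (mean_gap ths).
Local Notation v := (mean_mid z ths).
Local Notation r := (Num.sqrt n%:R : R).
Local Notation Vs := (V z ths).
Local Notation e := (t / (r * Vs)).
Hypotheses (Ds : opbound D s) (Cs : C * s <= 2^-1) (s0 : 0 <= s).
Hypotheses (kX : euclnorm (muX th - muX ths) <= m)
           (kY : euclnorm (muY th - muY ths) <= m).
Hypotheses (hX : euclnorm (smean x - muX ths) <= h)
           (hY : euclnorm (smean y - muY ths) <= h).
Hypotheses (Ww : opbound W w) (Cw : C * w <= 2^-1).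
Hypotheses (Wu : euclnorm (W *m (Om *m u)) <= rho * euclnorm u)
           (Wv : euclnorm (W *m (Om *m v)) <= rho * euclnorm v) (hrho : h <= rho).
Hypotheses (sk : s <= kap) (mhk : m + h <= kap) (rk : r^-1 <= kap)
  (rs : r * s ^+ 2 <= kap) (rmh : r * (m + h) ^+ 2 <= kap)
  (rsmh : r * (s * (m + h)) <= kap) (rrho : r * rho ^+ 2 <= kap)
  (kapt : 4 * C ^+ 4 * `|t| * kap <= 2^-1).

Let C0 : 0 <= C. Proof. exact: le_trans ler01 C1. Qed.
Let m0 : 0 <= m. Proof. exact: le_trans (euclnorm_ge0 _) kX. Qed.
Let h0 : 0 <= h. Proof. exact: le_trans (euclnorm_ge0 _) hX. Qed.
Let rho0 : 0 <= rho. Proof. exact: le_trans h0 hrho. Qed.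
Let kap0 : 0 <= kap. Proof. exact: le_trans s0 sk. Qed.
Let r0 : 0 < r. Proof. by rewrite sqrtr_gt0 ltr0n. Qed.
Let nr : n%:R = r ^+ 2. Proof. by rewrite sqr_sqrtr // ler0n. Qed.
Let Ou : Omega th \in unitmx. Proof. exact: posdef_unit. Qed.
Let Os : (Omega th)^T = Omega th. Proof. by case: Opos. Qed.
Let OmSg : Om *m Sigma ths = 1%:M. Proof. by rewrite mulmxV // posdef_unit. Qed.
Let ne : n%:R * `|e| = `|t| * r / Vs.
Proof.
rewrite normrM normfV (gtr0_norm (mulr_gt0 r0 V0)).
move: nr r0; move: (Num.sqrt (n%:R : R)) => rr; move: (n%:R : R) => N -> rr0.
by field; rewrite !gt_eqF.
Qed.
Let ne2 : n%:R * e ^+ 2 = t ^+ 2 / Vs ^+ 2.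
Proof.
move: nr r0; move: (Num.sqrt (n%:R : R)) => rr; move: (n%:R : R) => N -> rr0.
by field; rewrite !gt_eqF.
Qed.
Let eV : `|e| * Vs = `|t| * r^-1.
Proof. by rewrite normrM normfV (gtr0_norm (mulr_gt0 r0 V0)); field; rewrite !gt_eqF. Qed.

Let Onorm : opbound (Omega th) (2 * C).
Proof.
rewrite -(invmxK (Omega th)).
by apply: (inverse_opbound C1 OmSg _ OmC Ds Cs); rewrite unitmx_inv.
Qed.

Let Shu : Sigma_hat x y \in unitmx.
Proof. exact: (perturbed_unitmx C1 OmSg OmC Ww Cw). Qed.

Let hatnorm : opbound (invmx (Sigma_hat x y)) (2 * C).
Proof. exact: (inverse_opbound C1 OmSg Shu OmC Ww Cw). Qed.

Let U := euclnorm (Om *m u).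
Let U' := euclnorm (Om *m v).

Let UU : U * U' <= 2 * C ^+ 3 * Vs.
Proof.
have [_ _ uv] := mean_bounds C1 Om_pos SgC V0.
apply: le_trans (_ : (C * euclnorm u) * (C * euclnorm v) <= _).
  by apply: ler_pM; rewrite ?euclnorm_ge0 //; exact: OmC.
rewrite (_ : C * _ * _ = C ^+ 2 * (euclnorm u * euclnorm v)); last by ring.
rewrite (_ : 2 * C ^+ 3 * Vs = C ^+ 2 * (2 * C * Vs)); last by ring.
by rewrite ler_wpM2l ?sqr_ge0.
Qed.

Let Signorm : opbound (Sigma th) (2 * C).
Proof.
move=> b; have -> : Sigma th = D + Sigma ths by rewrite subrK.
rewrite mulmxDl (le_trans (euclnormD _ _)) //.
have sC : s <= C by have : s <= C * s by [rewrite ler_peMl]; move: Cs C1; lra.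
have := le_trans (Ds b) (ler_wpM2r (euclnorm_ge0 b) sC).
by have := SgC b; rewrite -mulrA; lra.
Qed.

Let UU0 : 0 <= U * U'. Proof. by rewrite mulr_ge0 ?euclnorm_ge0. Qed.
Let C3V : 0 <= 2 * C ^+ 3 * Vs. Proof. exact: le_trans UU0 UU. Qed.

Let al_bound S c : 0 <= c -> opbound S c -> `|quad_al z ths S| <= c * (2 * C ^+ 3 * Vs).
Proof.
by move=> c0 Sc; rewrite (le_trans (opbound_dotv _ _ Sc)) // ler_wpM2l.
Qed.

Let M := 4 * C ^+ 4 * Vs.

Let alM : `|quad_al z ths (Sigma th)| <= M.
Proof.
apply: le_trans (al_bound _ Signorm) _; first by rewrite mulr_ge0.
by rewrite /M le_eqVlt; apply/orP; left; apply/eqP; ring.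
Qed.

Let be_ge0 S : possemidef S -> 0 <= quad_be z ths S.
Proof. by move=> Sp; rewrite /quad_be mulr_ge0 // -qformE; case: Sp. Qed.

Let beM : Num.sqrt (quad_be z ths (Sigma th)) <= M.
Proof.
have M0 : 0 <= M by rewrite /M !mulr_ge0 ?exprn_ge0 // ltW.
rewrite -[M]ger0_norm // -sqrtr_sqr ler_wsqrtr //.
apply: le_trans (_ : (2 * C * (U * U)) * (2 * C * (U' * U')) <= _).
  rewrite ler_pM //; try by rewrite -qformE; case: (posdef_semi (posdef_inv Opos)).
  - by rewrite (le_trans (ler_norm _)) // opbound_dotv.
  - by rewrite (le_trans (ler_norm _)) // opbound_dotv.
rewrite (_ : 2 * C * _ * _ = (2 * C) ^+ 2 * (U * U') ^+ 2); last by ring.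
rewrite (_ : M ^+ 2 = (2 * C) ^+ 2 * (2 * C ^+ 3 * Vs) ^+ 2); last by rewrite /M; ring.
by rewrite ler_wpM2l ?sqr_ge0 // lerXn2r ?nnegrE.
Qed.

Let eM : `|e| * M <= 4 * C ^+ 4 * `|t| * kap.
Proof.
rewrite (_ : _ * M = 4 * C ^+ 4 * (`|e| * Vs)); last by rewrite /M; ring.
by rewrite eV mulrA ler_wpM2l // mulr_ge0 // mulr_ge0 ?exprn_ge0.
Qed.

Let logdet_error (q := (1 + e / 2 * quad_al z ths (Sigma th)) ^+ 2
             - (e / 2) ^+ 2 * quad_be z ths (Sigma th)) :
  0 < q /\ `|n%:R * (ln q - (e * quad_al z ths (Sigma th) - e ^+ 2 *
     (quad_al z ths (Sigma th) ^+ 2 + quad_be z ths (Sigma th)) / 4))|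
   <= 4 * (4 * C ^+ 4 * `|t|) ^+ 3 * kap.
Proof.
have be0 := be_ge0 (posdef_semi (posdef_inv Opos)).
have [q0 qb] := ln_det_ratio be0 alM beM (le_trans eM kapt).
split=> //; rewrite normrM ger0_norm ?ler0n //.
apply: le_trans (ler_wpM2l (ler0n _ _) qb) _.
have -> : `|e| * M = 4 * C ^+ 4 * `|t| * r^-1.
  by rewrite (_ : _ * M = 4 * C ^+ 4 * (`|e| * Vs)); [rewrite eV mulrA|rewrite /M; ring].
have -> : n%:R * (4 * (4 * C ^+ 4 * `|t| * r^-1) ^+ 3) =
          4 * (4 * C ^+ 4 * `|t|) ^+ 3 * r^-1.
  move: nr r0; move: (Num.sqrt (n%:R : R)) => rr; move: (n%:R : R) => N -> rr0.
  by field; rewrite !gt_eqF.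
by rewrite ler_wpM2l // mulr_ge0 // exprn_ge0 // !mulr_ge0 ?exprn_ge0.
Qed.

Let variance_error : `|n%:R * e ^+ 2 / 4 * (quad_al z ths (Sigma th) ^+ 2 + quad_be z ths (Sigma th)
      - (quad_al z ths (Sigma ths) ^+ 2 + quad_be z ths (Sigma ths)))|
   <= 6 * C ^+ 7 * t ^+ 2 * kap.
Proof.
pose K := 2 * C ^+ 3 * Vs; have K0 : 0 <= K := C3V; have UK : U * U' <= K := UU.
set a1 := quad_al z ths (Sigma th); set a0 := quad_al z ths (Sigma ths).
set b1 := quad_be z ths (Sigma th); set b0 := quad_be z ths (Sigma ths).
have aD : `|a1 - a0| <= s * K by rewrite /a1 /a0 /quad_al -dotvBr -mulmxBl al_bound.
have a1b : `|a1| <= 2 * C * K by rewrite al_bound // mulr_ge0.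
have a0b : `|a0| <= C * K by rewrite al_bound.
have dA : `|a1 ^+ 2 - a0 ^+ 2| <= s * K * (3 * C * K).
  rewrite subr_sqr normrM ler_pM // (le_trans (ler_normD _ _)) //.
  by rewrite (le_trans (lerD a1b a0b)) //; lra.
have dB : `|b1 - b0| <= 3 * C * s * K ^+ 2.
  rewrite /b1 /b0 /quad_be.
  set p1 := dotv _ (Sigma th *m (Om *m u)); set p2 := dotv _ (Sigma th *m _).
  set q1 := dotv _ _; set q2 := dotv _ (Sigma ths *m _).
  have dp1 : `|p1 - q1| <= s * (U * U).
    by rewrite /p1 /q1 -dotvBr -mulmxBl opbound_dotv.
  have dp2 : `|p2 - q2| <= s * (U' * U').
    by rewrite /p2 /q2 -dotvBr -mulmxBl opbound_dotv.
  have p2b : `|p2| <= 2 * C * (U' * U') by rewrite opbound_dotv.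
  have q1b : `|q1| <= C * (U * U) by rewrite opbound_dotv.
  have -> : p1 * p2 - q1 * q2 = (p1 - q1) * p2 + q1 * (p2 - q2) by ring.
  rewrite (le_trans (ler_normD _ _)) // !normrM.
  apply: le_trans (lerD (ler_pM _ _ dp1 p2b) (ler_pM _ _ q1b dp2)) _ => //.
  rewrite (_ : _ + _ = 3 * C * s * (U * U') ^+ 2); last by ring.
  by rewrite ler_wpM2l ?mulr_ge0 // lerXn2r ?nnegrE.
rewrite normrM (ger0_norm (x := n%:R * e ^+ 2 / 4)); last first.
  by rewrite mulr_ge0 // mulr_ge0 ?sqr_ge0 ?ler0n.
apply: le_trans (_ : n%:R * e ^+ 2 / 4 * (6 * C * s * K ^+ 2) <= _).
  rewrite ler_wpM2l //; first by rewrite mulr_ge0 // mulr_ge0 ?sqr_ge0 ?ler0n.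
  rewrite (_ : a1 ^+ 2 + b1 - _ = (a1 ^+ 2 - a0 ^+ 2) + (b1 - b0)); last by ring.
  rewrite (le_trans (ler_normD _ _)) //.
  apply: le_trans (lerD dA dB) _.
  by rewrite le_eqVlt; apply/orP; left; apply/eqP; ring.
rewrite ne2 (_ : _ / 4 * _ = 6 * C ^+ 7 * t ^+ 2 * s); last by rewrite /K; field; rewrite gt_eqF.
by rewrite ler_wpM2l //; nneg.
Qed.

Let g := smean x - muX th.
Let f := smean y - muY th.
Let gmh : euclnorm g <= m + h.
Proof.
rewrite /g (_ : _ - _ = (smean x - muX ths) - (muX th - muX ths)).
  by rewrite (le_trans (euclnormB _ _)) // addrC lerD.
by rewrite opprB addrA subrK.
Qed.
Let fmh : euclnorm f <= m + h.
Proof.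
rewrite /f (_ : _ - _ = (smean y - muY ths) - (muY th - muY ths)).
  by rewrite (le_trans (euclnormB _ _)) // addrC lerD.
by rewrite opprB addrA subrK.
Qed.

Let PhiC : opbound (Phi z ths) (C ^+ 3 * Vs).
Proof.
move=> b; rewrite Phi_mul // euclnormZ ger0_norm ?invr_ge0 //.
have E : euclnorm (dotv (Om *m v) b *: (Om *m u) + dotv (Om *m u) b *: (Om *m v))
   <= 2 * (U * U') * euclnorm b.
  rewrite (le_trans (euclnormD _ _)) // !euclnormZ.
  apply: le_trans (_ : U' * euclnorm b * U + U * euclnorm b * U' <= _).
    by rewrite lerD // ler_wpM2r ?euclnorm_ge0 // dotv_CS.
  by rewrite le_eqVlt; apply/orP; left; apply/eqP; ring.
have := ler_wpM2r (euclnorm_ge0 b) UU.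
lra.
Qed.

Let CV3 : 0 <= C ^+ 3 * Vs.
Proof. by rewrite mulr_ge0 ?exprn_ge0 // ltW. Qed.

Let trV0 : 0 <= `|t| * r / Vs.
Proof. by rewrite divr_ge0 // ?mulr_ge0 // ltW. Qed.

Let mean_error : `|n%:R * e * (dotv g (Phi z ths *m g) + dotv f (Phi z ths *m f))|
  <= 2 * C ^+ 3 * `|t| * kap.
Proof.
rewrite normrM normrM ger0_norm ?ler0n // ne.
apply: le_trans (_ : `|t| * r / Vs * (2 * (C ^+ 3 * Vs * ((m + h) * (m + h)))) <= _).
  rewrite ler_wpM2l //.
  have b (a : 'cV[R]_p) : euclnorm a <= m + h ->
      `|dotv a (Phi z ths *m a)| <= C ^+ 3 * Vs * ((m + h) * (m + h)).
    move=> ha; rewrite (le_trans (opbound_dotv _ _ PhiC)) //.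
    by rewrite ler_wpM2l ?ler_pM ?euclnorm_ge0.
  by rewrite (le_trans (ler_normD _ _)) // mulr2n [leRHS]mulrDl !mul1r lerD // b.
rewrite [leLHS](_ : _ = 2 * C ^+ 3 * `|t| * (r * (m + h) ^+ 2)); last first.
  by field; rewrite gt_eqF.
by rewrite ler_wpM2l // mulr_ge0 // mulr_ge0 ?exprn_ge0.
Qed.

Let Omt := Omega (lda_shift z n ths t th).
Let Q := 2 * C ^+ 2 * s + 2 * C ^+ 3 * (`|t| * r^-1).

Let OmtQ : opbound (Omt - Om) Q.
Proof.
move=> b; have -> : (Omt - Om) *m b =
    (2 * e) *: (Phi z ths *m b) - Omega th *m (D *m (Om *m b)).
  have -> : Omega th *m (D *m (Om *m b)) = Om *m b - Omega th *m b.
    rewrite !mulmxA mulmxBr /Sigma mulmxV // -mulmxA mulmxBl mul1mx.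
    by rewrite -(mulmxA (Omega th)) mulKmx // posdef_unit.
  rewrite /Omt /lda_shift {1}/Omega /= -mulrA !mulmxBl mulmxDl -scalemxAl.
  by rewrite opprB addrCA addrA.
apply: le_trans (euclnormB _ _) _; rewrite /Q [leRHS]mulrDl [leLHS]addrC; apply: lerD.
  rewrite (le_trans (Onorm _)) //.
  apply: le_trans (ler_wpM2l (mulr_ge0 (ler0n R 2) C0) (Ds _)) _.
  rewrite (_ : 2 * C ^+ 2 * s * _ = 2 * C * (s * (C * euclnorm b))); last by ring.
  by rewrite !ler_wpM2l // mulr_ge0.
rewrite euclnormZ normrM (ger0_norm (x := 2)) //.
apply: le_trans (ler_wpM2l (mulr_ge0 (ler0n R 2) (normr_ge0 _)) (PhiC _)) _.
rewrite -eV le_eqVlt; apply/orP; left; apply/eqP; ring.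
Qed.

Let rinv0 : 0 <= r^-1. Proof. by rewrite invr_ge0 ltW. Qed.
Let Q0 : 0 <= Q.
Proof. by rewrite /Q addr_ge0 // !mulr_ge0 ?exprn_ge0. Qed.

Let xiC : euclnorm (xiX z ths) <= 2 * C * Vs /\ euclnorm (xiY z ths) <= 2 * C * Vs.
Proof.
have [uC vC _] := mean_bounds C1 Om_pos SgC V0.
have uv : euclnorm u + euclnorm v <= 2 * C * Vs by lra.
split.
  rewrite (_ : xiX z ths = u + v); first exact: le_trans (euclnormD _ _) uv.
  by apply/matrixP => i j; rewrite !mxE; ring.
rewrite (_ : xiY z ths = u - v); first exact: le_trans (euclnormB _ _) uv.
by apply/matrixP => i j; rewrite !mxE; ring.
Qed.

Let cross_error : `|n%:R * e * (dotv (xiX z ths) ((Omt - Om) *m g)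
                       + dotv (xiY z ths) ((Omt - Om) *m f))|
  <= 4 * C * `|t| * (2 * C ^+ 2 + 2 * C ^+ 3 * `|t|) * kap.
Proof.
have [xX xY] := xiC.
rewrite normrM normrM ger0_norm ?ler0n // ne.
apply: le_trans (_ : `|t| * r / Vs * (2 * (Q * ((2 * C * Vs) * (m + h)))) <= _).
  rewrite ler_wpM2l //.
  have b (a c : 'cV[R]_p) : euclnorm a <= 2 * C * Vs -> euclnorm c <= m + h ->
      `|dotv a ((Omt - Om) *m c)| <= Q * ((2 * C * Vs) * (m + h)).
    move=> ha hc; rewrite (le_trans (opbound_dotv _ _ OmtQ)) //.
    by rewrite ler_wpM2l ?ler_pM ?euclnorm_ge0.
  by rewrite (le_trans (ler_normD _ _)) // mulr2n [leRHS]mulrDl !mul1r lerD // b.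
rewrite [leLHS](_ : _ = 4 * C * `|t| * (2 * C ^+ 2 * (r * (s * (m + h)))
      + 2 * C ^+ 3 * `|t| * (m + h))); last first.
  by rewrite /Q; field; rewrite !gt_eqF.
rewrite -[leRHS]mulrA; apply: ler_wpM2l; first by nneg.
by rewrite [leRHS]mulrDl; apply: lerD; apply: ler_wpM2l => //; nneg.
Qed.

Let square_error : `|n%:R * e ^+ 2 / 2 * (dotv (xiX z ths) ((Omt - Om) *m xiX z ths)
                       + dotv (xiY z ths) ((Omt - Om) *m xiY z ths))|
  <= 4 * C ^+ 2 * t ^+ 2 * (2 * C ^+ 2 + 2 * C ^+ 3 * `|t|) * kap.
Proof.
have [xX xY] := xiC.
have n2 : 0 <= t ^+ 2 / Vs ^+ 2 / 2 by rewrite !divr_ge0 ?sqr_ge0.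
rewrite ne2 normrM (ger0_norm n2).
apply: le_trans (_ : t ^+ 2 / Vs ^+ 2 / 2 * (2 * (Q * ((2 * C * Vs) * (2 * C * Vs)))) <= _).
  rewrite ler_wpM2l //.
  have b (a : 'cV[R]_p) : euclnorm a <= 2 * C * Vs ->
      `|dotv a ((Omt - Om) *m a)| <= Q * ((2 * C * Vs) * (2 * C * Vs)).
    move=> ha; rewrite (le_trans (opbound_dotv _ _ OmtQ)) //.
    by rewrite ler_wpM2l ?ler_pM ?euclnorm_ge0.
  by rewrite (le_trans (ler_normD _ _)) // mulr2n [leRHS]mulrDl !mul1r lerD // b.
rewrite [leLHS](_ : _ = 4 * C ^+ 2 * t ^+ 2 * (2 * C ^+ 2 * s
      + 2 * C ^+ 3 * `|t| * r^-1)); last first.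
  by rewrite /Q; field; rewrite !gt_eqF.
rewrite -[leRHS]mulrA; apply: ler_wpM2l; first by nneg.
by rewrite [leRHS]mulrDl; apply: lerD; apply: ler_wpM2l => //; nneg.
Qed.

Let rho1 := C * s + m.

Let remth : `|Delta_rem z ths th| <= 16 * C ^+ 2 * rho1 ^+ 2 * Vs.
Proof.
have Cs0 : 0 <= C * s by rewrite mulr_ge0.
have DO b : euclnorm (D *m (Om *m b)) <= rho1 * euclnorm b.
  rewrite (le_trans (Ds _)) //.
  apply: le_trans (ler_wpM2l s0 (OmC b)) _.
  by rewrite mulrA ler_wpM2r ?euclnorm_ge0 // mulrC /rho1 lerDl.
have mrho : m <= rho1 by rewrite /rho1 lerDr.
apply: (Delta_rem_bound C1) => //; first by rewrite addr_ge0.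
  exact: le_trans kX mrho.
exact: le_trans kY mrho.
Qed.

Let remhat : `|Delta_rem z ths (plug_in x y)| <= 16 * C ^+ 2 * rho ^+ 2 * Vs.
Proof.
apply: (Delta_rem_bound C1) => //; rewrite /plug_in /Sigma /muX /muY /Omega /= ?invmxK //.
- by rewrite trmx_inv Sigma_hat_sym.
- by rewrite unitmx_inv.
- exact: le_trans hX hrho.
- exact: le_trans hY hrho.
Qed.

Let remainder_error : `|n%:R * e * (Delta_rem z ths th - Delta_rem z ths (plug_in x y))|
  <= 16 * C ^+ 2 * `|t| * (4 * C ^+ 2 + 1) * kap.
Proof.
rewrite normrM normrM ger0_norm ?ler0n // ne.
apply: le_trans (_ : `|t| * r / Vs * (16 * C ^+ 2 * rho1 ^+ 2 * Vs
    + 16 * C ^+ 2 * rho ^+ 2 * Vs) <= _).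
  rewrite ler_wpM2l //.
  by rewrite (le_trans (ler_normB _ _)) // lerD.
rewrite [leLHS](_ : _ = 16 * C ^+ 2 * `|t| * (r * rho1 ^+ 2 + r * rho ^+ 2)); last first.
  by field; rewrite !gt_eqF.
rewrite -[leRHS]mulrA; apply: ler_wpM2l; first by nneg.
rewrite [leRHS]mulrDl mul1r; apply: lerD => //.
have rm2 : r * m ^+ 2 <= kap.
  apply: le_trans rmh; apply: ler_wpM2l (ltW r0) _ _ _.
  rewrite lerXn2r ?nnegrE ?addr_ge0 //.
  by rewrite lerDl.
apply: le_trans (_ : 2 * C ^+ 2 * (r * s ^+ 2) + 2 * (r * m ^+ 2) <= _).
  rewrite (_ : 2 * C ^+ 2 * _ + _ = r * (2 * ((C * s) ^+ 2 + m ^+ 2))); last by ring.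
  apply: ler_wpM2l (ltW r0) _ _ _.
  by have := sqr_ge0 (C * s - m); rewrite /rho1 sqrrB sqrrD; lra.
have C21 : 1 <= C ^+ 2 by rewrite exprn_ege1.
have : C ^+ 2 * (r * s ^+ 2) <= C ^+ 2 * kap by rewrite ler_wpM2l ?sqr_ge0.
have : kap <= C ^+ 2 * kap by rewrite ler_peMl.
lra.
Qed.

Lemma loglik_shift_bound :
  `|loglik x y (lda_shift z n ths t th) - loglik x y th
    - (t * (r * Vs^-1 * (Delta z th - Delta_hat z x y)) - t ^+ 2 / 2)|
  <= shift_const C t * kap.
Proof.
have [q0 t1] := logdet_error; rewrite loglik_shift_identity //.
rewrite /shift_const.
do 5 (rewrite [leRHS]mulrDl; apply: le_trans (ler_normB _ _) _; apply: lerD; last by []).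
exact: t1.
Qed.
End ShiftBound.

(** * Taylor bounds for exp and sin *)
Section ExpTaylor.
Variable R : realType.
Implicit Types (x y a : R) (c : nat -> R).

Lemma exprn_fact_le_expR x n : 0 <= x -> x ^+ n / n`!%:R <= expR x.
Proof.
move=> x0; case: n => [|n].
  by rewrite expr0 fact0 divr1 (le_trans _ (expR_ge1Dx x)) // lerDl.
by rewrite (le_trans _ (expR_ge1Dxn n x0)) // lerDr.
Qed.

Lemma exp_series_le x n : 0 <= x -> \sum_(0 <= k < n) x ^+ k / k`!%:R <= expR x.
Proof.
move=> x0; have := @nondecreasing_cvgn_le R (series (exp_coeff x)).
rewrite /expR; apply; last exact: is_cvg_series_exp_coeff.
apply/nondecreasing_seqP => k; rewrite /series /= big_nat_recr //= lerDl.
exact: exp_coeff_ge0.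
Qed.

(** Tails of every power series whose coefficients are dominated by those of
    the exponential; used for both exp and sin. *)
Lemma exp_tail_le c x n m : (forall k, `|c k| <= 1) -> (n <= m)%N ->
  `|\sum_(n <= k < m) c k * (x ^+ k / k`!%:R)| <= `|x| ^+ n / n`!%:R * expR `|x|.
Proof.
move=> c1 nm; rewrite (le_trans (ler_norm_sum _ _ _)) //.
apply: le_trans (_ : \sum_(n <= k < m) `|x| ^+ k / k`!%:R <= _).
  apply: ler_sum => k _; rewrite normrM normrM normfV normrX (ger0_norm (ler0n _ _)).
  by rewrite ler_piMl // divr_ge0 // exprn_ge0.
rewrite -{1}[n]add0n big_addn.
apply: le_trans (_ : \sum_(0 <= k < m - n) (`|x| ^+ n / n`!%:R) * (`|x| ^+ k / k`!%:R) <= _).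
  apply: ler_sum => k _; rewrite addnC exprD mulrACA ler_wpM2l ?mulr_ge0 ?exprn_ge0 //.
  rewrite -invfM lef_pV2 ?posrE ?mulr_gt0 ?ltr0n ?fact_gt0 //.
  rewrite -natrM ler_nat -(@bin_fact (n + k) n) ?leq_addr //.
  by rewrite addKn leq_pmull // bin_gt0 leq_addr.
by rewrite -mulr_sumr ler_wpM2l ?divr_ge0 ?exprn_ge0 // exp_series_le.
Qed.

Lemma series_taylor_le c (f : R) x n : (forall k, `|c k| <= 1) ->
  (series (fun k => c k * (x ^+ k / k`!%:R)) m @[m --> \oo]) --> f ->
  `|f - \sum_(0 <= k < n) c k * (x ^+ k / k`!%:R)| <= `|x| ^+ n / n`!%:R * expR `|x|.
Proof.
move=> c1 cf; set s := \sum_(_ <= _ < _) _.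
have cg : (`|series (fun k => c k * (x ^+ k / k`!%:R)) m - s| @[m --> \oo]) --> `|f - s|.
  by apply: cvg_norm; apply: cvgB => //; exact: cvg_cst.
rewrite -(cvg_lim (@Rhausdorff R) cg); apply: limr_le; first by apply/cvg_ex; exists `|f - s|.
near=> m; rewrite /series /= /s (@big_cat_nat _ _ _ n 0 m) //=; last by near: m; exact: nbhs_infty_ge.
rewrite [X in X - _]addrC addrK; apply: exp_tail_le => //; near: m; exact: nbhs_infty_ge.
Unshelve. all: by end_near. Qed.

Lemma expR_taylor x n :
  `|expR x - \sum_(0 <= k < n) x ^+ k / k`!%:R| <= `|x| ^+ n / n`!%:R * expR `|x|.
Proof.
have := @series_taylor_le (fun=> 1) (expR x) x n.
under eq_bigr do rewrite mul1r.
apply; first by move=> k; rewrite normr1.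
under eq_fun do (rewrite /series /=; under eq_bigr do rewrite mul1r).
exact: is_cvg_series_exp_coeff.
Qed.

Definition sin_sign k : R := (odd k)%:R * (-1) ^+ k.-1./2.

Lemma sin_taylor x n :
  `|sin x - \sum_(0 <= k < n) sin_sign k * (x ^+ k / k`!%:R)|
  <= `|x| ^+ n / n`!%:R * expR `|x|.
Proof.
apply: series_taylor_le.
  move=> k; rewrite /sin_sign normrM normrX normrN1 expr1n mulr1.
  by case: odd; rewrite ?normr1 ?normr0.
rewrite unlock.
have <- : sin_coeff x = (fun k => sin_sign k * (x ^+ k / k`!%:R)).
  by apply/funext => k; rewrite /sin_coeff /= /sin_sign mulrA.
exact: is_cvg_series_sin_coeff.
Qed.
End ExpTaylor.

(** * Approximation by exponential sums *)
Section ExpSum.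
Variable R : realType.
Implicit Types (s G W : seq (R * R)) (f : R -> R) (x a : R).

Definition expsum s x : R := \sum_(q <- s) q.1 * expR (q.2 * x).
(** The standard Gaussian expectation of expsum s. *)
Definition expsumN s : R := \sum_(q <- s) q.1 * expR (q.2 ^+ 2 / 2).
Definition expsumZ (c : R) s : seq (R * R) := [seq (c * q.1, q.2) | q <- s].
Definition expsumM s s' : seq (R * R) :=
  [seq (q.1 * q'.1, q.2 + q'.2) | q <- s, q' <- s'].

Lemma expsum_cat s s' x : expsum (s ++ s') x = expsum s x + expsum s' x.
Proof. by rewrite /expsum big_cat. Qed.

Lemma expsumN_cat s s' : expsumN (s ++ s') = expsumN s + expsumN s'.
Proof. by rewrite /expsumN big_cat. Qed.

Lemma expsum_Z c s x : expsum (expsumZ c s) x = c * expsum s x.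
Proof. by rewrite /expsum big_map mulr_sumr; apply: eq_bigr => q _; rewrite mulrA. Qed.

Lemma expsumN_Z c s : expsumN (expsumZ c s) = c * expsumN s.
Proof. by rewrite /expsumN big_map mulr_sumr; apply: eq_bigr => q _; rewrite mulrA. Qed.

Lemma expsum_M s s' x : expsum (expsumM s s') x = expsum s x * expsum s' x.
Proof.
rewrite /expsum /expsumM big_allpairs_dep mulr_suml; apply: eq_bigr => q _.
rewrite mulr_sumr; apply: eq_bigr => q' _ /=.
by rewrite mulrDl expRD mulrACA.
Qed.

Lemma expsumN_M_cat G s s' :
  expsumN (expsumM G (s ++ s')) = expsumN (expsumM G s) + expsumN (expsumM G s').
Proof.
rewrite /expsumN /expsumM !big_allpairs_dep -big_split; apply: eq_bigr => q _.
by rewrite big_cat.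
Qed.

Lemma expsumN_M_Z G c s : expsumN (expsumM G (expsumZ c s)) = c * expsumN (expsumM G s).
Proof.
rewrite /expsumN /expsumM !big_allpairs_dep mulr_sumr; apply: eq_bigr => q _.
by rewrite big_map mulr_sumr; apply: eq_bigr => q' _ /=; rewrite mulrCA !mulrA.
Qed.

Lemma expsumN_MA G s s' :
  expsumN (expsumM G (expsumM s s')) = expsumN (expsumM (expsumM G s) s').
Proof.
rewrite /expsumN /expsumM !big_allpairs_dep; apply: eq_bigr => q _.
rewrite big_allpairs_dep; apply: eq_bigr => q' _; apply: eq_bigr => q'' _ /=.
by rewrite addrA mulrA.
Qed.

(** Functions approximable by exponential sums with an error that is itself
    dominated by an exponential sum of small Gaussian mean.  The weight G is what
    makes products work: the error of one factor is weighted by a bound on the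
    other. *)
Definition expapprox f := forall G eta, (forall x, 0 <= expsum G x) -> 0 < eta ->
  exists g W, (forall x, `|f x - expsum g x| <= expsum W x) /\
              expsumN (expsumM G W) <= eta.

Lemma expapprox_expsum s : expapprox (expsum s).
Proof.
move=> G eta _ eta0; exists s, [::]; split.
  by move=> x; rewrite subrr normr0 /expsum big_nil.
by rewrite /expsumN /expsumM allpairs0r big_nil ltW.
Qed.

Lemma expapprox_ext f f' : f =1 f' -> expapprox f -> expapprox f'.
Proof. by move=> /funext ->. Qed.

Definition one_es : seq (R * R) := [:: (1, 0)].
Lemma expsum_one x : expsum one_es x = 1.
Proof. by rewrite /expsum /one_es big_seq1 /= mul0r expR0 mulr1. Qed.

Lemma expapprox_cst c : expapprox (fun=> c).
Proof.
apply: (expapprox_ext _ (expapprox_expsum (expsumZ c one_es))) => x.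
by rewrite expsum_Z expsum_one mulr1.
Qed.

Lemma expsum_dominated s : exists B, forall x, `|expsum s x| <= expsum B x.
Proof.
exists [seq (`|q.1|, q.2) | q <- s] => x.
rewrite /expsum big_map (le_trans (ler_norm_sum _ _ _)) // ler_sum // => q _.
by rewrite normrM (ger0_norm (expR_ge0 _)).
Qed.

Lemma expapprox_limit f :
  (forall G eta, (forall x, 0 <= expsum G x) -> 0 < eta ->
   exists f' W, [/\ expapprox f', forall x, `|f x - f' x| <= expsum W x &
                 expsumN (expsumM G W) <= eta]) ->
  expapprox f.
Proof.
move=> H G eta G0 eta0; have eta2 : 0 < eta / 2 by rewrite divr_gt0.
have [f' [W [f'A fW GW]]] := H G _ G0 eta2.
have [g [W' [gW' GW']]] := f'A G _ G0 eta2.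
exists g, (W ++ W'); split.
  move=> x; rewrite expsum_cat -(subrK (f' x) (f x)) -addrA.
  by rewrite (le_trans (ler_normD _ _)) // lerD.
by rewrite expsumN_M_cat [eta]splitr lerD.
Qed.

Lemma expapproxD f f' : expapprox f -> expapprox f' -> expapprox (fun x => f x + f' x).
Proof.
move=> fA f'A G eta G0 eta0; have eta2 : 0 < eta / 2 by rewrite divr_gt0.
have [g [W [gW GW]]] := fA G _ G0 eta2.
have [g' [W' [gW' GW']]] := f'A G _ G0 eta2.
exists (g ++ g'), (W ++ W'); split.
  move=> x; rewrite !expsum_cat opprD addrACA.
  by rewrite (le_trans (ler_normD _ _)) // lerD.
by rewrite expsumN_M_cat [eta]splitr lerD.
Qed.

Lemma expapproxM f f' : expapprox f -> expapprox f' -> expapprox (fun x => f x * f' x).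
Proof.
move=> fA f'A G eta G0 eta0; have eta2 : 0 < eta / 2 by rewrite divr_gt0.
have one0 x : 0 <= expsum one_es x by rewrite expsum_one.
have [h [U [hU _]]] := fA one_es 1 one0 ltr01.
have [B hB] := expsum_dominated h.
have fB x : `|f x| <= expsum (U ++ B) x.
  rewrite -(subrK (expsum h x) (f x)) expsum_cat.
  by rewrite (le_trans (ler_normD _ _)) // lerD.
have G1 x : 0 <= expsum (expsumM G (U ++ B)) x.
  by rewrite expsum_M mulr_ge0 // (le_trans _ (fB x)).
have [g' [W' [gW' GW']]] := f'A _ _ G1 eta2.
have [B' gB'] := expsum_dominated g'.
have G2 x : 0 <= expsum (expsumM G B') x.
  by rewrite expsum_M mulr_ge0 // (le_trans _ (gB' x)).
have [g [W [gW GW]]] := fA _ _ G2 eta2.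
exists (expsumM g g'), (expsumM (U ++ B) W' ++ expsumM B' W); split.
  move=> x; rewrite expsum_cat !expsum_M.
  rewrite (_ : f x * f' x - _ =
     f x * (f' x - expsum g' x) + expsum g' x * (f x - expsum g x)); last by ring.
  by rewrite (le_trans (ler_normD _ _)) // !normrM lerD // ler_pM.
by rewrite expsumN_M_cat !expsumN_MA [eta]splitr lerD.
Qed.

Lemma expapproxX f k : expapprox f -> expapprox (fun x => f x ^+ k).
Proof.
move=> fA; elim: k => [|k IH].
  by apply: expapprox_ext (expapprox_cst 1) => x; rewrite expr0.
by apply: expapprox_ext (expapproxM fA IH) => x; rewrite exprS.
Qed.

Lemma expapprox_sum (F : nat -> R -> R) n : (forall k, expapprox (F k)) ->
  expapprox (fun x => \sum_(0 <= k < n) F k x).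
Proof.
move=> FA; elim: n => [|n IH].
  by apply: expapprox_ext (expapprox_cst 0) => x; rewrite big_geq.
by apply: expapprox_ext (expapproxD IH (FA n)) => x; rewrite big_nat_recr.
Qed.

Definition cosh_es (c a : R) : seq (R * R) := [:: (expR (- (c * a)), c); (expR (c * a), - c)].

Lemma cosh_es_ge c a x : 0 <= c -> expR (c * `|x - a|) <= expsum (cosh_es c a) x.
Proof.
move=> c0; rewrite /expsum big_cons big_seq1 /= -!expRD.
rewrite (_ : - (c * a) + c * x = c * (x - a)); last by ring.
rewrite (_ : c * a + - c * x = c * - (x - a)); last by ring.
by have [xa|xa] := ger0P (x - a); rewrite ?opprB ?lerDl ?lerDr expR_ge0.
Qed.

Lemma expsum_smallmul G W eta : 0 < eta ->
  exists2 del : R, 0 < del & forall c, 0 <= c -> c <= del ->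
  expsumN (expsumM G (expsumZ c W)) <= eta.
Proof.
move=> eta0; set N := expsumN (expsumM G W).
exists (eta / (`|N| + 1)); first by rewrite divr_gt0 // ltr_wpDl.
move=> c c0 cd; rewrite expsumN_M_Z -/N.
apply: le_trans (ler_norm _) _; rewrite normrM (ger0_norm c0).
apply: le_trans (ler_wpM2r (normr_ge0 _) cd) _.
rewrite mulrAC ler_pdivrMr ?ltr_wpDl // ler_wpM2l ?(ltW eta0) //.
by rewrite lerDl.
Qed.

(** The identity is approximated by difference quotients of exp. *)
Lemma expapprox_id : expapprox id.
Proof.
move=> G eta G0 eta0.
have [del del0 H] := expsum_smallmul G (cosh_es 2 0) eta0.
pose t := Num.min del 1; have t0 : 0 < t by rewrite lt_min del0 ltr01.
have t1 : t <= 1 by rewrite ge_min lexx orbT.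
exists [:: (t^-1, t); (- t^-1, 0)], (expsumZ t (cosh_es 2 0)); split; last first.
  by apply: H; [exact: ltW|rewrite ge_min lexx].
move=> x; rewrite expsum_Z /expsum big_cons big_seq1 /= mul0r expR0 mulr1.
have := expR_taylor (t * x) 2; rewrite !big_nat_recr //= big_geq // add0r.
rewrite !expr0 expr1 !fact0 !divr1 => H1.
rewrite (_ : x - _ = - t^-1 * (expR (t * x) - (1 + t * x))); last by field; rewrite gt_eqF.
rewrite normrM normrN normfV (gtr0_norm t0) mulrC ler_pdivrMr //.
apply: le_trans H1 _; rewrite normrM (gtr0_norm t0).
have tx : t * `|x| <= `|x| by rewrite ler_piMl.
rewrite (_ : _ / _ * _ = t * (t * (`|x| ^+ 2 / 2`!%:R * expR (t * `|x|)))); last by ring.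
rewrite [leRHS]mulrC; do 2 apply: ler_wpM2l (ltW t0) _ _ _.
apply: le_trans (_ : expR `|x| * expR `|x| <= _).
  by rewrite ler_pM ?expR_ge0 ?mulr_ge0 ?exprn_ge0 // ?ler_expR // exprn_fact_le_expR.
by rewrite -expRD; have := cosh_es_ge 0 x (ler0n R 2); rewrite subr0 mulr2n mulrDl mul1r.
Qed.

(** Taylor polynomials converge fast enough because y^n / n! is at most
    2^-n exp (2 y). *)
Lemma expapprox_sin l a : 0 <= l -> expapprox (fun x => sin (l * (x - a))).
Proof.
move=> l0; apply: expapprox_limit => G eta G0 eta0.
have [del del0 H] := expsum_smallmul G (cosh_es (3 * l) a) eta0.
have [n _ nd] : exists2 n : nat, True & (2 ^- n : R) <= del.
  exists (Num.bound del^-1) => //.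
  rewrite -[leRHS]invrK lef_pV2 ?posrE ?invr_gt0 ?exprn_gt0 // ltW //.
  exact: upper_nthrootP.
exists (fun x => \sum_(0 <= k < n) sin_sign R k * ((l * (x - a)) ^+ k / k`!%:R)),
  (expsumZ (2 ^- n) (cosh_es (3 * l) a)); split.
- apply: (expapprox_sum (F := fun k x => sin_sign R k * ((l * (x - a)) ^+ k / k`!%:R))) => k.
  apply: expapproxM; first exact: expapprox_cst.
  apply: expapproxM; last exact: expapprox_cst.
  apply: (expapproxX (f := fun x => l * (x - a))).
  apply: expapproxM; first exact: expapprox_cst.
  by apply: expapproxD expapprox_id _; exact: expapprox_cst.
- move=> x; rewrite expsum_Z (le_trans (sin_taylor _ n)) //.
  set y := `|l * (x - a)|.
  apply: le_trans (_ : 2 ^- n * (expR (2 * y) * expR y) <= _).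
    rewrite mulrA ler_wpM2r ?expR_ge0 //.
    rewrite [leRHS]mulrC ler_pdivlMr ?exprn_gt0 // mulrAC -exprMn -/y [y * 2]mulrC.
    by apply: exprn_fact_le_expR; rewrite mulr_ge0 // normr_ge0.
  rewrite ler_wpM2l ?invr_ge0 ?exprn_ge0 // -expRD.
  have := @cosh_es_ge (3 * l) a x; rewrite mulr_ge0 // => /(_ isT).
  by rewrite (_ : 3 * l * _ = 2 * y + y) // /y normrM (ger0_norm l0); ring.
- by apply: H => //; rewrite invr_ge0 exprn_ge0.
Qed.

End ExpSum.

(** * Smoothed indicators *)
Section Step.
Variable R : realType.
Implicit Types (s x a : R).

Lemma bernoulli_ge x n : -1 <= x -> 1 + n%:R * x <= (1 + x) ^+ n.
Proof.
move=> x1; elim: n => [|n IH]; first by rewrite mul0r addr0 expr0.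
rewrite exprSr; apply: le_trans (_ : (1 + n%:R * x) * (1 + x) <= _).
  by have n0 : 0 <= n%:R :> R := ler0n _ _; rewrite -natr1; nra.
by rewrite ler_wpM2r //; lra.
Qed.

(** Polynomials in s converging to the indicator of s < 1/2 on [0, 1]. *)
Definition step_poly k s : R := (1 - s ^+ k) ^+ (2 ^ k).

Lemma step_poly_itv k s : 0 <= s <= 1 -> 0 <= step_poly k s <= 1.
Proof.
move=> /andP[s0 s1]; have sk : 0 <= 1 - s ^+ k <= 1.
  by rewrite subr_ge0 exprn_ile1 //= gerBl exprn_ge0.
by case/andP: sk => ? ?; rewrite exprn_ge0 //= exprn_ile1.
Qed.

Lemma step_poly_low k s : 0 <= s <= 1 -> 1 - (2 * s) ^+ k <= step_poly k s.
Proof.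
move=> /andP[s0 s1]; have := @bernoulli_ge (- s ^+ k) (2 ^ k).
rewrite lerN2 exprn_ile1 // => /(_ isT).
by rewrite natrX mulrN -exprMn.
Qed.

Lemma step_poly_high k s : 0 < s <= 1 -> step_poly k s <= ((2 * s) ^+ k)^-1.
Proof.
move=> /andP[s0 s1]; rewrite -[leRHS]mul1r ler_pdivlMr ?exprn_gt0 ?mulr_gt0 //.
have sk0 : 0 < s ^+ k by rewrite exprn_gt0.
have sk1 : s ^+ k <= 1 by rewrite exprn_ile1 // ltW.
apply: le_trans (_ : (1 - s ^+ k) ^+ (2 ^ k) * (1 + s ^+ k) ^+ (2 ^ k) <= _).
  rewrite ler_wpM2l ?exprn_ge0 ?subr_ge0 //.
  have := @bernoulli_ge (s ^+ k) (2 ^ k); rewrite natrX -exprMn => H.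
  by apply: le_trans (H _); lra.
rewrite -exprMn exprn_ile1 //; nra.
Qed.

Lemma exprn_small (q eta : R) : 0 <= q < 1 -> 0 < eta -> exists k, q ^+ k <= eta.
Proof.
move=> /andP[q0 q1] eta0.
have /cvgrPdist_le/(_ _ eta0) [k _ H] : q ^+ n @[n --> \oo] --> (0 : R).
  by apply: cvg_expr; rewrite ger0_norm.
by exists k; have := H k (leqnn k); rewrite sub0r normrN ger0_norm // exprn_ge0.
Qed.

Lemma expR_small (N eta : R) : 0 < eta -> 0 <= N -> exists2 L, 1 <= L & expR (- L) * N <= eta.
Proof.
move=> eta0 N0; exists (1 + N / eta); first by rewrite lerDl divr_ge0 // ltW.
rewrite expRN mulrC ler_pdivrMr ?expR_gt0 //.
apply: le_trans (_ : eta * (1 + (1 + N / eta)) <= _).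
  by rewrite !mulrDr mulr1 (mulrC eta (N / _)) divfK ?gt_eqF //; lra.
by rewrite ler_wpM2l ?expR_ge1Dx // ltW.
Qed.

Lemma sin_ge_on (del y : R) : 0 <= del -> del <= y -> y <= 1 -> sin del <= sin y.
Proof.
move=> d0 dy y1; have pi2 := @pi_ge2 R.
rewrite leNgt ltr_sin -?leNgt // in_itv /=; apply/andP; split; lra.
Qed.

(** The step polynomial is evaluated at (1 + sin) / 2 of a slowly varying argument
    centred in the window.  While that argument is at most 1 in absolute value, sin
    is monotone and stays away from 0 off the window; beyond, the error is absorbed
    by a small multiple of a hyperbolic cosine. *)
Lemma expsum_step a h eta : 0 < h -> 0 < eta -> exists g W : seq (R * R),
  [/\ forall x, 0 <= expsum W x, expsumN W <= eta,
      forall x, x <= a -> 1 - expsum W x <= expsum g x,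
      forall x, a + h <= x -> expsum g x <= expsum W x &
      forall x, - expsum W x <= expsum g x <= 1 + expsum W x].
Proof.
move=> h0 eta0; pose del := h / 2; pose c := a + del.
have del0 : 0 < del by rewrite divr_gt0.
have eta3 : 0 < eta / 3 by rewrite divr_gt0.
pose N := expsumN (cosh_es 1 c).
have N0 : 0 <= N.
  by rewrite /N /expsumN big_cons big_seq1 addr_ge0 // mulr_ge0 ?expR_ge0.
have [L1 L11 HL1] := expR_small eta3 N0.
pose L := L1 + del; have L0 : 0 < L by rewrite /L; lra.
pose sg := sin (del / L).
have dL : 0 < del / L by rewrite divr_gt0.
have dL1 : del / L <= 1 by rewrite ler_pdivrMr // mul1r /L; lra.
have sg0 : 0 < sg.
  apply: sin_gt0_pi; rewrite dL /=; apply: le_lt_trans dL1 _.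
  by have := @pi_ge2 R; lra.
have [k Hk] : exists k, (1 + sg)^-1 ^+ k <= eta / 3.
  apply: exprn_small => //; rewrite invr_ge0 invf_lt1 ?ltrDl ?sg0 ?andbT; lra.
pose y x := L^-1 * (x - c); pose s x := (1 + sin (y x)) / 2.
have s01 x : 0 <= s x <= 1.
  by have := sin_geN1 (y x); have := sin_le1 (y x); rewrite /s; lra.
pose f x := step_poly k (s x).
have fA : expapprox f.
  apply: expapproxX; apply: expapproxD; first exact: expapprox_cst.
  have -> : (fun x => - s x ^+ k) = (fun x => (-1) * s x ^+ k).
    by apply/funext => x; rewrite mulN1r.
  apply: expapproxM; first exact: expapprox_cst.
  apply: expapproxX; apply: expapproxM; last exact: expapprox_cst.
  apply: expapproxD; first exact: expapprox_cst.
  by apply: expapprox_sin; rewrite invr_ge0 ltW.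
have f01 x := step_poly_itv k (s01 x).
have far x : 1 < `|y x| -> 1 <= expR (- L1) * expsum (cosh_es 1 c) x.
  rewrite /y normrM normfV (gtr0_norm L0) ltr_pdivlMl // mulr1 => yL.
  apply: le_trans (_ : expR (- L1) * expR (1 * `|x - c|) <= _).
    rewrite -expRD -[leLHS]expR0 ler_expR mul1r.
    by move: yL; rewrite /L; lra.
  by rewrite ler_wpM2l ?expR_ge0 // cosh_es_ge.
have cosh0 x : 0 <= expsum (cosh_es 1 c) x.
  by rewrite (le_trans _ (cosh_es_ge c x ler01)) // expR_ge0.
have low x : x <= a -> 1 - (eta / 3 + expR (- L1) * expsum (cosh_es 1 c) x) <= f x.
  move=> xa; have [y1|/far] := leP `|y x| 1; last first.
    by have /andP[] := f01 x; rewrite -/(f x); lra.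
  have E0 : 0 <= expR (- L1) * expsum (cosh_es 1 c) x by rewrite mulr_ge0 ?expR_ge0.
  have yn : del / L <= - y x.
    by rewrite /y mulrC -mulrN ler_wpM2l ?invr_ge0 ?(ltW L0) // /c; lra.
  have sy : sg <= - sin (y x).
    rewrite -sinN sin_ge_on // ?(ltW dL) //.
    by apply: le_trans y1; rewrite -normrN ler_norm.
  have H : (2 * s x) ^+ k <= eta / 3.
    apply: le_trans Hk; rewrite lerXn2r ?nnegrE ?invr_ge0 //; try lra.
      by have := s01 x; lra.
    rewrite -[leRHS]mul1r ler_pdivlMr; last by lra.
    have -> : 2 * s x = 1 + sin (y x) by rewrite /s; field.
    by have := sin_geN1 (y x); nra.
  by have := step_poly_low k (s01 x); rewrite -/(f x); lra.
have high x : a + h <= x -> f x <= eta / 3 + expR (- L1) * expsum (cosh_es 1 c) x.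
  move=> xa; have [y1|/far] := leP `|y x| 1; last first.
    by have /andP[] := f01 x; rewrite -/(f x); lra.
  have E0 : 0 <= expR (- L1) * expsum (cosh_es 1 c) x by rewrite mulr_ge0 ?expR_ge0.
  have yn : del / L <= y x.
    by rewrite /y mulrC ler_wpM2l ?invr_ge0 ?(ltW L0) // /c /del; lra.
  have sy : sg <= sin (y x).
    by rewrite sin_ge_on // ?(ltW dL) // (le_trans (ler_norm _)).
  have sE : 2 * s x = 1 + sin (y x) by rewrite /s; field.
  have sx0 : 0 < s x by lra.
  have := @step_poly_high k (s x); rewrite sx0 /=; have /andP[_ ->] := s01 x.
  move=> /(_ isT); rewrite -/(f x) => H.
  apply: le_trans H _; rewrite -[leLHS]addr0 lerD //; apply: le_trans Hk.
  rewrite exprVn lef_pV2 ?posrE ?exprn_gt0 //; try lra.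
  by rewrite lerXn2r ?nnegrE //; lra.
have one0 x : 0 <= expsum (one_es R) x by rewrite expsum_one.
have [g [W [gW NW]]] := fA _ _ one0 eta3.
have W0 x : 0 <= expsum W x by exact: le_trans (gW x).
pose W' := W ++ (expsumZ (eta / 3) (one_es R) ++ expsumZ (expR (- L1)) (cosh_es 1 c)).
have W'E x : expsum W' x = expsum W x + (eta / 3 + expR (- L1) * expsum (cosh_es 1 c) x).
  by rewrite /W' !expsum_cat !expsum_Z expsum_one mulr1.
have E0 x : 0 <= expR (- L1) * expsum (cosh_es 1 c) x by rewrite mulr_ge0 ?expR_ge0.
exists g, W'; split.
- by move=> x; rewrite W'E !addr_ge0 // ltW.
- rewrite /W' !expsumN_cat !expsumN_Z -/N.
  have -> : expsumN (one_es R) = 1.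
    by rewrite /expsumN big_seq1 /= expr0n mul0r expR0 mulr1.
  have -> : expsumN W = expsumN (expsumM (one_es R) W).
    rewrite /expsumN big_allpairs_dep big_seq1; apply: eq_bigr => q _ /=.
    by rewrite mul1r add0r.
  by move: NW HL1; lra.
- move=> x xa; rewrite W'E; have := low x xa; have := gW x.
  by rewrite ler_norml => /andP[]; lra.
- move=> x xa; rewrite W'E; have := high x xa; have := gW x.
  by rewrite ler_norml => /andP[]; lra.
- move=> x; rewrite W'E; have := f01 x; rewrite -/(f x) => /andP[].
  have := E0 x; have := gW x; rewrite ler_norml => /andP[]; move: (eta / 3) eta3 => b b0.
  by move=> *; apply/andP; split; lra.
Qed.

End Step.

(** * From exponential moments to distribution functions *)
Section LaplaceBounds.
Context d (T : measurableType d) (R : realType) (mu : {measure set T -> \bar R}).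
Variables (D : set T) (S rho : T -> R) (I : R -> R) (ts : seq R).
Hypotheses (mD : measurable D) (mS : measurable_fun D S) (mrho : measurable_fun D rho).
Hypothesis rho0 : forall x, D x -> 0 <= rho x.
Hypothesis HI : forall t, t \in ts ->
  (\int[mu]_(x in D) (expR (t * S x) * rho x)%:E = (I t)%:E)%E.

Definition expsumI (s : seq (R * R)) : R := \sum_(q <- s) q.1 * I q.2.

Let mexp t : measurable_fun D (fun x => expR (t * S x) * rho x).
Proof.
apply: measurable_funM => //; apply: measurableT_comp => //.
by apply: measurable_funM => //.
Qed.

Let iexp t : t \in ts -> mu.-integrable D (fun x => (expR (t * S x) * rho x)%:E).
Proof.
move=> tts; apply/integrableP; split; first exact/measurable_EFinP.
under eq_integral => x /[!inE] Dx do
  rewrite /= ger0_norm ?mulr_ge0 ?expR_ge0 ?rho0 //.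
by rewrite HI // ltry.
Qed.

Lemma integrable_expsum s : {in s, forall q, q.2 \in ts} ->
  mu.-integrable D (fun x => (expsum s (S x) * rho x)%:E) /\
  (\int[mu]_(x in D) (expsum s (S x) * rho x)%:E = (expsumI s)%:E)%E.
Proof.
elim: s => [|q s IH] sts.
  rewrite /expsumI big_nil; split.
    apply: (eq_integrable mD (cst 0%E)) => [x _|]; last exact: integrable0.
    by rewrite /expsum big_nil mul0r.
  by apply: integral0_eq => x _; rewrite /expsum big_nil mul0r.
have qts : q.2 \in ts by apply: sts; rewrite mem_head.
have [i1 e1] : mu.-integrable D (fun x => (expsum s (S x) * rho x)%:E) /\
  (\int[mu]_(x in D) (expsum s (S x) * rho x)%:E = (expsumI s)%:E)%E.
  by apply: IH => r rs; apply: sts; rewrite in_cons rs orbT.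
have i2 : mu.-integrable D (fun x => q.1%:E * (expR (q.2 * S x) * rho x)%:E)%E.
  by apply: integrableZl => //; exact: iexp.
have E x : (expsum (q :: s) (S x) * rho x)%:E =
   (q.1%:E * (expR (q.2 * S x) * rho x)%:E + (expsum s (S x) * rho x)%:E)%E.
  by rewrite -EFinM -EFinD /expsum big_cons mulrDl mulrA.
split; first by under eq_fun do rewrite E; exact: integrableD.
under eq_integral do rewrite E.
rewrite integralD // e1 integralZl //; last exact: iexp.
by rewrite HI // -EFinM -EFinD /expsumI big_cons.
Qed.

Let mB b : measurable (D `&` [set x | (S x <= b)%R]).
Proof.
exact: (mS mD (measurable_itv `]-oo, b])).
Qed.

Let indB b x : D x -> (\1_(D `&` [set y | (S y <= b)%R]) x : R) = (S x <= b)%R%:R.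
Proof.
move=> Dx; rewrite indicE; congr (nat_of_bool _)%:R.
by apply/idP/idP; [rewrite inE => -[]|move=> Sx; rewrite inE].
Qed.

Let Fint b : (\int[mu]_(x in D `&` [set x | (S x <= b)%R]) (rho x)%:E =
  \int[mu]_(x in D) (((S x <= b)%R%:R * rho x)%R)%:E)%E.
Proof.
rewrite [LHS]integral_mkcondr; apply: eq_integral => x; rewrite inE => Dx.
rewrite /patch; case: ifPn; rewrite ?inE ?notin_setE /= => Sx.
  by rewrite Sx mul1r.
by move/negP: Sx => /negbTE ->; rewrite mul0r.
Qed.

Let mi b : measurable_fun D (fun x => (((S x <= b)%R%:R * rho x)%R)%:E).
Proof.
apply/measurable_EFinP/measurable_funM => //.
have := @measurable_indic _ T R D _ (mB b).
apply: eq_measurable_fun => x; rewrite inE => Dx; exact: indB.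
Qed.

Lemma cdf_le_expsumI b s : {in s, forall q, q.2 \in ts} ->
  (forall x, (x <= b)%R%:R <= expsum s x) ->
  exists2 F, (\int[mu]_(x in D `&` [set x | (S x <= b)%R]) (rho x)%:E = F%:E)%E &
             F <= expsumI s.
Proof.
move=> sts le; have [ints es] := integrable_expsum sts.
have nn x : D x -> (0%:E <= (((S x <= b)%R%:R * rho x)%R)%:E)%E.
  by move=> Dx; rewrite lee_fin mulr_ge0 ?rho0.
have H : (\int[mu]_(x in D `&` [set x | (S x <= b)%R]) (rho x)%:E <= (expsumI s)%:E)%E.
  rewrite Fint -es; apply: ge0_le_integral => //.
  - exact: measurable_int ints.
  - by move=> x Dx; rewrite lee_fin ler_wpM2r ?rho0.
have fin : (\int[mu]_(x in D `&` [set x | (S x <= b)%R]) (rho x)%:E)%E \is a fin_num.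
  rewrite ge0_fin_numE; first by rewrite (le_lt_trans H) ?ltry.
  by apply: integral_ge0 => x [Dx _]; rewrite lee_fin rho0.
exists (fine (\int[mu]_(x in D `&` [set x | (S x <= b)%R]) (rho x)%:E)%E).
  by rewrite fineK.
by rewrite -lee_fin fineK.
Qed.

Lemma expsumI_le_cdf b s F : {in s, forall q, q.2 \in ts} ->
  (forall x, expsum s x <= (x <= b)%R%:R) ->
  (\int[mu]_(x in D `&` [set x | (S x <= b)%R]) (rho x)%:E = F%:E)%E ->
  expsumI s <= F.
Proof.
move=> sts le FE; have [ints es] := integrable_expsum sts.
rewrite -lee_fin -es -FE Fint; apply: le_integral => //.
  apply/integrableP; split; first exact: mi.
  under eq_integral => x /[!inE] Dx do
    rewrite /= ger0_norm ?mulr_ge0 ?rho0 //.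
  by rewrite -Fint FE ltry.
by move=> x; rewrite inE => Dx; rewrite lee_fin ler_wpM2r ?rho0.
Qed.

End LaplaceBounds.

Section GaussianLaplace.
Variable R : realType.
Local Notation leb := (@lebesgue_measure R).

Definition gauss_cdf (a : R) : R := fine (normal_prob 0 1 `]-oo, a]).

Lemma normal_pdf_tilt (m sig t x : R) : sig != 0 ->
  expR (t * (x - m)) * normal_pdf m sig x =
  expR (t ^+ 2 * sig ^+ 2 / 2) * normal_pdf (m + t * sig ^+ 2) sig x.
Proof.
move=> s0; rewrite !normal_pdfE // /normal_fun mulrCA [RHS]mulrCA; congr (_ * _).
by rewrite -!expRD; congr expR; field.
Qed.

Lemma normal_mgf (m sig t : R) : sig != 0 ->
  (\int[leb]_x (expR (t * (x - m)) * normal_pdf m sig x)%:E =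
  (expR (t ^+ 2 * sig ^+ 2 / 2))%:E)%E.
Proof.
move=> s0; under eq_integral do rewrite normal_pdf_tilt // EFinM.
rewrite integralZl //; last exact: integrable_normal_pdf.
by rewrite integral_normal_pdf mule1.
Qed.

Lemma gauss_cdfE a : (normal_prob 0 1 `]-oo, a] = (gauss_cdf a)%:E :> \bar R)%E.
Proof. by rewrite /gauss_cdf fineK // fin_num_measure. Qed.

(** Exponential sums give bounds on the Gaussian distribution function without
    any Gaussian integral but the moment generating function. *)
Lemma gauss_cdf_expsum (a : R) (s : seq (R * R)) :
  ((forall x, (x <= a)%R%:R <= expsum s x) -> gauss_cdf a <= expsumN s) /\
  ((forall x, expsum s x <= (x <= a)%R%:R) -> expsumN s <= gauss_cdf a).
Proof.
have HI t : t \in [seq q.2 | q <- s] ->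
   (\int[leb]_(x in setT) (expR (t * x) * normal_pdf 0 1 x)%:E =
    (expR (t ^+ 2 / 2))%:E)%E.
  move=> _; have := @normal_mgf 0 1 t (oner_neq0 _).
  by rewrite expr1n mulr1 => <-; under [RHS]eq_integral do rewrite subr0.
have sts : {in s, forall q, q.2 \in [seq q.2 | q <- s]} by move=> q qs; exact: map_f.
have NE : expsumI (fun t : R => expR (t ^+ 2 / 2)) s = expsumN s by [].
have cE : (\int[leb]_(x in setT `&` [set x : R | (id x <= a)%R]) (normal_pdf 0 1 x)%:E =
    (gauss_cdf a)%:E)%E.
  rewrite -gauss_cdfE setTI /normal_prob; congr (integral _ _ _).
have pdf0 x : setT x -> 0 <= normal_pdf 0 1 x :> R by move=> _; exact: normal_pdf_ge0.
have mpdf : measurable_fun setT (@normal_pdf R 0 1) := measurable_normal_pdf 0 1.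
have mid : measurable_fun setT (@id R) by exact: measurable_id.
split=> le.
  have [F FE Fle] := @cdf_le_expsumI _ _ R leb setT id (normal_pdf 0 1) (fun t => expR (t ^+ 2 / 2)) _
    measurableT mid mpdf pdf0 HI _ _ sts le.
  by move: FE; rewrite cE => -[->]; rewrite -NE.
by rewrite -NE; exact: (@expsumI_le_cdf _ _ R leb setT id (normal_pdf 0 1) (fun t => expR (t ^+ 2 / 2)) _
  measurableT mid mpdf pdf0 HI _ _ _ sts le cE).
Qed.

Lemma gauss_cdf_increment (a h : R) : 0 <= h -> gauss_cdf a <= gauss_cdf (a + h) <= gauss_cdf a + h.
Proof.
move=> h0; apply/andP; split.
  rewrite -lee_fin -!gauss_cdfE; apply: le_measure; rewrite ?inE //.
  by move=> x /=; rewrite !in_itv /= => /le_trans; apply; rewrite lerDl.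
rewrite -lee_fin EFinD -!gauss_cdfE.
have -> : `]-oo, (a + h)]%classic = (`]-oo, a] `|` `]a, (a + h)])%classic :> set R.
  apply/seteqP; split => x /=; rewrite !in_itv /=.
    by move=> xh; have [|] := leP x a; [left|right].
  by case=> [xa|/andP[_ xh]] //; rewrite (le_trans xa) // lerDl.
apply: le_trans (measureU2 _ _ _) _ => //; apply: leeD => //.
apply: (@le_trans _ _ (\int[leb]_(x in `]a, (a + h)%R]) (normal_peak 1)%:E))%E.
  apply: ge0_le_integral => //.
  - by move=> x _; rewrite lee_fin normal_pdf_ge0.
  - by apply/measurable_EFinP; apply: measurable_funTS; exact: measurable_normal_pdf.
  - by move=> x _; rewrite lee_fin normal_pdf_ub // oner_neq0.
rewrite integral_cst //= lebesgue_measure_itv /= lte_fin ltrDl.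
have pk : normal_peak 1 <= 1 :> R.
  rewrite /normal_peak invf_le1 ?sqrtr_gt0; last first.
    by rewrite expr1n mul1r pmulrn_lgt0 // pi_gt0.
  by rewrite -[leLHS]sqrtr1 ler_wsqrtr // expr1n mul1r; have := @pi_ge2 R; lra.
case: ltP => hh; last by rewrite mule0 lee_fin.
by rewrite -EFinB addrC addKr -EFinM lee_fin ler_piMl.
Qed.

(** Chernoff bounds, written as comparisons with exponential sums. *)
Lemma gauss_cdf_tail eta : 0 < eta -> exists2 B : R, 0 < B &
  gauss_cdf (- B) <= eta /\ 1 - eta <= gauss_cdf B.
Proof.
move=> eta0; have [L L1 HL] := expR_small eta0 (expR_ge0 (1 / 2 : R)).
exists L; first by lra.
have [H _] := gauss_cdf_expsum (- L) [:: (expR (- L), -1)].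
have [_ H'] := gauss_cdf_expsum L [:: (1, 0); (- expR (- L), 1)].
split.
- apply: le_trans (H _) _.
    move=> x; rewrite /expsum big_seq1 /= mulN1r -expRD.
    have [xL|_] := leP x (- L); last exact: expR_ge0.
    by rewrite -[leLHS]expR0 ler_expR; lra.
  by rewrite /expsumN big_seq1 /= sqrrN expr1n.
- apply: le_trans (H' _).
    rewrite /expsumN big_cons big_seq1 /= expr0n mul0r expR0 expr1n mulr1 mulNr.
    by rewrite lerD2l lerN2.
  move=> x; rewrite /expsum big_cons big_seq1 /= mul0r expR0 mul1r mulr1 mulNr -expRD.
  have [xL|xL] := leP x L; first by rewrite gerBl expR_ge0.
  by rewrite subr_le0 -[leLHS]expR0 ler_expR; lra.
Qed.

(** Quantitative continuity theorem: the distribution function of S under a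
    weighted measure is close to the Gaussian one as soon as finitely many
    exponential moments are.  The indicator of ]-oo, a] lies between exponential
    sums, and the same sums nearly lie between the indicators at a - h and
    a + h, which controls their Gaussian expectations. *)
Lemma laplace_cdf (a h eta : R) : 0 < h -> 0 < eta ->
  exists (ts : seq R) (eps : R), 0 < eps /\
  forall d (T : measurableType d) (mu : {measure set T -> \bar R}) (D : set T)
    (S rho : T -> R) (I : R -> R) (Z : R),
  measurable D -> measurable_fun D S -> measurable_fun D rho ->
  (forall x, D x -> 0 <= rho x) -> 0 < Z ->
  (forall t, t \in ts ->
     (\int[mu]_(x in D) (expR (t * S x) * rho x)%:E = (I t)%:E)%E) ->
  (forall t, t \in ts -> `|I t - Z * expR (t ^+ 2 / 2)| <= eps * Z) ->
  exists2 F, (\int[mu]_(x in D `&` [set x | (S x <= a)%R]) (rho x)%:E = F%:E)%E &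
     Z * (gauss_cdf (a - h) - eta) <= F <= Z * (gauss_cdf (a + h) + eta).
Proof.
move=> h0 eta0; have eta3 : 0 < eta / 3 by rewrite divr_gt0.
have [g [W [W0 NW g1 g2 g3]]] := expsum_step a h0 eta3.
have [g' [W' [W0' NW' g1' g2' g3']]] := expsum_step (a - h) h0 eta3.
pose U := g ++ W; pose L := g' ++ expsumZ (-1) W'.
have Uge x : (x <= a)%R%:R <= expsum U x.
  rewrite /U expsum_cat; have [xa|xa] := leP x a; rewrite /= ?mulr1n ?mulr0n.
    by have := g1 x xa; lra.
  by have /andP[] := g3 x; lra.
have Lle x : expsum L x <= (x <= a)%R%:R.
  rewrite /L expsum_cat expsum_Z; have [xa|xa] := leP x a; rewrite /= ?mulr1n ?mulr0n.
    by have /andP[] := g3' x; lra.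
  by have := g2' x; rewrite subrK (ltW xa) => /(_ isT); lra.
have UN : expsumN U <= gauss_cdf (a + h) + 2 * (eta / 3).
  have [_ H] := gauss_cdf_expsum (a + h) (g ++ expsumZ (-1) W).
  have : expsumN (g ++ expsumZ (-1) W) <= gauss_cdf (a + h).
    apply: H => x; rewrite expsum_cat expsum_Z; have [xa|xa] := leP x (a + h); rewrite /= ?mulr1n ?mulr0n.
      by have /andP[] := g3 x; lra.
    by have := g2 x (ltW xa); lra.
  by rewrite /U !expsumN_cat expsumN_Z; lra.
have LN : gauss_cdf (a - h) - 2 * (eta / 3) <= expsumN L.
  have [H _] := gauss_cdf_expsum (a - h) (g' ++ W').
  have : gauss_cdf (a - h) <= expsumN (g' ++ W').
    apply: H => x; rewrite expsum_cat; have [xa|xa] := leP x (a - h); rewrite /= ?mulr1n ?mulr0n.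
      by have := g1' x xa; lra.
    by have /andP[] := g3' x; lra.
  by rewrite /L !expsumN_cat expsumN_Z; lra.
pose l1 (s : seq (R * R)) := \sum_(q <- s) `|q.1|.
have l10 s : 0 <= l1 s by rewrite /l1 sumr_ge0.
pose eps := eta / 3 / (1 + l1 U + l1 L).
have den0 : 0 < 1 + l1 U + l1 L by have := l10 U; have := l10 L; lra.
have eps0 : 0 < eps by rewrite divr_gt0.
exists [seq q.2 | q <- U ++ L], eps; split=> // d T mu D S rho I Z mD mS mrho rho0 Z0 HI Hclose.
have epsl s : l1 s <= 1 + l1 U + l1 L -> eps * l1 s <= eta / 3.
  move=> sl; apply: le_trans (ler_wpM2l (ltW eps0) sl) _.
  by rewrite /eps divfK // gt_eqF.
have near s : {subset s <= U ++ L} -> `|expsumI I s - Z * expsumN s| <= Z * (eps * l1 s).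
  move=> sUL; rewrite /expsumI /expsumN mulr_sumr -sumrB.
  rewrite (le_trans (ler_norm_sum _ _ _)) // /l1 !mulr_sumr !big_seq ler_sum // => q qs.
  rewrite mulrCA -mulrBr normrM mulrC [leRHS]mulrA [Z * eps]mulrC ler_wpM2r //.
  by apply: Hclose; apply: map_f; exact: sUL.
have subU : {subset U <= U ++ L} by move=> q qU; rewrite mem_cat qU.
have subL : {subset L <= U ++ L} by move=> q qL; rewrite mem_cat qL orbT.
have stU : {in U, forall q, q.2 \in [seq q.2 | q <- U ++ L]}.
  by move=> q /subU; exact: map_f.
have stL : {in L, forall q, q.2 \in [seq q.2 | q <- U ++ L]}.
  by move=> q /subL; exact: map_f.
have [F FE FU] := cdf_le_expsumI mD mS mrho rho0 HI stU Uge.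
have FL := expsumI_le_cdf mD mS mrho rho0 HI stL Lle FE.
exists F => //.
have eU := epsl U; have eL := epsl L.
have /eU{}eU : l1 U <= 1 + l1 U + l1 L by have := l10 L; lra.
have /eL{}eL : l1 L <= 1 + l1 U + l1 L by have := l10 U; lra.
have nU := near _ subU; have nL := near _ subL.
move: nU nL; rewrite !ler_norml => /andP[_ nU] /andP[nL _].
apply/andP; split.
- apply: le_trans (_ : Z * (expsumN L - eps * l1 L) <= _).
    by rewrite ler_pM2l //; move: eL LN; lra.
  by move: nL FL; rewrite mulrBr; lra.
- apply: le_trans (_ : Z * (expsumN U + eps * l1 U) <= _).
    by move: nU FU; rewrite mulrDr; lra.
  by rewrite ler_pM2l //; move: eU UN; lra.
Qed.

End GaussianLaplace.

(** * Moments of the normal law *)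
Section NormalMoments.
Variable R : realType.
Local Notation leb := (@lebesgue_measure R).

Lemma ge0_integral_normal_prob (m s : R) (f : R -> \bar R) :
  measurable_fun setT f -> (forall x, 0 <= f x)%E ->
  (\int[normal_prob m s]_x f x = \int[leb]_x (f x * (normal_pdf m s x)%:E))%E.
Proof.
move=> mf f0; have dom := @normal_prob_dominates R m s.
rewrite -(Radon_Nikodym_SigmaFinite.change_of_variables dom) //.
have RNi := Radon_Nikodym_SigmaFinite.f_integrable dom.
have ipdf := @integrable_normal_pdf R m s.
apply: ae_eq_integral => //.
- apply: emeasurable_funM => //; exact: (measurable_int leb).
- apply: emeasurable_funM => //; exact: (measurable_int leb).
apply: ae_eqe_mul2l; apply: integral_ae_eq => //.
  exact: (measurable_int leb).
by move=> E ET mE; rewrite -Radon_Nikodym_SigmaFinite.f_integral.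
Qed.

Lemma normal_expsum (m s : R) (q : seq (R * R)) : s != 0 ->
  leb.-integrable setT (fun x => (expsum q (x - m) * normal_pdf m s x)%:E) /\
  (\int[leb]_x (expsum q (x - m) * normal_pdf m s x)%:E =
   (\sum_(r <- q) r.1 * expR (r.2 ^+ 2 * s ^+ 2 / 2))%:E)%E.
Proof.
move=> s0.
have HI t : t \in [seq r.2 | r <- q] ->
   (\int[leb]_(x in setT) (expR (t * (x - m)) * normal_pdf m s x)%:E =
    (expR (t ^+ 2 * s ^+ 2 / 2))%:E)%E by move=> _; exact: normal_mgf.
have mS : measurable_fun setT (fun x : R => x - m) by exact: measurable_funB.
have pdf0 x : setT x -> 0 <= normal_pdf m s x :> R by move=> _; exact: normal_pdf_ge0.
apply: (@integrable_expsum _ _ R leb setT (fun x => x - m) (normal_pdf m s)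
  (fun t => expR (t ^+ 2 * s ^+ 2 / 2)) _ measurableT mS _ pdf0 HI).
  exact: measurable_normal_pdf.
by move=> r rq; exact: map_f.
Qed.

Lemma sqr_expsum_bound (t y : R) : 0 < t -> t <= 1 ->
  `|expsum [:: (1, t); (1, - t); (-2, 0)] y - t ^+ 2 * y ^+ 2|
  <= t ^+ 4 * (2 * expsum (cosh_es 2 0) y).
Proof.
move=> t0 t1; set Cs := expsum (cosh_es 2 0) y.
rewrite {1}/expsum !big_cons big_nil addr0 /= mul0r expR0 !mul1r mulr1.
have H := expR_taylor (t * y) 4; have H' := expR_taylor (- t * y) 4.
move: H H'; rewrite mulNr !big_nat_recr //= !big_geq // normrN.
rewrite !expr0 !expr1 !fact0 (_ : 1`! = 1)%N // !divr1 !add0r => H H'.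
set e1 := expR _ in H *; set e2 := expR _ in H' *.
rewrite (_ : _ - _ = (e1 - (1 + t * y + (t * y) ^+ 2 / 2`!%:R + (t * y) ^+ 3 / 3`!%:R))
  + (e2 - (1 + - (t * y) + (- (t * y)) ^+ 2 / 2`!%:R + (- (t * y)) ^+ 3 / 3`!%:R))); last first.
  by rewrite (_ : 2`! = 2)%N //; field; rewrite /= ?pnatr_eq0.
apply: le_trans (ler_normD _ _) _; apply: le_trans (lerD H H') _.
rewrite -[leLHS]mulr2n -[leLHS]mulr_natl [leRHS]mulrCA; apply: ler_wpM2l => //.
rewrite normrM (gtr0_norm t0) exprMn.
rewrite (_ : _ / _ * _ = t ^+ 4 * (`|y| ^+ 4 / 4`!%:R * expR (t * `|y|))); last by ring.
apply: ler_wpM2l; first by rewrite exprn_ge0 // ltW.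
apply: le_trans (_ : expR `|y| * expR `|y| <= _).
  apply: ler_pM; rewrite ?divr_ge0 ?exprn_ge0 ?expR_ge0 //.
    exact: exprn_fact_le_expR.
  by rewrite ler_expR ler_piMl // ltW.
by rewrite -expRD /Cs; have := cosh_es_ge 0 y (ler0n R 2); rewrite subr0 mulr2n mulrDl mul1r.
Qed.

(** As t tends to 0, the expectation of (exp (t y) + exp (- t y) - 2) / t^2 with
    y = x - m tends to the second moment on one side, and to s^2 on the other. *)
Lemma normal_sqr_moment (m s : R) : s != 0 ->
  (\int[leb]_x ((x - m) ^+ 2 * normal_pdf m s x)%:E = (s ^+ 2)%:E)%E.
Proof.
move=> s0.
have p0 x : 0 <= normal_pdf m s x by exact: normal_pdf_ge0.
have mpdf : measurable_fun setT (normal_pdf m s) by exact: measurable_normal_pdf.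
have mS : measurable_fun setT (fun x : R => x - m) by exact: measurable_funB.
have m2 (c : R) : measurable_fun setT (fun x : R => (c * (x - m) ^+ 2 * normal_pdf m s x)%:E).
  apply/measurable_EFinP; apply: measurable_funM => //.
  by apply: measurable_funM => //; exact: measurable_funX.
pose N (q : seq (R * R)) := \sum_(r <- q) r.1 * expR (r.2 ^+ 2 * s ^+ 2 / 2).
pose A (t : R) : seq (R * R) := [:: (1, t); (1, - t); (-2, 0)].
pose B (t : R) := expsumZ (t ^+ 4 * 2) (cosh_es 2 0).
have NB t : N (B t) = t ^+ 4 * (2 * N (cosh_es 2 0)).
  rewrite /N big_map !mulr_sumr; apply: eq_bigr => r _ /=.
  by rewrite !mulrA.
have bnd (t x : R) : 0 < t -> t <= 1 ->
    expsum (A t ++ expsumZ (-1) (B t)) (x - m) <= t ^+ 2 * (x - m) ^+ 2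
    <= expsum (A t ++ B t) (x - m).
  move=> t0 t1; have := sqr_expsum_bound (x - m) t0 t1.
  rewrite ler_norml !expsum_cat expsum_Z expsum_Z mulrA => /andP[h1 h2].
  by apply/andP; split; move: h1 h2; rewrite /A; lra.
pose I2 := (\int[leb]_x (1 * (x - m) ^+ 2 * normal_pdf m s x)%:E)%E.
have up (t : R) : 0 < t -> t <= 1 ->
  (\int[leb]_x (t ^+ 2 * (x - m) ^+ 2 * normal_pdf m s x)%:E <= (N (A t ++ B t))%:E)%E.
  move=> t0 t1; have [i e] := normal_expsum m (A t ++ B t) s0.
  rewrite /N -e; apply: ge0_le_integral => //.
  - by move=> x _; rewrite lee_fin; nneg.
  - exact: m2.
  - exact: measurable_int i.
  - move=> x _; rewrite lee_fin ler_wpM2r //; by have /andP[] := bnd t x t0 t1.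
have I2ge0 : (0 <= I2)%E by apply: integral_ge0 => x _; rewrite lee_fin; nneg.
have : (I2 < +oo)%E.
  by have := up 1 ltr01 (lexx _); rewrite expr1n => /le_lt_trans; apply; rewrite ltry.
rewrite -ge0_fin_numE // => /fineK I2E; set M2 := fine I2 in I2E.
have scl (c : R) : 0 <= c ->
  (\int[leb]_x (c * (x - m) ^+ 2 * normal_pdf m s x)%:E = (c * M2)%:E)%E.
  move=> c0; rewrite EFinM I2E /I2 -ge0_integralZl //.
  - by apply: eq_integral => x _; rewrite mul1r -mulrA -EFinM.
  - exact: m2.
  - by move=> x _; rewrite lee_fin; nneg.
have low (t : R) : 0 < t -> t <= 1 -> N (A t ++ expsumZ (-1) (B t)) <= t ^+ 2 * M2.
  move=> t0 t1; have [i e] := normal_expsum m (A t ++ expsumZ (-1) (B t)) s0.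
  rewrite -lee_fin -scl ?sqr_ge0 // /N -e; apply: le_integral => //.
    apply/integrableP; split; first exact: m2.
    under eq_integral do [rewrite /= ger0_norm; last by nneg].
    by rewrite scl ?sqr_ge0 // ltry.
  move=> x _; rewrite lee_fin ler_wpM2r //; by have /andP[] := bnd t x t0 t1.
suff -> : s ^+ 2 = M2.
  by rewrite -[M2]mul1r -scl //; apply: eq_integral => x _; rewrite mul1r.
pose K := 2 * N (cosh_es 2 0) + (s ^+ 2) ^+ 2 / 4 * expR (s ^+ 2 / 2).
have K0 : 0 <= K.
  rewrite addr_ge0 //; last by rewrite mulr_ge0 ?expR_ge0 // divr_ge0 ?sqr_ge0.
  by rewrite mulr_ge0 // /N big_cons big_seq1 addr_ge0 // mulr_ge0 ?expR_ge0.
have key (t : R) : 0 < t -> t <= 1 -> `|s ^+ 2 - M2| <= t ^+ 2 * K.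
  move=> t0 t1; have := up t t0 t1; have := low t t0 t1.
  rewrite scl ?sqr_ge0 // lee_fin.
  have NZ q q' : N (q ++ q') = N q + N q' by rewrite /N big_cat.
  have NN q : N (expsumZ (-1) q) = - N q.
    by rewrite /N big_map -sumrN; apply: eq_bigr => r _ /=; rewrite mulN1r mulNr.
  rewrite !NZ NN NB => h1 h2.
  have NA : N (A t) = 2 * (expR (t ^+ 2 * s ^+ 2 / 2) - 1).
    rewrite /N /A !big_cons big_nil addr0 /= sqrrN expr0n /= !mul0r expR0; ring.
  rewrite NA in h1 h2.
  have t20 : 0 < t ^+ 2 by rewrite exprn_gt0.
  have b0 : 0 <= t ^+ 2 * s ^+ 2 / 2 by rewrite divr_ge0 // mulr_ge0 ?sqr_ge0.
  have := expR_taylor (t ^+ 2 * s ^+ 2 / 2) 2.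
  rewrite (ger0_norm b0) !big_nat_recr //= big_geq // add0r expr0 expr1 !divr1.
  set E := expR _; set b := _ / 2 in b0 * => h3.
  have Eb : E <= expR (s ^+ 2 / 2).
    rewrite ler_expR /b ler_wpM2r // ler_piMl ?sqr_ge0 // exprn_ile1 // ltW //.
  have h4 : b ^+ 2 / 2 * E <= t ^+ 4 * ((s ^+ 2) ^+ 2 / 8 * expR (s ^+ 2 / 2)).
    rewrite (_ : b ^+ 2 / 2 = t ^+ 4 * ((s ^+ 2) ^+ 2 / 8)); last by rewrite /b; field.
    rewrite -[leLHS]mulrA; apply: ler_wpM2l; first by rewrite exprn_ge0 // ltW.
    by apply: ler_wpM2l => //; rewrite divr_ge0 // sqr_ge0.
  rewrite -(ler_pM2l t20) -{1}(gtr0_norm t20) -normrM.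
  rewrite (_ : t ^+ 2 * (t ^+ 2 * K) = t ^+ 4 * K); last by ring.
  move: h3; rewrite (_ : 2`!%:R = 2 :> R) // => /le_trans/(_ h4).
  set c8 := _ * expR _ in h4 *.
  have -> : K = 2 * N (cosh_es 2 0) + 2 * c8 by rewrite /K /c8; field.
  have -> : t ^+ 2 * (s ^+ 2 - M2) = 2 * b - t ^+ 2 * M2 by rewrite /b; field.
  rewrite -/b -/E in h1 h2; rewrite !ler_norml => /andP[h5 h6].
  apply/andP; split; move: h1 h2 h5 h6; lra.
apply/eqP; rewrite -subr_eq0 -normr_eq0; apply/eqP/le_anti; rewrite normr_ge0 andbT.
apply/ler_addgt0Pl => e e0; rewrite addr0.
pose t := Num.min 1 (e / (K + 1)).
have K1 : 0 < K + 1 by lra.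
have t0 : 0 < t by rewrite lt_min ltr01 divr_gt0.
have t1 : t <= 1 by rewrite ge_min lexx.
have te : t <= e / (K + 1) by rewrite ge_min lexx orbT.
apply: le_trans (key t t0 t1) _.
apply: le_trans (_ : t * (K + 1) <= _); last by rewrite -ler_pdivlMr.
rewrite expr2 -mulrA ler_wpM2l ?(ltW t0) //.
apply: le_trans (_ : 1 * K <= _); last by lra.
by rewrite ler_wpM2r.
Qed.

(** With y = x - m, y^4 is at most 24 s^4 exp (|y| / s), whose expectation is at
    most 24 s^4 times 2 exp (1 / 2), and exp (1 / 2) is at most 2. *)
Lemma normal_fourth_moment (m s : R) : s != 0 ->
  (\int[leb]_x ((x - m) ^+ 4 * normal_pdf m s x)%:E <= (96 * s ^+ 4)%:E)%E.
Proof.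
move=> s0; wlog sp : s s0 / 0 < s.
  move=> H; have [sp|sn|s00] := ltrgt0P s; first exact: H.
    have := H (- s); rewrite oppr_eq0 oppr_gt0 => /(_ s0 sn).
    rewrite (_ : (- s) ^+ 4 = s ^+ 4); last by ring.
    have -> // : normal_pdf m (- s) = normal_pdf m s.
    apply/funext => x; rewrite !normal_pdfE ?oppr_eq0 //.
    by rewrite /normal_peak /normal_fun !sqrrN.
  by rewrite s00 eqxx in s0.
pose q := expsumZ (24 * s ^+ 4) (cosh_es s^-1 0).
have [i e] := normal_expsum m q s0.
apply: (@le_trans _ _ (\int[leb]_x (expsum q (x - m) * normal_pdf m s x)%:E)%E).
  have mS : measurable_fun setT (fun x : R => x - m) by exact: measurable_funB.
  apply: ge0_le_integral => //.
  - by move=> x _; rewrite lee_fin mulr_ge0 ?normal_pdf_ge0 ?exprn_even_ge0.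
  - apply/measurable_EFinP; apply: measurable_funM; last exact: measurable_normal_pdf.
    exact: measurable_funX.
  - exact: measurable_int i.
  - move=> x _; rewrite lee_fin ler_wpM2r ?normal_pdf_ge0 // expsum_Z.
    have := cosh_es_ge 0 (x - m) (ltW (_ : 0 < s^-1)); rewrite invr_gt0 subr0 => /(_ sp) H.
    rewrite -mulrA mulrCA -ler_pdivrMl ?exprn_gt0 //.
    have y0 : 0 <= s^-1 * `|x - m| by rewrite mulr_ge0 // invr_ge0 ltW.
    have := exprn_fact_le_expR 4 y0; rewrite ler_pdivrMr // => H2.
    rewrite -[(x - m) ^+ 4]ger0_norm ?exprn_even_ge0 // normrX -exprVn -exprMn.
    apply: le_trans H2 _; rewrite mulrC (_ : 4`!%:R = 24 :> R) //.
    by rewrite ler_wpM2l.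
rewrite e lee_fin /q big_map big_cons big_seq1 /= !mulr0 oppr0 expR0 sqrrN !mulr1.
rewrite -mulrDr (_ : s^-1 ^+ 2 * s ^+ 2 = 1); last by rewrite -exprMn mulVf // expr1n.
have E2 : expR (1 / 2) <= 2 :> R.
  have := @expR_ge1Dx R (- (1 / 2)); rewrite expRN => H.
  by rewrite -[leRHS]invrK -[leLHS]invrK lef_pV2 ?posrE ?invr_gt0 ?expR_gt0 //; lra.
rewrite (_ : 96 * s ^+ 4 = 24 * s ^+ 4 * (2 + 2)); last by ring.
by rewrite ler_wpM2l ?lerD // mulr_ge0 // exprn_ge0 // ltW.
Qed.

End NormalMoments.

Section NormalProb.
Variables (R : realType) (m s : R).
Hypothesis s0 : s != 0.
Local Notation N := (@normal_prob R m s).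

Lemma normal_prob_mgf t :
  (\int[N]_x (expR (t * (x - m)))%:E = (expR (t ^+ 2 * s ^+ 2 / 2))%:E)%E.
Proof.
rewrite ge0_integral_normal_prob.
- by under eq_integral do rewrite -EFinM; exact: normal_mgf.
- apply/measurable_EFinP; apply: measurableT_comp => //.
  by apply: measurable_funM => //; exact: measurable_funB.
- by move=> x; rewrite lee_fin expR_ge0.
Qed.

Lemma normal_prob_sqr : (\int[N]_x ((x - m) ^+ 2)%:E = (s ^+ 2)%:E)%E.
Proof.
rewrite ge0_integral_normal_prob.
- by under eq_integral do rewrite -EFinM; exact: normal_sqr_moment.
- by apply/measurable_EFinP; apply: measurable_funX; exact: measurable_funB.
- by move=> x; rewrite lee_fin sqr_ge0.
Qed.

Lemma normal_prob_fourth : (\int[N]_x ((x - m) ^+ 4)%:E <= (96 * s ^+ 4)%:E)%E.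
Proof.
rewrite ge0_integral_normal_prob.
- by under eq_integral do rewrite -EFinM; exact: normal_fourth_moment.
- by apply/measurable_EFinP; apply: measurable_funX; exact: measurable_funB.
- by move=> x; rewrite lee_fin exprn_even_ge0.
Qed.

Let msub : measurable_fun setT (fun x : R => x - m).
Proof. exact: measurable_funB. Qed.

Let isqr : N.-integrable setT (fun x => ((x - m) ^+ 2)%:E).
Proof.
apply/integrableP; split; first by apply/measurable_EFinP; exact: measurable_funX.
by under eq_integral do rewrite /= ger0_norm ?sqr_ge0 //; rewrite normal_prob_sqr ltry.
Qed.

Let icst c : N.-integrable setT (fun=> c%:E).
Proof. exact: finite_measure_integrable_cst. Qed.

(** Since 1 + t y <= exp (t y), the mean M satisfies
    t M <= exp (t^2 s^2 / 2) - 1 for all t of either sign. *)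
Lemma normal_prob_centred :
  N.-integrable setT (fun x => (x - m)%:E) /\ (\int[N]_x (x - m)%:E = 0)%E.
Proof.
have i1 : N.-integrable setT (fun x => (x - m)%:E).
  have i2 : N.-integrable setT (fun x => (1%:E + ((x - m) ^+ 2)%:E)%E).
    by apply: integrableD.
  apply: le_integrable i2 => //; first exact/measurable_EFinP.
  move=> x _; rewrite -EFinD /= lee_fin (@ger0_norm _ (1 + _)) ?addr_ge0 ?sqr_ge0 //.
  rewrite -real_normK ?num_real //; have := normr_ge0 (x - m); nra.
split=> //.
have fin : (\int[N]_x (x - m)%:E)%E \is a fin_num by exact: integrable_fin_num.
rewrite -(fineK fin); set M := fine _; congr (_%:E).
have key t : t * M <= expR (t ^+ 2 * s ^+ 2 / 2) - 1.
  rewrite lerBrDl -lee_fin -normal_prob_mgf EFinD EFinM /M fineK //.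
  have c1 : (\int[N]_x 1%:E = 1%:E)%E.
    by rewrite integral_cst // [X in (_ * X)%E]probability_setT mule1.
  rewrite -integralZl // -[X in (X + _)%E]c1.
  rewrite -integralD //; last exact: integrableZl.
  apply: le_integral => //.
  - by apply: integrableD => //; exact: integrableZl.
  - apply/integrableP; split.
      apply/measurable_EFinP; apply: measurableT_comp => //.
      by apply: measurable_funM.
    under eq_integral do rewrite /= ger0_norm ?expR_ge0 //.
    by rewrite normal_prob_mgf ltry.
  - by move=> x _; rewrite /= -EFinM -EFinD lee_fin expR_ge1Dx.
have bound t : 0 < t -> t ^+ 2 * s ^+ 2 <= 1 -> `|M| <= t * s ^+ 2.
  move=> t0 ts; set b := t ^+ 2 * s ^+ 2 in ts.
  have b0 : 0 <= b by rewrite mulr_ge0 ?sqr_ge0.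
  have eb : expR (b / 2) - 1 <= b.
    have := @expR_ge1Dx R (- (b / 2)); rewrite expRN => H.
    have E0 := expR_gt0 (b / 2).
    have : (1 + - (b / 2)) * expR (b / 2) <= 1.
      by rewrite -ler_pdivlMr // mul1r.
    nra.
  have := key t; have := key (- t); rewrite sqrrN -/b => h1 h2.
  rewrite -(ler_pM2l t0) mulrA -expr2 -/b -{1}(gtr0_norm t0) -normrM ler_norml.
  by apply/andP; split; lra.
apply/eqP; rewrite -normr_eq0; apply/eqP/le_anti; rewrite normr_ge0 andbT.
apply/ler_addgt0Pl => e e0; rewrite addr0.
have s2 : 0 < s ^+ 2 by rewrite exprn_even_gt0.
pose t := Num.min (e / s ^+ 2) (`|s|^-1).
have t0 : 0 < t by rewrite lt_min divr_gt0 //= invr_gt0 normr_gt0.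
apply: le_trans (bound t t0 _) _; last first.
  by rewrite -ler_pdivlMr // ge_min lexx.
have ts : t <= `|s|^-1 by rewrite ge_min lexx orbT.
rewrite -[s ^+ 2]real_normK ?num_real // -exprMn exprn_ile1 ?mulr_ge0 ?(ltW t0) //.
by rewrite -ler_pdivlMr ?normr_gt0 // mul1r.
Qed.

Lemma normal_prob_sqr_centred (f := fun x => (x - m) ^+ 2 - s ^+ 2) :
  [/\ N.-integrable setT (EFin \o f), (\int[N]_x (f x)%:E = 0)%E &
      (\int[N]_x (f x ^+ 2)%:E <= (97 * s ^+ 4)%:E)%E].
Proof.
split.
- rewrite (_ : EFin \o f = (fun x => ((x - m) ^+ 2)%:E - (s ^+ 2)%:E)%E); last first.
    by apply/funext => x; rewrite /f /= EFinB.
  by apply: integrableB.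
- under eq_integral do rewrite EFinB.
  rewrite integralB // normal_prob_sqr integral_cst //.
  by rewrite [X in (_ * X)%E]probability_setT mule1 subee.
- apply: (@le_trans _ _ (\int[N]_x (((x - m) ^+ 4)%:E + (s ^+ 4)%:E))%E).
    apply: ge0_le_integral => //.
    + by move=> x _; rewrite lee_fin sqr_ge0.
    + apply/measurable_EFinP; apply: measurable_funX; apply: measurable_funB => //.
      exact: measurable_funX.
    + apply/measurable_EFinP; apply: measurable_funD => //.
      exact: measurable_funX.
    + move=> x _; rewrite -EFinD lee_fin /f.
      have := sqr_ge0 (x - m); have := sqr_ge0 s.
      rewrite (_ : (x - m) ^+ 4 = (x - m) ^+ 2 * (x - m) ^+ 2); last by ring.
      rewrite (_ : s ^+ 4 = s ^+ 2 * s ^+ 2); last by ring.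
      by nra.
  rewrite ge0_integralD //.
  + rewrite integral_cst // [X in (_ * X)%E]probability_setT mule1.
    apply: le_trans (leeD normal_prob_fourth (lexx _)) _.
    by rewrite -EFinD lee_fin; lra.
  + by move=> x _; rewrite lee_fin exprn_even_ge0.
  + by apply/measurable_EFinP; exact: measurable_funX.
  + by move=> x _; rewrite lee_fin exprn_even_ge0.
Qed.

End NormalProb.

(** * Independent random variables *)
Section BorelMeasurable.
Variables (R : realType) (E : normedModType R).

Lemma continuous_borel_measurable (f : E -> R) : continuous f ->
  measurable_fun [set: borel E] (f : borel E -> R).
Proof.
move=> /continuousP cf; apply: (measurability _ (RGenOpens.measurableE R)).
move=> _ [_ [a [b ->] <-]]; rewrite setTI.
apply: sub_sigma_algebra; apply: cf; exact: interval_open.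
Qed.
End BorelMeasurable.

Section Independence.
Context d (T : measurableType d) (R : realType) (P : probability T R).
Local Notation RT := (measurableTypeR R).

Lemma mfun_RV d' (T' : measurableType d') (f : T -> T') : measurable_fun setT f ->
  exists X : {RV P >-> T'}, f = X.
Proof.
move=> mf; pose X : {mfun T >-> T'} := HB.pack f (isMeasurableFun.Build _ _ _ _ f mf).
by exists X.
Qed.

Lemma law_ge0_integral (U : T -> R) (m : probability RT R) (f : R -> \bar R) :
  measurable_fun setT U ->
  (forall A, measurable A -> P (U @^-1` A) = m A) ->
  measurable_fun setT f -> (forall x, 0 <= f x)%E ->
  (\int[P]_w f (U w) = \int[m]_x f x)%E.
Proof.
move=> mU UE mf f0; have [X XE] := @mfun_RV _ RT U mU; subst U.
rewrite -(ge0_integral_distribution X mf f0).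
by apply: eq_measure_integral => A mA _; exact: UE.
Qed.

Lemma law_integrable (U : T -> R) (m : probability RT R) (f : R -> R) :
  measurable_fun setT U ->
  (forall A, measurable A -> P (U @^-1` A) = m A) ->
  measurable_fun setT f -> m.-integrable setT (EFin \o f) ->
  P.-integrable setT (fun w => (f (U w))%:E).
Proof.
move=> mU UE mf /integrableP[_ fi]; apply/integrableP; split.
  by apply/measurable_EFinP; exact: (measurableT_comp mf mU).
rewrite (law_ge0_integral (f := fun x => `|(f x)%:E|%E) mU UE) //.
by apply: measurableT_comp => //; exact/measurable_EFinP.
Qed.

(** The joint law is the product measure, so that by Fubini the centred factor
    can be integrated first. *)
Lemma indep_product (U V : T -> R) (m1 m2 : probability RT R) (f g : R -> R) :
  measurable_fun setT U -> measurable_fun setT V ->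
  (forall A B, measurable A -> measurable B ->
     P (U @^-1` A `&` V @^-1` B) = m1 A * m2 B)%E ->
  measurable_fun setT f -> measurable_fun setT g ->
  m1.-integrable setT (EFin \o f) -> m2.-integrable setT (EFin \o g) ->
  (\int[m2]_y (g y)%:E = 0)%E ->
  P.-integrable setT (fun w => (f (U w) * g (V w))%:E) /\
  (\int[P]_w (f (U w) * g (V w))%:E = 0)%E.
Proof.
move=> mU mV UV mf mg fi gi g0.
pose W w := (U w, V w).
have mW : measurable_fun setT W by exact: measurable_fun_pair.
pose F (z : RT * RT) : \bar R := (f z.1 * g z.2)%:E.
have mF : measurable_fun setT F.
  apply/measurable_EFinP; apply: measurable_funM.
    exact: (measurableT_comp mf measurable_fst).
  exact: (measurableT_comp mg measurable_snd).
have [X XE] := @mfun_RV _ (RT * RT)%type W mW.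
have lawE A : measurable A -> (m1 \x m2)%E A = distribution P X A.
  apply: product_measure_unique => A' B' mA mB.
  transitivity (P (W @^-1` (A' `*` B'))); first by rewrite XE.
  by rewrite -UV //; congr (P _); apply/seteqP; split=> w [].
have iF : (m1 \x m2)%E.-integrable setT F.
  apply/integrable12ltyP => //; rewrite /F /=.
  pose G := (\int[m2]_y `|g y|%:E)%E.
  have [_ Gfin] := integrableP _ _ _ gi; have [_ Ffin] := integrableP _ _ _ fi.
  have Gn : G \is a fin_num.
    by rewrite /G ge0_fin_numE //; apply: integral_ge0 => y _; rewrite lee_fin.
  apply: le_lt_trans (_ : (\int[m1]_x (`|f x|%:E * G) < +oo)%E); last first.
    rewrite ge0_integralZr //.
    - apply: lte_mul_pinfty => //; first by apply: integral_ge0.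
      by rewrite ge0_fin_numE //; apply: integral_ge0.
    - by apply/measurable_EFinP/measurableT_comp.
    - by apply: integral_ge0 => y _; rewrite lee_fin.
  rewrite le_eqVlt; apply/orP; left; apply/eqP; apply: eq_integral => x _.
  rewrite /G -ge0_integralZl //; first by apply: eq_integral => y _; rewrite -EFinM -normrM.
  by apply/measurable_EFinP/measurableT_comp.
have iFP : (distribution P X).-integrable setT F.
  have [_ lt] := integrableP _ _ _ iF; apply/integrableP; split => //.
  rewrite (eq_measure_integral (m1 \x m2)%E) // => A mA _; exact/esym/lawE.
have iFX : P.-integrable setT (F \o X).
  have [_ lt] := integrableP _ _ _ iFP; apply/integrableP; split.
    by apply: measurableT_comp => //.
  move: lt; rewrite ge0_integral_distribution //.
  by apply: measurableT_comp.
split; first by move: iFX; rewrite -XE.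
rewrite (_ : (\int[P]_w _)%E = (\int[P]_w (F \o X) w)%E); last by rewrite -XE.
rewrite -(integral_distribution mF iFX).
rewrite (eq_measure_integral (m1 \x m2)%E); last by move=> A mA _; exact/esym/lawE.
rewrite -integral12_prod_meas1 //; apply: integral0_eq => x _.
rewrite /fubini_F /F /=; under eq_integral do rewrite EFinM.
by rewrite integralZl // g0 mule0.
Qed.

(** The cross terms vanish by independence and centring. *)
Lemma sum_sqr_indep n (U : 'I_n -> T -> R) (m : probability RT R) (f : R -> R) (B : R) :
  (forall i, measurable_fun setT (U i)) ->
  (forall i A, measurable A -> P (U i @^-1` A) = m A) ->
  (forall i k, i != k -> forall A A', measurable A -> measurable A' ->
     P (U i @^-1` A `&` U k @^-1` A') = m A * m A')%E ->
  measurable_fun setT f -> m.-integrable setT (EFin \o f) ->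
  (\int[m]_x (f x)%:E = 0)%E -> (\int[m]_x (f x ^+ 2)%:E <= B%:E)%E ->
  (\int[P]_w ((\sum_i f (U i w)) ^+ 2)%:E <= (n%:R * B)%:E)%E.
Proof.
move=> mU lawU indU mf fi f0 fB.
have f2i : m.-integrable setT (fun x => (f x ^+ 2)%:E).
  apply/integrableP; split; first by apply/measurable_EFinP; exact: measurable_funX.
  under eq_integral do rewrite /= ger0_norm ?sqr_ge0 //.
  by apply: le_lt_trans fB _; rewrite ltry.
have mf2 : measurable_fun setT (fun x => f x ^+ 2) by exact: measurable_funX.
have term i k : P.-integrable setT (fun w => (f (U i w) * f (U k w))%:E) /\
    (\int[P]_w (f (U i w) * f (U k w))%:E <= (if i == k then B else 0)%:E)%E.
  case: ifPn => [/eqP <-|ik].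
    split.
      have := law_integrable (mU i) (lawU i) mf2 f2i.
      by under eq_fun do rewrite expr2.
    have /= H := @law_ge0_integral (U i) m (fun x => (f x ^+ 2)%:E) (mU i) (lawU i).
    under eq_integral do rewrite -expr2.
    rewrite H //; first exact/measurable_EFinP.
    by move=> x; rewrite lee_fin sqr_ge0.
  have [i1 ->] := indep_product (mU i) (mU k) (indU i k ik) mf mf fi fi f0.
  by split.
have E w : ((\sum_i f (U i w)) ^+ 2)%:E =
    (\sum_(i < n) \sum_(k < n) (f (U i w) * f (U k w))%:E)%E.
  rewrite expr2 mulr_suml -sumEFin; apply: eq_bigr => i _.
  by rewrite mulr_sumr -sumEFin.
under eq_integral do rewrite E.
rewrite integral_sum //; last first.
  by move=> i; apply: integrable_sum => // k _; case: (term i k).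
apply: (@le_trans _ _ (\sum_(i < n) \sum_(k < n) (if i == k then B else 0)%:E)%E).
  apply: lee_sum => i _; rewrite integral_sum //; last by move=> k; case: (term i k).
  by apply: lee_sum => k _; case: (term i k).
under eq_bigr => i _.
  rewrite sumEFin -big_mkcond /= (eq_bigl (pred1 i)); last by move=> k; rewrite eq_sym.
  rewrite big_pred1_eq; over.
by rewrite sumEFin sumr_const card_ord mulr_natl.
Qed.

End Independence.

(** * Concentration of sample means and covariances *)
Section Markov.
Context d (T : measurableType d) (R : realType) (P : probability T R).

Lemma markov_ge0 (f : T -> R) (a b : R) : measurable_fun setT f ->
  (forall w, 0 <= f w) -> 0 < a -> (\int[P]_w (f w)%:E <= (a * b)%:E)%E ->
  (P [set w | (a < f w)%R] <= b%:E)%E.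
Proof.
move=> mf f0 a0 fab.
have mA : measurable [set w | a < f w].
  rewrite -[X in measurable X]setTI.
  have := mf measurableT _ (measurable_itv `]a, +oo[).
  by congr (measurable _); apply/seteqP; split => w /=; rewrite in_itv /= andbT.
rewrite -(@lee_pmul2l _ a%:E) // -EFinM; apply: le_trans fab.
rewrite -integral_cst //.
apply: (@le_trans _ _ (\int[P]_(w in [set w | (a < f w)%R]) (f w)%:E)%E).
  apply: ge0_le_integral => //.
  - by move=> w _; rewrite lee_fin ltW.
  - by apply/measurable_EFinP; exact: measurable_funTS.
  - by move=> w /= /ltW; rewrite lee_fin.
apply: ge0_subset_integral => //; first exact/measurable_EFinP.
by move=> w _; rewrite lee_fin.
Qed.
End Markov.

Section Concentration.
Context d (T : measurableType d) (R : realType) (P : probability T R).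
Variables (n p : nat) (X : 'I_n -> T -> 'cV[R]_p) (mu : 'cV[R]_p) (Sg : 'M[R]_p).
Hypothesis n0 : (0 < n)%N.
Hypothesis Sg_pos : posdef Sg.
Hypothesis mX : forall i, measurable_fun setT (X i : T -> borel 'cV[R]_p).
Hypothesis lawX : forall i, mvnormal P (X i) mu Sg.
Hypothesis indX : forall i k, i != k -> forall B B' : set (borel 'cV[R]_p),
  measurable B -> measurable B' ->
  (P (X i @^-1` B `&` X k @^-1` B') = P (X i @^-1` B) * P (X k @^-1` B'))%E.
Variable C : R.
Hypotheses (C0 : 0 <= C) (SgC : opbound Sg C).

Let nR : 0 < n%:R :> R. Proof. by rewrite ltr0n. Qed.

Lemma dotv_continuous (c : 'cV[R]_p) : continuous (fun v : 'cV[R]_p => dotv c v).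
Proof.
rewrite (_ : (fun v => dotv c v) = (fun v => \sum_i c i 0 * v i 0)); last first.
  by apply/funext => w; rewrite dotvE.
have ac : continuous (fun x : R * R => x.1 + x.2).
  by move=> x; apply: cvgD; [exact: cvg_fst|exact: cvg_snd].
apply: (continuous_big ac) => i _ v.
apply: continuousM; [exact: cst_continuous|exact: coord_continuous].
Qed.

Let mdot c i : measurable_fun setT (fun w => dotv c (X i w)).
Proof.
exact: (measurableT_comp (continuous_borel_measurable (dotv_continuous (c := c))) (mX i)).
Qed.

Let mdotB (c : 'cV[R]_p) (B : set R) : measurable B ->
  measurable ((fun v : borel 'cV[R]_p => dotv c v) @^-1` B).
Proof.
move=> mB; rewrite -[X in measurable X]setTI.
exact: (continuous_borel_measurable (dotv_continuous (c := c))).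
Qed.

Let qpos c : c != 0 -> 0 < qform Sg c. Proof. by case: Sg_pos => _ H /H. Qed.

(** Taking f affine, then quadratic, gives the errors of the mean and of the
    covariance in the direction c. *)
Lemma linear_form_sum c (f : R -> R) (B : R) : c != 0 ->
  let N := normal_prob (dotv c mu) (Num.sqrt (qform Sg c)) in
  measurable_fun setT f -> N.-integrable setT (EFin \o f) ->
  (\int[N]_x (f x)%:E = 0)%E -> (\int[N]_x (f x ^+ 2)%:E <= B%:E)%E ->
  (\int[P]_w ((n%:R^-1 * \sum_i f (dotv c (X i w))) ^+ 2)%:E <= (B / n%:R)%:E)%E.
Proof.
move=> c0 N mf fi f0 fB.
have law i A : measurable A -> P ((fun w => dotv c (X i w)) @^-1` A) = N A.
  by move=> mA; exact: (lawX i c0 mA).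
have H := @sum_sqr_indep _ T R P n (fun i w => dotv c (X i w)) N f B
  (mdot c) law _ mf fi f0 fB.
have {}H : (\int[P]_w ((\sum_i f (dotv c (X i w))) ^+ 2)%:E <= (n%:R * B)%:E)%E.
  apply: H => i k ik A A' mA mA'.
  apply: (etrans (indX ik (mdotB c mA) (mdotB c mA'))).
  by congr (_ * _)%E; exact: law.
have mS : measurable_fun setT (fun w => \sum_i f (dotv c (X i w))).
  by apply: measurable_sum => i; exact: (measurableT_comp mf (mdot c i)).
under eq_integral do rewrite exprMn EFinM.
rewrite ge0_integralZl //; first last.
- by move=> w _; rewrite lee_fin sqr_ge0.
- by apply/measurable_EFinP; exact: measurable_funX.
apply: le_trans (lee_wpmul2l _ H) _; first by rewrite lee_fin sqr_ge0.
rewrite -EFinM lee_fin le_eqVlt; apply/orP; left; apply/eqP; field.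
by rewrite gt_eqF.
Qed.

Let mean_dev c w := dotv c (smean (X^~ w) - mu).
Let cov_dev c w := dotv c ((scov (X^~ w) mu - Sg) *m c).

Let mean_devE c w : mean_dev c w = n%:R^-1 * \sum_i (dotv c (X i w) - dotv c mu).
Proof.
rewrite /mean_dev /smean dotvBr dotvZr sumrB sumr_const card_ord mulrBr.
rewrite -[dotv c mu *+ n]mulr_natl mulKf ?gt_eqF //; congr (_ * _ - _).
elim/big_ind2 : _ => [|x y x' y' <- <-|//]; first by rewrite dotvC dotv0l.
by rewrite dotvDr.
Qed.

Let cov_devE c w : cov_dev c w =
  n%:R^-1 * \sum_i ((dotv c (X i w) - dotv c mu) ^+ 2 - Num.sqrt (qform Sg c) ^+ 2).
Proof.
have q0 : 0 <= qform Sg c by case: (posdef_semi Sg_pos).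
rewrite sqr_sqrtr // /cov_dev mulmxBl dotvBr -(qformE Sg) sumrB sumr_const card_ord mulrBr.
rewrite -[qform Sg c *+ n]mulr_natl mulKf ?gt_eqF //; congr (_ - _).
rewrite /scov -scalemxAl dotvZr; congr (_ * _).
rewrite mulmx_suml.
transitivity (\sum_i dotv c ((X i w - mu) *m (X i w - mu)^T *m c)).
  elim/big_ind2 : _ => [|x y x' y' <- <-|//]; first by rewrite dotvC dotv0l.
  by rewrite dotvDr.
apply: eq_bigr => i _; rewrite outerE dotvZr [dotv _ c]dotvC dotvBr.
by rewrite expr2.
Qed.

Let mmean c : measurable_fun setT (mean_dev c).
Proof.
have /funext -> := mean_devE c.
apply: measurable_funM => //; apply: measurable_sum => i.
exact: measurable_funB.
Qed.

Let mcov c : measurable_fun setT (cov_dev c).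
Proof.
have /funext -> := cov_devE c.
apply: measurable_funM => //; apply: measurable_sum => i.
by apply: measurable_funB => //; apply: measurable_funX; exact: measurable_funB.
Qed.

Let mean_sqr c : (\int[P]_w (mean_dev c w ^+ 2)%:E <= (qform Sg c / n%:R)%:E)%E.
Proof.
have [->|c0] := eqVneq c 0.
  rewrite (_ : qform Sg 0 = 0) ?mul0r; last by rewrite qformE dotv0l.
  by rewrite integral0_eq // => w _; rewrite /mean_dev dotv0l expr0n.
have s0 : Num.sqrt (qform Sg c) != 0 by rewrite gt_eqF // sqrtr_gt0 qpos.
have [i1 i0] := normal_prob_centred (dotv c mu) s0.
under eq_integral do rewrite mean_devE.
apply: (linear_form_sum (f := fun x => x - dotv c mu) c0) => //.
  exact: measurable_funB.
by rewrite normal_prob_sqr // sqr_sqrtr // ltW // qpos.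
Qed.

Let cov_sqr c : (\int[P]_w (cov_dev c w ^+ 2)%:E <= (97 * qform Sg c ^+ 2 / n%:R)%:E)%E.
Proof.
have [->|c0] := eqVneq c 0.
  rewrite (_ : qform Sg 0 = 0); last by rewrite qformE dotv0l.
  rewrite expr0n mulr0 mul0r.
  by rewrite integral0_eq // => w _; rewrite /cov_dev dotv0l expr0n.
have s0 : Num.sqrt (qform Sg c) != 0 by rewrite gt_eqF // sqrtr_gt0 qpos.
have [i1 i0 i2] := normal_prob_sqr_centred (dotv c mu) s0.
under eq_integral do rewrite cov_devE.
apply: (linear_form_sum (f := fun x => (x - dotv c mu) ^+ 2 - Num.sqrt (qform Sg c) ^+ 2) c0) => //.
  by apply: measurable_funB => //; apply: measurable_funX; exact: measurable_funB.
apply: le_trans i2 _; rewrite lee_fin ler_wpM2l //.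
by rewrite (exprM _ 2 2) sqr_sqrtr // ltW // qpos.
Qed.

Let qle c : qform Sg c <= C * euclnorm c ^+ 2.
Proof. by rewrite qformE expr2 (le_trans (ler_norm _)) // opbound_dotv. Qed.

Let E (j : 'I_p) : 'cV[R]_p := delta_mx j 0.

Let dotE j v : dotv (E j) v = v j 0.
Proof.
rewrite dotvE (bigD1 j) //= big1 ?addr0 => [|i ij]; first by rewrite mxE !eqxx mul1r.
by rewrite mxE (negbTE ij) mul0r.
Qed.

Let normE j : euclnorm (E j) = 1.
Proof. by rewrite euclnormE dotE mxE !eqxx sqrtr1. Qed.

Lemma smean_norm_measurable :
  measurable_fun setT (fun w => euclnorm (smean (X^~ w) - mu) ^+ 2).
Proof.
rewrite (_ : (fun w => _) = (fun w => \sum_j mean_dev (E j) w ^+ 2)).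
  by apply: measurable_sum => j; exact: measurable_funX.
apply/funext => w; rewrite euclnorm_sqr dotvE; apply: eq_bigr => j _.
by rewrite /mean_dev dotE expr2.
Qed.

Lemma smean_norm_integral :
  (\int[P]_w (euclnorm (smean (X^~ w) - mu) ^+ 2)%:E <= (C * (p%:R / n%:R))%:E)%E.
Proof.
rewrite (_ : (fun w => _) = (fun w => \sum_j (mean_dev (E j) w ^+ 2)%:E)%E).
  rewrite ge0_integral_sum //; last 2 first.
  - by move=> j; apply/measurable_EFinP; exact: measurable_funX.
  - by move=> j w _; rewrite lee_fin sqr_ge0.
  apply: (@le_trans _ _ (\sum_(j < p) (C / n%:R)%:E)%E).
    apply: lee_sum => j _; apply: le_trans (mean_sqr _) _.
    rewrite lee_fin ler_wpM2r ?invr_ge0 ?(ltW nR) //.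
    by rewrite (le_trans (qle _)) // normE expr1n mulr1.
  by rewrite sumEFin sumr_const card_ord lee_fin -[leLHS]mulr_natl [leLHS]mulrCA.
apply/funext => w; rewrite sumEFin euclnorm_sqr dotvE; congr (_%:E).
by apply: eq_bigr => j _; rewrite /mean_dev dotE expr2.
Qed.

Let cov_polar y j w : ((scov (X^~ w) mu - Sg) *m y) j 0 =
  2^-1 * (cov_dev (E j + y) w - cov_dev (E j) w - cov_dev y w).
Proof.
rewrite /cov_dev; set M := _ - Sg.
have Ms : M^T = M by rewrite /M linearB /= scov_sym; case: Sg_pos => ->.
rewrite !(mulmxDr, dotvDl, dotvDr) (dotv_sym y (E j) Ms) -(dotE j (M *m y)).
by field.
Qed.

Lemma scov_mul_measurable y :
  measurable_fun setT (fun w => euclnorm ((scov (X^~ w) mu - Sg) *m y) ^+ 2).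
Proof.
rewrite (_ : (fun w => _) = (fun w => \sum_j (2^-1 *
  (cov_dev (E j + y) w - cov_dev (E j) w - cov_dev y w)) ^+ 2)).
  apply: measurable_sum => j; apply: measurable_funX; apply: measurable_funM => //.
  by apply: measurable_funB => //; exact: measurable_funB.
by apply/funext => w; rewrite euclnorm_sqr dotvE; apply: eq_bigr => j _; rewrite -cov_polar expr2.
Qed.

(** Along a fixed direction the squared covariance error has order p / n, much
    less than the bound p^2 / n of the Frobenius norm.  The entries of the error
    vector are reduced to quadratic forms by polarization. *)
Lemma scov_mul_integral y : euclnorm y <= 1 ->
  (\int[P]_w (euclnorm ((scov (X^~ w) mu - Sg) *m y) ^+ 2)%:E
     <= (1310 * C ^+ 2 * (p%:R / n%:R))%:E)%E.
Proof.
move=> y1.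
apply: (@le_trans _ _ (\sum_(j < p) (1310 * C ^+ 2 / n%:R)%:E)%E); last first.
  by rewrite sumEFin sumr_const card_ord lee_fin -[leLHS]mulr_natl [leLHS]mulrCA.
rewrite (_ : (fun w => (euclnorm ((scov (X^~ w) mu - Sg) *m y) ^+ 2)%:E) =
  (fun w => \sum_j (((scov (X^~ w) mu - Sg) *m y) j 0 ^+ 2)%:E)%E);
  last first.
  apply/funext => w; rewrite sumEFin euclnorm_sqr dotvE; congr (_%:E).
have mq c : measurable_fun setT (fun w => (cov_dev c w ^+ 2)%:E).
  by apply/measurable_EFinP; exact: measurable_funX.
have mj j : measurable_fun setT (fun w => (((scov (X^~ w) mu - Sg) *m y) j 0 ^+ 2)%:E).
  under eq_fun do rewrite cov_polar.
  apply/measurable_EFinP; apply: measurable_funX; apply: measurable_funM => //.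
  by apply: measurable_funB => //; exact: measurable_funB.
rewrite ge0_integral_sum //; last by move=> j w _; rewrite lee_fin sqr_ge0.
apply: lee_sum => j _.
apply: (@le_trans _ _ (\int[P]_w ((3 / 4)%:E * ((cov_dev (E j + y) w ^+ 2)%:E
   + ((cov_dev (E j) w ^+ 2)%:E + (cov_dev y w ^+ 2)%:E)))%E)%E).
  apply: ge0_le_integral => //.
  - by move=> w _; rewrite lee_fin sqr_ge0.
  - apply: emeasurable_funM => //; apply: emeasurable_funD => //.
    exact: emeasurable_funD.
  - move=> w _; rewrite cov_polar -!EFinD -EFinM lee_fin.
    set a := cov_dev _ w; set b := cov_dev _ w; set c := cov_dev _ w.
    have := sqr_ge0 (a + b); have := sqr_ge0 (a + c); have := sqr_ge0 (b - c).
    by nra.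
have nn c w : (0 <= (cov_dev c w ^+ 2)%:E)%E by rewrite lee_fin sqr_ge0.
rewrite ge0_integralZl //; last 2 first.
- by apply: emeasurable_funD => //; exact: emeasurable_funD.
- by move=> w _; rewrite !adde_ge0.
rewrite ge0_integralD //; last 2 first.
- by move=> w _; rewrite adde_ge0.
- exact: emeasurable_funD.
rewrite ge0_integralD //.
have qb c k : 0 <= k -> euclnorm c <= k -> (\int[P]_w (cov_dev c w ^+ 2)%:E <=
   (97 * (k ^+ 2) ^+ 2 * C ^+ 2 / n%:R)%:E)%E.
  move=> k0 ck; apply: le_trans (cov_sqr c) _; rewrite lee_fin ler_wpM2r ?invr_ge0 ?(ltW nR) //.
  rewrite -mulrA ler_wpM2l // -exprMn lerXn2r ?nnegrE ?mulr_ge0 ?sqr_ge0 //.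
    by case: (posdef_semi Sg_pos).
  rewrite (le_trans (qle c)) // mulrC ler_wpM2r // lerXn2r ?nnegrE ?euclnorm_ge0 //.
have b1 : euclnorm (E j + y) <= 2.
  by rewrite (le_trans (euclnormD _ _)) // normE; lra.
have b2 : euclnorm (E j) <= 1 by rewrite normE.
apply: le_trans (lee_wpmul2l _ (leeD (qb _ _ (ler0n _ 2) b1)
  (leeD (qb _ _ ler01 b2) (qb _ _ ler01 y1)))) _.
  by rewrite lee_fin.
(* 3 / 4 * 97 * (2 ^ 4 + 1 + 1) <= 1310 *)
rewrite -!EFinD -EFinM lee_fin expr1n !expr1n mulr1.
have : 0 <= C ^+ 2 / n%:R by rewrite divr_ge0 ?sqr_ge0 // ltW.
by rewrite -!mulrA; lra.
Qed.

Lemma scov_frob_measurable :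
  measurable_fun setT (fun w => frobnorm (scov (X^~ w) mu - Sg) ^+ 2).
Proof.
under eq_fun do rewrite frobnorm_sqr_cols.
by apply: measurable_sum => j; exact: scov_mul_measurable.
Qed.

Lemma scov_frob_integral :
  (\int[P]_w (frobnorm (scov (X^~ w) mu - Sg) ^+ 2)%:E
     <= (1310 * C ^+ 2 * (p%:R ^+ 2 / n%:R))%:E)%E.
Proof.
rewrite (_ : (fun w => (frobnorm (scov (X^~ w) mu - Sg) ^+ 2)%:E) = (fun w =>
   \sum_j (euclnorm ((scov (X^~ w) mu - Sg) *m E j) ^+ 2)%:E)%E); last first.
  by apply/funext => w; rewrite sumEFin frobnorm_sqr_cols.
rewrite ge0_integral_sum //; last 2 first.
- by move=> j; apply/measurable_EFinP; exact: scov_mul_measurable.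
- by move=> j w _; rewrite lee_fin sqr_ge0.
apply: (@le_trans _ _ (\sum_(j < p) (1310 * C ^+ 2 * (p%:R / n%:R))%:E)%E).
  by apply: lee_sum => j _; apply: scov_mul_integral; rewrite normE.
rewrite sumEFin sumr_const card_ord lee_fin -mulr_natl.
by rewrite le_eqVlt; apply/orP; left; apply/eqP; ring.
Qed.

End Concentration.

(** * Distribution function of the posterior *)
Section Polya.
Variable R : realType.

(** Between two points of a grid of mesh e both functions are monotone and the
    Gaussian one grows by at most e; beyond the grid it is within e of 0 or 1. *)
Lemma gauss_cdf_grid (e : R) : 0 < e -> exists gs : seq R,
  forall F : R -> R, (forall s t, s <= t -> F s <= F t) -> (forall t, 0 <= F t <= 1) ->
  (forall a, a \in gs -> `|F a - gauss_cdf a| <= e) ->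
  forall t, `|F t - gauss_cdf t| <= 2 * e.
Proof.
move=> e0; have [B B0 [tl tr]] := gauss_cdf_tail e0.
have [m Hm] : exists m : nat, B <= - B + m%:R * e.
  exists (Num.bound (2 * B / e)).
  have : 2 * B / e < (Num.bound (2 * B / e))%:R.
    by rewrite archi_boundP // divr_ge0 ?mulr_ge0 ?(ltW B0) // ltW.
  by rewrite ltr_pdivrMr //; lra.
pose a j : R := - B + j%:R * e.
exists [seq a j | j <- iota 0 m.+1] => F Fm F01 Fa t.
have Faj j : (j <= m)%N -> `|F (a j) - gauss_cdf (a j)| <= e.
  by move=> jm; apply: Fa; apply: map_f; rewrite mem_iota add0n ltnS.
have Nm (s s' : R) : s <= s' -> gauss_cdf s <= gauss_cdf s'.
  by move=> ss; have := @gauss_cdf_increment R s (s' - s); rewrite subr_ge0 ss subrKC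
    => /(_ isT) /andP[].
have N0 (s : R) : 0 <= gauss_cdf s by rewrite /gauss_cdf fine_ge0.
have N1 (s : R) : gauss_cdf s <= 1.
  by rewrite -lee_fin -gauss_cdfE; exact: probability_le1.
have a0 : a 0%N = - B by rewrite /a mul0r addr0.
have [tB|tB] := ltP t (- B).
  have := Faj 0%N isT; rewrite a0 !ler_norml => /andP[h1 h2].
  have := Fm _ _ (ltW tB); have := Nm _ _ (ltW tB); have /andP[h3 h4] := F01 t.
  have := N0 t => h5 h6 h7; apply/andP; split; lra.
have [tm|tm] := leP (a m) t.
  have := Faj m (leqnn m); rewrite !ler_norml => /andP[h1 h2].
  have := Fm _ _ tm; have := Nm _ _ tm; have := Nm _ _ Hm; have /andP[h3 h4] := F01 t.
  have := N1 t => h5 h6 h7 h8; apply/andP; split; rewrite -/(a m) in h6; lra.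
have [j jm /andP[j1 j2]] : exists2 j, (j < m)%N & a j <= t < a j.+1.
  elim: m {Hm Fa Faj} tm => [|m IH] tm; first by move: tm; rewrite a0 ltNge tB.
  have [am|/IH[j jm H]] := leP (a m) t; first by exists m; rewrite // am.
  by exists j; rewrite // ltnW.
have aj1 : a j.+1 = a j + e by rewrite /a -natr1 mulrDl mul1r addrA.
have /andP[_ inc] := gauss_cdf_increment (a j) (ltW e0).
have := Faj j (ltnW jm); have := Faj j.+1 jm; rewrite aj1 in j2 *.
rewrite !ler_norml => /andP[h1 h2] /andP[h3 h4].
have := Fm _ _ j1; have := Fm _ _ (ltW j2); have := Nm _ _ j1; have := Nm _ _ (ltW j2).
move=> h5 h6 h7 h8; apply/andP; split; lra.
Qed.
End Polya.

Section PosteriorLimit.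
Variable R : realType.

(** The posterior probability for an abstract log-likelihood l. *)
Definition gibbs d (T : measurableType d) (Pi : {measure set T -> \bar R})
    (l : T -> R) (B : set T) : R :=
  fine (\int[Pi]_(th in B) (expR (l th))%:E) / fine (\int[Pi]_th (expR (l th))%:E).

(** The deterministic part of the argument runs under these conditions: A has
    almost full mass, and on A the shifted likelihoods have almost the same total
    mass and are almost exponential tilts by S. *)
Definition tilt_close d (T : measurableType d) (Pi : {measure set T -> \bar R})
    (A : set T) (l S : T -> R) (lt : R -> T -> R) (ts : seq R) (zeta : R) :=
  [/\ `|gibbs Pi l A - 1| <= zeta,
      forall t, t \in ts -> `|fine (\int[Pi]_(th in A) (expR (lt t th))%:E) /
                              fine (\int[Pi]_(th in A) (expR (l th))%:E) - 1| <= zeta &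
      forall t, t \in ts -> forall th, A th ->
        `|lt t th - l th - (t * S th - t ^+ 2 / 2)| <= zeta].

Lemma tilt_closeW d (T : measurableType d) (Pi : {measure set T -> \bar R})
    (A : set T) (l S : T -> R) (lt : R -> T -> R) ts ts' zeta zeta' :
  {subset ts' <= ts} -> zeta <= zeta' -> tilt_close Pi A l S lt ts zeta ->
  tilt_close Pi A l S lt ts' zeta'.
Proof.
move=> sub zz [h1 h2 h3]; split; first exact: le_trans h1 zz.
- by move=> t /sub tts; exact: le_trans (h2 t tts) zz.
- by move=> t /sub tts th Ath; exact: le_trans (h3 t tts th Ath) zz.
Qed.

Section Fixed.
Context d (T : measurableType d) (Pi : {measure set T -> \bar R}).
Variables (A : set T) (l S : T -> R) (lt : R -> T -> R).
Hypotheses (mA : measurable A) (ml : measurable_fun setT l) (mS : measurable_fun setT S).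
Hypothesis mlt : forall t, measurable_fun setT (lt t).
Local Notation "'mass' B" := (\int[Pi]_(th in B) (expR (l th))%:E)%E (at level 10).

Let mexp : measurable_fun setT (fun th => (expR (l th))%:E).
Proof. by apply/measurable_EFinP; exact: measurableT_comp. Qed.

Let mexpD (D : set T) : measurable_fun D (fun th => (expR (l th))%:E).
Proof. exact: measurable_funTS. Qed.

Let mass_ge0 D : (0 <= mass D)%E.
Proof. by apply: integral_ge0 => th _; rewrite lee_fin expR_ge0. Qed.

Let mass_le D D' : measurable D -> measurable D' -> D `<=` D' -> (mass D <= mass D')%E.
Proof.
move=> mD mD' DD'; by apply: ge0_subset_integral => // th _; rewrite lee_fin expR_ge0.
Qed.

Let fine_neq0 (x : \bar R) : (0 <= x)%E -> fine x != 0 -> exists2 r : R, 0 < r & x = r%:E.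
Proof.
case: x => [r| |] //= x0 r0; last by rewrite eqxx in r0.
by exists r => //; rewrite lt_neqAle eq_sym r0.
Qed.

Variables (ts : seq R) (zeta : R).
Hypothesis Hclose : tilt_close Pi A l S lt ts zeta.
Hypothesis zeta2 : zeta <= 2^-1.

(** A ratio near 1 excludes zero or infinite normalizing integrals, for which the
    ratio is 0 by convention. *)
Lemma gibbs_mass : exists Z D0 : R,
  [/\ 0 < Z, 0 < D0, mass A = Z%:E, mass setT = D0%:E &
      Z <= D0 /\ 1 - zeta <= Z / D0].
Proof.
have [h1 _ _] := Hclose; move: h1; rewrite /gibbs ler_norml => /andP[h1 _].
have nz : fine (mass A) / fine (mass setT) != 0.
  by apply/eqP => h0; rewrite h0 in h1; move: zeta2 h1; lra.
have : fine (mass A) != 0 by apply: contraNneq nz => ->; rewrite mul0r.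
have : fine (mass setT) != 0 by apply: contraNneq nz => ->; rewrite invr0 mulr0.
move=> /(fine_neq0 (mass_ge0 _))[D0 D00 DE] /(fine_neq0 (mass_ge0 _))[Z Z0 ZE].
exists Z, D0; split=> //; split.
  by rewrite -lee_fin -ZE -DE mass_le.
by move: h1; rewrite ZE DE /=; lra.
Qed.

(** On A, exp (t S + l) is nearly exp (t^2 / 2) times the shifted likelihood, and
    the latter has nearly the mass of exp l: under the posterior restricted to A
    the Laplace transform of S is nearly the Gaussian one. *)
Let tilt_moment t Z : t \in ts -> 0 < Z -> mass A = Z%:E ->
  exists2 I : R, (\int[Pi]_(th in A) (expR (t * S th) * expR (l th))%:E = I%:E)%E &
    `|I - Z * expR (t ^+ 2 / 2)| <= 4 * zeta * expR (t ^+ 2 / 2) * Z.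
Proof.
move=> tts Z0 ZE; have [h0 h2 h3] := Hclose.
have z0 : 0 <= zeta by exact: le_trans (normr_ge0 _) h0.
have := h2 t tts; rewrite ZE /= ler_norml => /andP[l1 l2].
have nz : fine (\int[Pi]_(th in A) (expR (lt t th))%:E)%E != 0.
  apply/eqP => e0; move: l1; rewrite e0 mul0r; move: zeta2; lra.
have lt0 : (0 <= \int[Pi]_(th in A) (expR (lt t th))%:E)%E.
  by apply: integral_ge0 => th _; rewrite lee_fin expR_ge0.
have [Zt Zt0 ZtE] := fine_neq0 lt0 nz.
rewrite ZtE /= in l1 l2.
have l1' : (1 - zeta) * Z <= Zt by rewrite -ler_pdivlMr //; lra.
have l2' : Zt <= (1 + zeta) * Z by rewrite -ler_pdivrMr //; lra.
set E := expR (t ^+ 2 / 2); have E0 : 0 < E by exact: expR_gt0.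
have mlt' : measurable_fun A (fun th => (expR (lt t th))%:E).
  by apply: measurable_funTS; apply/measurable_EFinP; exact: measurableT_comp.
have mI : measurable_fun A (fun th => (expR (t * S th) * expR (l th))%:E).
  apply: measurable_funTS; apply/measurable_EFinP; apply: measurable_funM.
    by apply: measurableT_comp => //; exact: measurable_funM.
  exact: measurableT_comp.
have scale c : 0 <= c ->
   (\int[Pi]_(th in A) (c%:E * (expR (lt t th))%:E) = (c * Zt)%:E)%E.
  by move=> c0; rewrite ge0_integralZl // ?ZtE ?EFinM // => th _; rewrite lee_fin expR_ge0.
have pw th : A th -> (expR (- zeta) * E) * expR (lt t th) <= expR (t * S th) * expR (l th)
      <= (expR zeta * E) * expR (lt t th).
  move=> Ath; have := h3 t tts th Ath; rewrite ler_norml /E -!expRD !ler_expR.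
  by move=> /andP[k1 k2]; apply/andP; split; lra.
have up : (\int[Pi]_(th in A) (expR (t * S th) * expR (l th))%:E
    <= (expR zeta * E * Zt)%:E)%E.
  rewrite -scale ?mulr_ge0 ?expR_ge0 ?(ltW E0) //; apply: ge0_le_integral => //.
  - by apply: emeasurable_funM.
  - by move=> th Ath; rewrite -EFinM lee_fin; have /andP[] := pw th Ath.
have low : ((expR (- zeta) * E * Zt)%:E <=
   \int[Pi]_(th in A) (expR (t * S th) * expR (l th))%:E)%E.
  rewrite -scale ?mulr_ge0 ?expR_ge0 ?(ltW E0) //; apply: ge0_le_integral => //.
  - by move=> th _; rewrite -EFinM lee_fin !mulr_ge0 ?expR_ge0 ?(ltW E0).
  - by apply: emeasurable_funM.
  - by move=> th Ath; rewrite -EFinM lee_fin; have /andP[] := pw th Ath.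
have I0 : (0 <= \int[Pi]_(th in A) (expR (t * S th) * expR (l th))%:E)%E.
  by apply: integral_ge0 => th _; rewrite lee_fin mulr_ge0 ?expR_ge0.
have Ifin : (\int[Pi]_(th in A) (expR (t * S th) * expR (l th))%:E)%E \is a fin_num.
  by rewrite ge0_fin_numE // (le_lt_trans up) // ltry.
move: up low; rewrite -(fineK Ifin) !lee_fin; set I := fine _ => up low.
exists I => //.
have ez : expR zeta <= 1 + 2 * zeta.
  have := @expR_ge1Dx R (- zeta); rewrite expRN => H.
  have e0 := expR_gt0 zeta.
  have : (1 - zeta) * expR zeta <= 1 by rewrite -ler_pdivlMr // mul1r.
  have z1 : 0 < 1 - zeta by move: zeta2; lra.
  move=> H1; rewrite -(ler_pM2l z1); apply: le_trans H1 _.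
  have : 0 <= zeta * (1 - 2 * zeta) by apply: mulr_ge0 => //; move: zeta2; lra.
  lra.
have ez' := @expR_ge1Dx R (- zeta).
have z2 := zeta2.
have zz : 0 <= zeta * (1 - 2 * zeta) by apply: mulr_ge0 => //; lra.
have b1 : I <= (1 + 4 * zeta) * (E * Z).
  apply: le_trans up _; rewrite -mulrA.
  apply: le_trans (_ : (1 + 2 * zeta) * (E * ((1 + zeta) * Z)) <= _).
    by rewrite ler_pM ?mulr_ge0 ?expR_ge0 ?(ltW E0) ?(ltW Zt0) // ler_wpM2l ?(ltW E0).
  rewrite [leLHS](_ : _ = (1 + 2 * zeta) * (1 + zeta) * (E * Z)); last by ring.
  rewrite ler_wpM2r ?mulr_ge0 ?(ltW E0) ?(ltW Z0) //; nra.
have b2 : (1 - 4 * zeta) * (E * Z) <= I.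
  apply: le_trans low; rewrite -[leRHS]mulrA.
  apply: le_trans (_ : (1 - zeta) * (E * ((1 - zeta) * Z)) <= _).
    rewrite [leRHS](_ : _ = (1 - zeta) * (1 - zeta) * (E * Z)); last by ring.
    rewrite ler_wpM2r ?mulr_ge0 ?(ltW E0) ?(ltW Z0) //; nra.
  have z1 : 0 <= 1 - zeta by lra.
  by rewrite ler_pM ?mulr_ge0 ?(ltW E0) ?(ltW Z0) // ler_wpM2l ?(ltW E0).
by rewrite ler_norml; apply/andP; split; move: b1 b2; lra.
Qed.

(** The first hypothesis is the conclusion of laplace_cdf for one threshold; it is
    kept abstract so that the list of exponents can serve several thresholds. *)
Lemma gibbs_cdf_close a h eta eps :
  (forall d (T : measurableType d) (mu : {measure set T -> \bar R}) (D : set T)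
    (S rho : T -> R) (I : R -> R) (Z : R),
  measurable D -> measurable_fun D S -> measurable_fun D rho ->
  (forall x, D x -> 0 <= rho x) -> 0 < Z ->
  (forall t, t \in ts ->
     (\int[mu]_(x in D) (expR (t * S x) * rho x)%:E = (I t)%:E)%E) ->
  (forall t, t \in ts -> `|I t - Z * expR (t ^+ 2 / 2)| <= eps * Z) ->
  exists2 F, (\int[mu]_(x in D `&` [set x | (S x <= a)%R]) (rho x)%:E = F%:E)%E &
     Z * (gauss_cdf (a - h) - eta) <= F <= Z * (gauss_cdf (a + h) + eta)) ->
  (forall t, t \in ts -> 4 * zeta * expR (t ^+ 2 / 2) <= eps) -> 0 <= h ->
  `|gibbs Pi l [set th | S th <= a] - gauss_cdf a| <= h + eta + zeta.
Proof.
move=> lap zeps h0; have [Z [D0 [Z0 D00 ZE DE [ZD zq]]]] := gibbs_mass.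
pose I t := fine (\int[Pi]_(th in A) (expR (t * S th) * expR (l th))%:E)%E.
have mSA : measurable_fun A S by exact: measurable_funTS.
have mlA : measurable_fun A (fun th => expR (l th)).
  by apply: measurable_funTS; exact: measurableT_comp.
have [t|t tts|F FE /andP[F1 F2]] := lap _ T Pi A S (fun th => expR (l th)) I Z mA mSA mlA
    (fun th _ => expR_ge0 _) Z0.
- by move=> tts; rewrite /I; have [I' -> _] := tilt_moment tts Z0 ZE.
- rewrite /I; have [I' -> /= H] := tilt_moment tts Z0 ZE.
  by apply: le_trans H _; rewrite ler_pM2r // zeps.
set B := [set th | S th <= a] in FE *.
have mB : measurable B.
  rewrite -[B]setTI; have := mS measurableT (measurable_itv `]-oo, a]).
  by congr measurable; apply/seteqP; split=> th /=; rewrite in_itv.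
have F0 : 0 <= F by rewrite -lee_fin -FE mass_ge0.
have FZ : F <= Z by rewrite -lee_fin -FE -ZE mass_le //; exact: measurableI.
have Bfin : mass B \is a fin_num.
  rewrite ge0_fin_numE //; apply: le_lt_trans (_ : (D0%:E < +oo)%E); last by rewrite ltry.
  by rewrite -DE mass_le.
have FB : F <= fine (mass B).
  by rewrite -lee_fin fineK // -FE mass_le //; exact: measurableI.
have BF : fine (mass B) <= F + (D0 - Z).
  rewrite -lee_fin fineK // EFinD -FE EFinB -DE -ZE.
  have -> : (mass setT - mass A = mass (~` A))%E.
    have -> : mass setT = (mass A + mass (~` A))%E.
      rewrite -ge0_integral_setU //; first by rewrite setUv.
      - exact: measurableC.
      - exact/disj_setPCl.
    by rewrite addeAC subee ?add0e // ZE.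
  have -> : B = (A `&` B) `|` (B `&` ~` A) by rewrite setIC -setIUr setUv setIT.
  rewrite ge0_integral_setU //; last 3 first.
  - exact: measurableI.
  - by apply: measurableI => //; exact: measurableC.
  - by apply/disj_setPS => th [[? _] [_ ?]].
  apply: leeD; first by rewrite setIUr setIA setIid setICA setICr !setI0 setU0.
  by apply: mass_le; [apply: measurableI => //; exact: measurableC|exact: measurableC|move=> th []].
have /andP[i1 _] := gauss_cdf_increment (a - h) h0.
have /andP[_ i2] := gauss_cdf_increment (a - h) h0.
have /andP[_ i3] := gauss_cdf_increment a h0.
rewrite subrK in i1 i2.
rewrite /gibbs DE /=; set b := fine _ in FB BF *.
have G1 : Z * (gauss_cdf a - h - eta) <= F.
  by apply: le_trans F1; rewrite ler_pM2l //; lra.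
have G2 : F <= Z * (gauss_cdf a + h + eta).
  by apply: le_trans F2 _; rewrite ler_pM2l //; lra.
have zq' : (1 - zeta) * D0 <= Z by rewrite -ler_pdivlMr.
have u0 : 0 <= gauss_cdf a + h + eta.
  by move: (le_trans F0 G2); rewrite pmulr_rge0.
have u1 : gauss_cdf a - h - eta <= 1.
  by rewrite -(ler_pM2l Z0) mulr1 (le_trans G1).
rewrite ler_norml lerBlDr lerBrDr ler_pdivlMr // ler_pdivrMr //.
have z0 : 0 <= zeta by have [h1 _ _] := Hclose; exact: le_trans (normr_ge0 _) h1.
apply/andP; split.
  apply: le_trans FB; have [g0|g0] := leP 0 (gauss_cdf a - h - eta).
    apply: le_trans G1; nra.
  apply: le_trans F0; nra.
apply: le_trans BF _; nra.
Qed.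

End Fixed.

Lemma gibbs_cdf_finite (gs : seq R) (e : R) : 0 < e ->
  exists (ts : seq R) (zeta : R), 0 < zeta <= 2^-1 /\
  forall d (T : measurableType d) (Pi : {measure set T -> \bar R})
    (A : set T) (l S : T -> R) (lt : R -> T -> R),
  measurable A -> measurable_fun setT l -> measurable_fun setT S ->
  (forall t, measurable_fun setT (lt t)) ->
  tilt_close Pi A l S lt ts zeta ->
  forall a, a \in gs -> `|gibbs Pi l [set th | S th <= a] - gauss_cdf a| <= e.
Proof.
move=> e0; elim: gs => [|a gs [ts [zeta [/andP[z0 z2] H]]]].
  by exists [::], 2^-1; split=> //; lra.
have e3 : 0 < e / 3 by rewrite divr_gt0.
have [ts' [eps [eps0 lap]]] := laplace_cdf a e3 e3.
pose M : R := 1 + \sum_(t <- ts') expR (t ^+ 2 / 2).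
have M0 : 0 < M by rewrite ltr_wpDr // sumr_ge0 // => t _; exact: expR_ge0.
have Mt t : t \in ts' -> expR (t ^+ 2 / 2) <= M.
  move=> tts; rewrite /M (big_rem t) //= addrCA lerDl.
  by apply: addr_ge0 => //; apply: sumr_ge0 => s _; exact: expR_ge0.
pose z := Num.min (Num.min zeta (e / 3)) (eps / (4 * M)).
have zz : z <= zeta by rewrite /z !ge_min lexx.
have ze : z <= e / 3 by rewrite /z !ge_min lexx !orbT.
have zeps : z <= eps / (4 * M) by rewrite /z !ge_min lexx !orbT.
have zpos : 0 < z by rewrite /z !lt_min z0 e3 divr_gt0 // mulr_gt0.
exists (cat ts ts'); exists z; split; first by apply/andP; split; [exact: zpos|exact: le_trans zz z2].
move=> dd TT Pi A l S lt mA ml mS mlt close b; rewrite inE => /orP[/eqP ->|bgs].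
  have close' : tilt_close Pi A l S lt ts' z.
    by apply: tilt_closeW close => // t tt; rewrite mem_cat tt orbT.
  apply: le_trans (gibbs_cdf_close mA ml mS mlt close' (le_trans zz z2) lap _ (ltW e3)) _; last first.
    by lra.
  move=> t tts; apply: le_trans (_ : 4 * z * M <= _).
    by rewrite ler_wpM2l ?Mt // mulr_ge0 // ltW.
  by rewrite mulrAC -ler_pdivlMl ?mulr_gt0 // mulrC.
apply: (H dd TT Pi A l S lt) => //; apply: tilt_closeW close => // t tt.
by rewrite mem_cat tt.
Qed.

(** The exponents and the tolerance depend on e only, so that they can be chosen
    before the sample size. *)
Lemma gibbs_cdf_uniform (e : R) : 0 < e ->
  exists (ts : seq R) (zeta : R), 0 < zeta /\
  forall d (T : measurableType d) (Pi : {measure set T -> \bar R})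
    (A : set T) (l S : T -> R) (lt : R -> T -> R),
  measurable A -> measurable_fun setT l -> measurable_fun setT S ->
  (forall t, measurable_fun setT (lt t)) ->
  tilt_close Pi A l S lt ts zeta ->
  forall a, `|gibbs Pi l [set th | S th <= a] - gauss_cdf a| <= e.
Proof.
move=> e0; have e2 : 0 < e / 2 by rewrite divr_gt0.
have [gs Hgs] := gauss_cdf_grid e2.
have [ts [zeta [/andP[z0 z2] H]]] := gibbs_cdf_finite gs e2.
exists ts, zeta; split=> // dd TT Pi A l S lt mA ml mS mlt close a.
have -> : e = 2 * (e / 2) by rewrite mulrC divfK.
have [Z [D0 [Z0 D00 ZE DE _]]] := gibbs_mass mA ml close z2.
have mB t : measurable [set th | S th <= t].
  rewrite -[X in measurable X]setTI; have := mS measurableT _ (measurable_itv `]-oo, t]).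
  by congr measurable; apply/seteqP; split=> th /=; rewrite in_itv.
have mexp : measurable_fun setT (fun th => (expR (l th))%:E).
  by apply/measurable_EFinP; exact: measurableT_comp.
have le_mass (B B' : set TT) : measurable B -> measurable B' -> B `<=` B' ->
    (\int[Pi]_(th in B) (expR (l th))%:E <= \int[Pi]_(th in B') (expR (l th))%:E)%E.
  move=> mB1 mB2 BB; apply: ge0_subset_integral => //; exact: measurable_funTS.
have ge0 (B : set TT) : (0 <= \int[Pi]_(th in B) (expR (l th))%:E)%E.
  by apply: integral_ge0 => th _; rewrite lee_fin expR_ge0.
have fin (B : set TT) : measurable B ->
    (\int[Pi]_(th in B) (expR (l th))%:E)%E \is a fin_num.
  move=> mB1; rewrite ge0_fin_numE //.
  by rewrite (le_lt_trans (le_mass _ _ mB1 measurableT (@subsetT _ B))) // DE ltry.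
apply: (Hgs (fun a => gibbs Pi l [set th | S th <= a])).
- move=> s t st; rewrite /gibbs DE /= ler_pM2r ?invr_gt0 //.
  apply: fine_le; rewrite ?fin // le_mass // => th /= h; exact: le_trans h st.
- move=> t; rewrite /gibbs DE /=; apply/andP; split.
    by rewrite divr_ge0 ?(ltW D00) // fine_ge0.
  by rewrite ler_pdivrMr // mul1r -lee_fin fineK ?fin // -DE le_mass.
- by move=> b bgs; exact: (H dd TT Pi A l S lt).
Qed.

End PosteriorLimit.

(** * The expansion on concentrated samples *)
Section Concentrated.
Variable R : realType.

(** Each quantity is allowed e^-1 times its expected order, so that each of the
    four inequalities fails with probability of order e. *)
Definition concentrated (e : R) n p (x : 'I_n -> 'cV[R]_p) (mu : 'cV[R]_p)
    (Sg : 'M[R]_p) (a b : 'cV[R]_p) : Prop :=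
  [/\ euclnorm (smean x - mu) ^+ 2 <= e^-1 * (p%:R / n%:R),
      euclnorm ((scov x mu - Sg) *m a) ^+ 2 <= e^-1 * (p%:R / n%:R) * euclnorm a ^+ 2,
      euclnorm ((scov x mu - Sg) *m b) ^+ 2 <= e^-1 * (p%:R / n%:R) * euclnorm b ^+ 2 &
      frobnorm (scov x mu - Sg) ^+ 2 <= e^-1 * (p%:R ^+ 2 / n%:R)].

(** Centring at the sample means instead of the true ones changes each sample
    covariance by an outer product of size h^2. *)
Lemma Sigma_hat_error n p (x y : 'I_n -> 'cV[R]_p) (mu nu : 'cV[R]_p) (Sg : 'M[R]_p)
    (v : 'cV[R]_p) (bx by_ h : R) : (0 < n)%N ->
  euclnorm (smean x - mu) <= h -> euclnorm (smean y - nu) <= h ->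
  euclnorm ((scov x mu - Sg) *m v) <= bx -> euclnorm ((scov y nu - Sg) *m v) <= by_ ->
  euclnorm ((Sigma_hat x y - Sg) *m v) <= 2^-1 * (bx + by_) + h ^+ 2 * euclnorm v.
Proof.
move=> n0 hx hy Ax Ay.
have outer (k : 'cV[R]_p) : euclnorm k <= h -> euclnorm (k *m k^T *m v) <= h ^+ 2 * euclnorm v.
  move=> kh; have -> : k *m k^T *m v = dotv k v *: k.
    by rewrite -mulmxA [k^T *m v]mx11_scalar mul_mx_scalar.
  rewrite euclnormZ; have := dotv_CS k v => H.
  have k0 := euclnorm_ge0 k; have v0 := euclnorm_ge0 v.
  apply: le_trans (ler_wpM2r k0 H) _.
  rewrite mulrAC ler_wpM2r // expr2 ler_pM //.
have -> : (Sigma_hat x y - Sg) *m v =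
  2^-1 *: ((scov x mu - Sg) *m v + (scov y nu - Sg) *m v
   - (smean x - mu) *m (smean x - mu)^T *m v - (smean y - nu) *m (smean y - nu)^T *m v).
  rewrite (scov_decomp n0 x mu) (scov_decomp n0 y nu) /Sigma_hat -mulmxDl -!mulmxBl.
  by rewrite scalemxAl; congr (_ *m v); apply/matrixP => i j; rewrite !mxE; field; rewrite pnatr_eq0 -lt0n.
rewrite euclnormZ ger0_norm ?invr_ge0 //.
have ox := outer _ hx; have oy := outer _ hy.
set A := (scov x mu - Sg) *m v in Ax *; set B := (scov y nu - Sg) *m v in Ay *.
set k := _ *m v in ox *; set l := _ *m v in oy *.
have := euclnormD (A + B - k) (- l); have := euclnormD (A + B) (- k); have := euclnormD A B.
rewrite !euclnormN.
move: Ax Ay ox oy {hx hy}; move: (h ^+ 2 * euclnorm v) => q.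
lra.
Qed.

(** The factor r = sqrt n is compensated by one of r (k^2 + l^2 + s^2) and r h^2 in
    each product; mixed products are split by the arithmetic-geometric mean. *)
Lemma shift_error_rates (C e r k l s h : R) : 1 <= C -> 0 < e -> e <= 1 -> 0 < r ->
  r^-1 <= e ^+ 2 -> 0 <= k -> 0 <= l -> 0 <= s -> 0 <= h -> k + l + s <= e ^+ 2 ->
  r * (k ^+ 2 + l ^+ 2 + s ^+ 2) <= e ^+ 2 -> h <= e -> r * h ^+ 2 <= e ->
  let kap := 6 * C ^+ 2 * e in
  [/\ s <= kap, k + l + h <= kap, r^-1 <= kap & r * s ^+ 2 <= kap] /\
  [/\ r * (k + l + h) ^+ 2 <= kap, r * (s * (k + l + h)) <= kap,
      r * (2 * C * h) ^+ 2 <= kap & h <= 2 * C * h].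
Proof.
move=> C1 e0 e1 r0 ri k0 l0 s0 h0 kls rkls he rh kap.
have e2e : e ^+ 2 <= e by rewrite expr2; apply: ler_piMl => //; exact: ltW.
have CC : 1 <= C ^+ 2 by exact: exprn_ege1.
have C0 : 0 <= C by exact: le_trans C1.
have kap1 : 6 * e <= kap by have := ler_wpM2r (ltW e0) CC; rewrite /kap; lra.
have q1 : r * (k ^+ 2 + l ^+ 2) <= e.
  apply: le_trans (le_trans rkls e2e); rewrite ler_wpM2l ?(ltW r0) //.
  by rewrite lerDl sqr_ge0.
have rs2 : r * s ^+ 2 <= e.
  apply: le_trans (le_trans rkls e2e); rewrite ler_wpM2l ?(ltW r0) //.
  by rewrite lerDr addr_ge0 // sqr_ge0.
have rkl : r * (k + l + h) ^+ 2 <= 6 * e.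
  have -> : r * (k + l + h) ^+ 2 =
     4 * (r * (k ^+ 2 + l ^+ 2)) + 2 * (r * h ^+ 2)
     - r * ((k + l - h) ^+ 2 + 2 * (k - l) ^+ 2) by ring.
  have q2 : 0 <= r * ((k + l - h) ^+ 2 + 2 * (k - l) ^+ 2).
    by apply: mulr_ge0 (ltW r0) _; apply: addr_ge0; [exact: sqr_ge0|rewrite mulr_ge0 ?sqr_ge0].
  move: q1 q2 rh; lra.
have rskl : r * (s * (k + l + h)) <= 6 * e.
  have q : 0 <= r * (s - (k + l + h)) ^+ 2 by apply: mulr_ge0 (ltW r0) _; exact: sqr_ge0.
  have E : r * (s - (k + l + h)) ^+ 2 =
     r * s ^+ 2 + r * (k + l + h) ^+ 2 - 2 * (r * (s * (k + l + h))) by ring.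
  move: q; rewrite E; lra.
split; split; try (apply: le_trans kap1; lra).
- rewrite (_ : r * _ = 4 * C ^+ 2 * (r * h ^+ 2)); last by ring.
  have H : 0 <= 4 * C ^+ 2 by rewrite mulr_ge0 ?sqr_ge0.
  apply: le_trans (ler_wpM2l H rh) _.
  have : 0 <= C ^+ 2 * e by apply: mulr_ge0 (ltW e0); exact: sqr_ge0.
  rewrite /kap; lra.
- have : h <= C * h by rewrite ler_peMl.
  have := mulr_ge0 C0 h0; lra.
Qed.

Variables (C t e delta : R) (n p : nat) (z : 'cV[R]_p) (ths th : param R p).
Variables (x y : 'I_n -> 'cV[R]_p).
Local Notation Om := (Omega ths).
Local Notation u := (Om *m mean_gap ths).
Local Notation v := (Om *m mean_mid z ths).
Local Notation r := (Num.sqrt n%:R : R).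

(** The sampling errors are h^2 = e^-1 p / n along fixed vectors and e in operator
    norm; since r h^2 = e^-1 p / sqrt n <= e, all rates are of order e. *)
Lemma loglik_shift_concentrated :
  1 <= C -> (0 < n)%N -> (0 < p)%N -> posdef Om ->
  opbound Om C -> opbound (Sigma ths) C -> 0 < V z ths -> 1 <= C * V z ths ->
  0 < e -> e <= 1 -> p%:R / r <= e ^+ 2 -> delta <= e ^+ 2 ->
  C * (2 * e) <= 2^-1 -> 4 * C ^+ 4 * `|t| * (6 * C ^+ 2 * e) <= 2^-1 ->
  concentrated e x (muX ths) (Sigma ths) u v ->
  concentrated e y (muY ths) (Sigma ths) u v ->
  nbhd n ths delta th ->
  `|loglik x y (lda_shift z n ths t th) - loglik x y th
    - (t * (r * (V z ths)^-1 * (Delta z th - Delta_hat z x y)) - t ^+ 2 / 2)|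
  <= shift_const C t * (6 * C ^+ 2 * e).
Proof.
move=> C1 n0 p0 Om_pos OmC SgC V0 VC e0 e1 pr de Ce kapt [x1 x2 x3 x4] [y1 y2 y3 y4].
move=> [Opos]; rewrite ge_max => /andP[nb1 nb2].
have r0 : 0 < r by rewrite sqrtr_gt0 ltr0n.
have r2 : r ^+ 2 = n%:R by rewrite sqr_sqrtr // ler0n.
have p1 : 1 <= p%:R :> R by rewrite ler1n.
have ri0 : 0 < r^-1 by rewrite invr_gt0.
have ri : r^-1 <= e ^+ 2.
  apply: le_trans pr; rewrite -[leLHS]mul1r; apply: ler_wpM2r => //; exact: ltW.
have e2e : e ^+ 2 <= e by rewrite expr2; apply: ler_piMl => //; exact: ltW.
have ei : e^-1 * e = 1 by rewrite mulVf // gt_eqF.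
have ei0 : 0 < e^-1 by rewrite invr_gt0.
have pn : p%:R / n%:R = (p%:R / r) * r^-1 :> R by rewrite -[in LHS]r2 expr2 invfM mulrA.
have pr0 : 0 <= p%:R / r by apply: divr_ge0 => //; exact: ltW.
pose h2 := e^-1 * (p%:R / n%:R).
have h20 : 0 <= h2 by rewrite /h2 mulr_ge0 ?(ltW ei0) // divr_ge0.
pose h := Num.sqrt h2.
have h0 : 0 <= h by exact: sqrtr_ge0.
have hh : h ^+ 2 = h2 by rewrite sqr_sqrtr.
have rh : r * h ^+ 2 <= e.
  rewrite hh /h2 pn (_ : r * _ = e^-1 * (p%:R / r) * (r * r^-1)); last by ring.
  rewrite divff ?gt_eqF // mulr1 ler_pdivrMl //; exact: le_trans pr _.
have h2e : h ^+ 2 <= e ^+ 2.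
  have : r * h ^+ 2 * r^-1 <= e * e ^+ 2.
    have rh0 : 0 <= r * h ^+ 2 by apply: mulr_ge0; rewrite ?sqr_ge0 // (ltW r0).
    exact: ler_pM rh0 (ltW ri0) rh ri.
  rewrite mulrAC divff ?gt_eqF // mul1r => H; apply: le_trans H _.
  by rewrite ler_piMl // sqr_ge0.
have he : h <= e by move: h2e; rewrite ler_pXn2r // nnegrE // ltW.
have le_h (k : R) : 0 <= k -> k ^+ 2 <= h2 -> k <= h.
  by move=> k0; rewrite -hh ler_pXn2r // nnegrE.
have le_hw (k w : R) : 0 <= k -> 0 <= w -> k ^+ 2 <= h2 * w ^+ 2 -> k <= h * w.
  move=> k0 w0; rewrite -hh -exprMn ler_pXn2r // nnegrE // mulr_ge0 //.
have hX := le_h _ (euclnorm_ge0 _) x1; have hY := le_h _ (euclnorm_ge0 _) y1.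
have frob (M : 'M[R]_p) : frobnorm M ^+ 2 <= e^-1 * (p%:R ^+ 2 / n%:R) -> opbound M e.
  move=> HM; apply: opboundW (frobnorm_opbound M) _.
  have f0 : 0 <= frobnorm M by exact: sqrtr_ge0.
  rewrite -(@ler_pXn2r _ 2) // ?nnegrE ?(ltW e0) //; apply: le_trans HM _.
  rewrite (_ : _ / n%:R = (p%:R / r) ^+ 2); last by rewrite exprMn exprVn r2.
  rewrite ler_pdivrMl //; apply: le_trans (_ : (e ^+ 2) ^+ 2 <= _).
    by rewrite ler_pXn2r // nnegrE // sqr_ge0.
  rewrite (_ : (e ^+ 2) ^+ 2 = e * (e * e ^+ 2)); last by ring.
  rewrite ler_wpM2l ?(ltW e0) // ler_piMl ?sqr_ge0 //.
pose s := specnorm (Sigma th - Sigma ths).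
pose k := euclnorm (muX th - muX ths); pose l := euclnorm (muY th - muY ths).
have s0 : 0 <= s by exact: specnorm_ge0.
have k0 : 0 <= k by exact: euclnorm_ge0.
have l0 : 0 <= l by exact: euclnorm_ge0.
rewrite -/s -/k -/l in nb1 nb2.
have kls : k + l + s <= e ^+ 2.
  apply: le_trans (le_trans nb2 de); rewrite -[leLHS]mul1r ler_wpM2r ?addr_ge0 //.
  by have := ler_wsqrtr p1; rewrite sqrtr1.
have rkls : r * (k ^+ 2 + l ^+ 2 + s ^+ 2) <= e ^+ 2 by exact: le_trans nb1 de.
have C0 : 0 <= C by exact: le_trans C1.
have [[b1 b2 b3 b4] [b5 b6 b7 b8]] :=
  shift_error_rates C1 e0 e1 r0 ri k0 l0 s0 h0 kls rkls he rh.
have Werr (c : 'cV[R]_p) :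
    euclnorm ((scov x (muX ths) - Sigma ths) *m (Om *m c)) ^+ 2
      <= h2 * euclnorm (Om *m c) ^+ 2 ->
    euclnorm ((scov y (muY ths) - Sigma ths) *m (Om *m c)) ^+ 2
      <= h2 * euclnorm (Om *m c) ^+ 2 ->
    euclnorm ((Sigma_hat x y - Sigma ths) *m (Om *m c)) <= 2 * C * h * euclnorm c.
  move=> /(le_hw _ _ (euclnorm_ge0 _) (euclnorm_ge0 _)) c1.
  move=> /(le_hw _ _ (euclnorm_ge0 _) (euclnorm_ge0 _)) c2.
  apply: le_trans (Sigma_hat_error n0 hX hY c1 c2) _.
  have Oc := OmC c; set w := euclnorm (Om *m c) in c1 c2 Oc *.
  have w0 : 0 <= w by exact: euclnorm_ge0.
  have hhh : h ^+ 2 <= h by rewrite expr2 ler_piMl // (le_trans he).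
  have H1 : h ^+ 2 * w <= h * w by rewrite ler_wpM2r.
  have H2 : h * w <= h * (C * euclnorm c) by rewrite ler_wpM2l.
  rewrite (_ : 2 * C * h * euclnorm c = h * (C * euclnorm c) + h * (C * euclnorm c));
    last by ring.
  rewrite (_ : 2^-1 * _ = h * w); last by field.
  by rewrite lerD // (le_trans H1).
apply: (loglik_shift_bound (s := s) (m := k + l) (h := h) (w := 2 * e) (rho := 2 * C * h)) => //.
- exact: specnorm_opbound.
- apply: le_trans Ce; rewrite ler_wpM2l //; apply: le_trans (_ : e ^+ 2 <= _).
    by apply: le_trans kls; rewrite lerDr addr_ge0.
  by apply: le_trans e2e _; rewrite mulr_natl lerDl ltW.
- by rewrite lerDl.
- by rewrite lerDr.
- move=> c; apply: le_trans (Sigma_hat_error n0 hX hY (frob _ x4 c) (frob _ y4 c)) _.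
  have c0 := euclnorm_ge0 c.
  rewrite (_ : 2 * e * euclnorm c =
    2^-1 * (e * euclnorm c + e * euclnorm c) + e * euclnorm c); last by field.
  by rewrite lerD2l ler_wpM2r // (le_trans h2e).
- exact: Werr x2 y2.
- exact: Werr x3 y3.
Qed.

End Concentrated.

(** * Measurability in the parameter *)
Section ParamMeasurability.
Variable R : realType.

Section Entrywise.
Context d (T : measurableType d).

(** Entries are enough here: likelihood and discriminant are compositions of matrix
    operations, and the Borel structure only matters for the coordinates. *)
Definition entrywise_measurable m n (f : T -> 'M[R]_(m, n)) : Prop :=
  forall i j, measurable_fun setT (fun t => f t i j).

Lemma entrywise_measurable_cst m n (M : 'M[R]_(m, n)) :
  entrywise_measurable (fun _ => M).
Proof. by move=> i j; exact: measurable_cst. Qed.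

Lemma entrywise_measurableD m n (f g : T -> 'M[R]_(m, n)) :
  entrywise_measurable f -> entrywise_measurable g ->
  entrywise_measurable (fun t => f t + g t).
Proof.
move=> mf mg i j; under eq_fun do rewrite mxE.
by apply: measurable_funD.
Qed.

Lemma entrywise_measurableZ m n (c : R) (f : T -> 'M[R]_(m, n)) :
  entrywise_measurable f -> entrywise_measurable (fun t => c *: f t).
Proof.
move=> mf i j; under eq_fun do rewrite mxE.
by apply: measurable_funM => //; exact: measurable_cst.
Qed.

Lemma entrywise_measurableB m n (f g : T -> 'M[R]_(m, n)) :
  entrywise_measurable f -> entrywise_measurable g ->
  entrywise_measurable (fun t => f t - g t).
Proof.
move=> mf mg i j; under eq_fun do rewrite !mxE.
by apply: measurable_funB.
Qed.

Lemma entrywise_measurableM m n k (f : T -> 'M[R]_(m, n)) (g : T -> 'M[R]_(n, k)) :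
  entrywise_measurable f -> entrywise_measurable g ->
  entrywise_measurable (fun t => f t *m g t).
Proof.
move=> mf mg i j; under eq_fun do rewrite mxE.
by apply: measurable_sum => l; exact: measurable_funM.
Qed.

Lemma entrywise_measurable_tr m n (f : T -> 'M[R]_(m, n)) :
  entrywise_measurable f -> entrywise_measurable (fun t => (f t)^T).
Proof. by move=> mf i j; under eq_fun do rewrite mxE; exact: mf. Qed.

Lemma entrywise_measurable_sum m n I (s : seq I) (f : I -> T -> 'M[R]_(m, n)) :
  (forall k, entrywise_measurable (f k)) ->
  entrywise_measurable (fun t => \sum_(k <- s) f k t).
Proof.
move=> mf i j; under eq_fun do rewrite summxE.
by apply: measurable_sum => l; exact: mf.
Qed.

Lemma measurable_mxtrace n (f : T -> 'M[R]_n) :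
  entrywise_measurable f -> measurable_fun setT (fun t => \tr (f t)).
Proof. by move=> mf; apply: measurable_sum => l; exact: mf. Qed.

Lemma measurable_det n (f : T -> 'M[R]_n) :
  entrywise_measurable f -> measurable_fun setT (fun t => \det (f t)).
Proof.
move=> mf; apply: measurable_sum => s; apply: measurable_funM; first exact: measurable_cst.
by apply: measurable_prod => i _; exact: mf.
Qed.

Lemma measurable_loglik1 n p (x : 'I_n -> 'cV[R]_p) (mu : T -> 'cV[R]_p) (Om : T -> 'M[R]_p) :
  entrywise_measurable mu -> entrywise_measurable Om ->
  measurable_fun setT (fun t => loglik1 x (mu t) (Om t)).
Proof.
move=> mmu mOm; apply: measurable_funB; apply: measurable_funM; try exact: measurable_cst.
  by apply: measurableT_comp; [exact: measurable_ln|exact: measurable_det].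
apply: measurable_mxtrace; apply: entrywise_measurableM => //.
apply: entrywise_measurableZ; apply: entrywise_measurable_sum => i.
have mB : entrywise_measurable (fun t => x i - mu t).
  by apply: entrywise_measurableB => //; exact: entrywise_measurable_cst.
by apply: entrywise_measurableM => //; exact: entrywise_measurable_tr.
Qed.

Lemma measurable_loglik n p (x y : 'I_n -> 'cV[R]_p) (th : T -> param R p) :
  entrywise_measurable (fun t => muX (th t)) -> entrywise_measurable (fun t => muY (th t)) ->
  entrywise_measurable (fun t => Omega (th t)) ->
  measurable_fun setT (fun t => loglik x y (th t)).
Proof.
by move=> mX mY mO; apply: measurable_funD; exact: measurable_loglik1.
Qed.

Lemma measurable_qform p (M : T -> 'M[R]_p) (v : T -> 'cV[R]_p) :
  entrywise_measurable M -> entrywise_measurable v ->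
  measurable_fun setT (fun t => qform (M t) (v t)).
Proof.
move=> mM mv; apply: (entrywise_measurableM _ mv).
by apply: entrywise_measurableM => //; exact: entrywise_measurable_tr.
Qed.

Lemma measurable_Delta p (z : 'cV[R]_p) (th : T -> param R p) :
  entrywise_measurable (fun t => muX (th t)) -> entrywise_measurable (fun t => muY (th t)) ->
  entrywise_measurable (fun t => Omega (th t)) ->
  measurable_fun setT (fun t => Delta z (th t)).
Proof.
move=> mX mY mO; apply: measurable_funD; last first.
  by apply: measurable_qform => //; exact: entrywise_measurableB.
by by apply: measurable_funN; apply: measurable_qform => //; exact: entrywise_measurableB.
Qed.

End Entrywise.

Section Coordinates.
Variable p : nat.

Lemma muX_measurable : entrywise_measurable (fun th : paramB R p => muX (th : param R p)).
Proof.
move=> i j; apply: (@continuous_borel_measurable R _ (fun th => muX th i j)) => th.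
apply: (@continuous_comp _ _ _ (fun th : param R p => th.1.1) (fun v => v i j)).
  by apply: (@continuous_comp _ _ _ (fun th : param R p => th.1) (fun v => v.1)); exact: cvg_fst.
exact: coord_continuous.
Qed.

Lemma muY_measurable : entrywise_measurable (fun th : paramB R p => muY (th : param R p)).
Proof.
move=> i j; apply: (@continuous_borel_measurable R _ (fun th => muY th i j)) => th.
apply: (@continuous_comp _ _ _ (fun th : param R p => th.1.2) (fun v => v i j)).
  by apply: (@continuous_comp _ _ _ (fun th : param R p => th.1) (fun v => v.2));
    [exact: cvg_fst|exact: cvg_snd].
exact: coord_continuous.
Qed.

Lemma Omega_measurable : entrywise_measurable (fun th : paramB R p => Omega (th : param R p)).
Proof.
move=> i j; apply: (@continuous_borel_measurable R _ (fun th => Omega th i j)) => th.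
apply: (@continuous_comp _ _ _ (fun th : param R p => th.2) (fun v => v i j)).
  exact: cvg_snd.
exact: coord_continuous.
Qed.

Lemma loglik_measurable n (x y : 'I_n -> 'cV[R]_p) :
  measurable_fun setT (fun th : paramB R p => loglik x y (th : param R p)).
Proof.
by apply: measurable_loglik; [exact: muX_measurable|exact: muY_measurable|
  exact: Omega_measurable].
Qed.

Lemma loglik_shift_measurable n (x y : 'I_n -> 'cV[R]_p) (z : 'cV[R]_p) (ths : param R p) t :
  measurable_fun setT
    (fun th : paramB R p => loglik x y (lda_shift z n ths t (th : param R p))).
Proof.
apply: measurable_loglik.
- by apply: entrywise_measurableB; [exact: muX_measurable|exact: entrywise_measurable_cst].
- by apply: entrywise_measurableB; [exact: muY_measurable|exact: entrywise_measurable_cst].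
- by apply: entrywise_measurableD; [exact: Omega_measurable|exact: entrywise_measurable_cst].
Qed.

Lemma Delta_measurable (z : 'cV[R]_p) :
  measurable_fun setT (fun th : paramB R p => Delta z (th : param R p)).
Proof.
by apply: measurable_Delta; [exact: muX_measurable|exact: muY_measurable|
  exact: Omega_measurable].
Qed.

End Coordinates.
End ParamMeasurability.

(** * Events of vanishing probability *)
Section ConcentrationProbability.
Context d (T : measurableType d) (R : realType) (P : probability T R).
Variables (n p : nat) (X : 'I_n -> T -> 'cV[R]_p) (mu : 'cV[R]_p) (Sg : 'M[R]_p).
Hypotheses (n0 : (0 < n)%N) (p0 : (0 < p)%N) (Sg_pos : posdef Sg).
Hypothesis mX : forall i, measurable_fun setT (X i : T -> borel 'cV[R]_p).
Hypothesis lawX : forall i, mvnormal P (X i) mu Sg.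
Hypothesis indX : forall i k, i != k -> forall B B' : set (borel 'cV[R]_p),
  measurable B -> measurable B' ->
  (P (X i @^-1` B `&` X k @^-1` B') = P (X i @^-1` B) * P (X k @^-1` B'))%E.
Variables (C e : R).
Hypotheses (C1 : 1 <= C) (SgC : opbound Sg C) (e0 : 0 < e).

Let markov_ext (f : T -> R) (c : R) : measurable_fun setT f -> (forall w, 0 <= f w) ->
  0 < c -> (\int[P]_w (f w)%:E <= (1310 * C ^+ 2 * c)%:E)%E ->
  (P^*%mu [set w | ~ (f w <= e^-1 * c)%R] <= (1310 * C ^+ 2 * e)%:E)%E.
Proof.
move=> mf f0 c0 If.
have -> : [set w | ~ f w <= e^-1 * c] = [set w | e^-1 * c < f w].
  by apply/seteqP; split=> w /=; rewrite ltNge => /negP.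
have mB : measurable [set w | e^-1 * c < f w].
  rewrite -[X in measurable X]setTI.
  have := mf measurableT _ (measurable_itv `]e^-1 * c, +oo[).
  by congr (measurable _); apply/seteqP; split => w /=; rewrite in_itv /= andbT.
rewrite measurable_mu_extE //; apply: markov_ge0 => //.
  by rewrite mulr_gt0 // invr_gt0.
apply: le_trans If _; rewrite lee_fin le_eqVlt; apply/orP; left; apply/eqP.
by field; rewrite gt_eqF.
Qed.

(** Markov's inequality for each of the four conditions; the expectations are at
    most 1310 C^2 times the quantities that e^-1 multiplies. *)
Lemma concentrated_fails (a b : 'cV[R]_p) :
  (P^*%mu [set w | ~ concentrated e (fun i => X i w) mu Sg a b] <=
     (4 * (1310 * C ^+ 2 * e))%:E)%E.
Proof.
have C0 : 0 <= C by exact: le_trans C1.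
have pR : 0 < p%:R :> R by rewrite ltr0n.
have nR : 0 < n%:R :> R by rewrite ltr0n.
have pn0 : 0 < p%:R / n%:R :> R by exact: divr_gt0.
pose S1 := [set w | ~ (euclnorm (smean (X^~ w) - mu) ^+ 2 <= e^-1 * (p%:R / n%:R))%R].
pose S2 (c : 'cV[R]_p) := [set w | ~ (euclnorm ((scov (X^~ w) mu - Sg) *m c) ^+ 2
   <= e^-1 * (p%:R / n%:R) * euclnorm c ^+ 2)%R].
pose S3 := [set w | ~ (frobnorm (scov (X^~ w) mu - Sg) ^+ 2 <= e^-1 * (p%:R ^+ 2 / n%:R))%R].
have h1 : (P^*%mu S1 <= (1310 * C ^+ 2 * e)%:E)%E.
  apply: (@markov_ext (fun w => euclnorm (smean (X^~ w) - mu) ^+ 2)) => //.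
  - exact: smean_norm_measurable.
  - by move=> w; exact: sqr_ge0.
  apply: le_trans (smean_norm_integral n0 Sg_pos mX lawX indX SgC) _.
  rewrite lee_fin ler_wpM2r ?(ltW pn0) //.
  have : C * 1 <= C * C by rewrite ler_wpM2l.
  rewrite expr2; have := mulr_ge0 C0 C0; lra.
have h2 c : (P^*%mu (S2 c) <= (1310 * C ^+ 2 * e)%:E)%E.
  pose y := (euclnorm c)^-1 *: c.
  have cy : c = euclnorm c *: y.
    rewrite /y scalerA; have [c0|c0] := eqVneq (euclnorm c) 0; last by rewrite divff // scale1r.
    by rewrite c0 mul0r scale0r; exact: euclnorm_eq0.
  have y1 : euclnorm y <= 1.
    rewrite /y euclnormZ ger0_norm ?invr_ge0 ?euclnorm_ge0 //.
    have [->|c0] := eqVneq (euclnorm c) 0; first by rewrite mulr0.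
    by rewrite mulVf.
  have sub : S2 c `<=` [set w | ~ (euclnorm ((scov (X^~ w) mu - Sg) *m y) ^+ 2
       <= e^-1 * (p%:R / n%:R))%R].
    move=> w /= H Hy; apply: H.
    rewrite {1}cy -scalemxAr euclnormZ ger0_norm ?euclnorm_ge0 // exprMn mulrC.
    by rewrite ler_wpM2r // sqr_ge0.
  apply: le_trans (le_mu_ext P sub) _.
  apply: (@markov_ext (fun w => euclnorm ((scov (X^~ w) mu - Sg) *m y) ^+ 2)) => //.
  - exact: scov_mul_measurable.
  - by move=> w; exact: sqr_ge0.
  - exact: scov_mul_integral.
have h3 : (P^*%mu S3 <= (1310 * C ^+ 2 * e)%:E)%E.
  apply: (@markov_ext (fun w => frobnorm (scov (X^~ w) mu - Sg) ^+ 2)) => //.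
  - exact: scov_frob_measurable.
  - by move=> w; exact: sqr_ge0.
  - by rewrite divr_gt0 // exprn_gt0.
  - exact: scov_frob_integral.
have sub : [set w | ~ concentrated e (fun i => X i w) mu Sg a b] `<=`
    S1 `|` (S2 a `|` (S2 b `|` S3)).
  move=> w /= H; apply: contrapT => /not_orP[/contrapT k1 /not_orP[/contrapT k2]].
  by move=> /not_orP[/contrapT k3 /contrapT k4]; apply: H; split.
apply: le_trans (le_mu_ext P sub) _.
apply: le_trans (outer_measureU2 _ _ _) _.
rewrite (_ : 4 * _ = 1310 * C ^+ 2 * e + (1310 * C ^+ 2 * e +
  (1310 * C ^+ 2 * e + 1310 * C ^+ 2 * e))); last by ring.
rewrite !EFinD; apply: leeD => //; apply: le_trans (outer_measureU2 _ _ _) _.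
apply: leeD; first exact: h2.
apply: le_trans (outer_measureU2 _ _ _) _; apply: leeD; [exact: h2|exact: h3].
Qed.

End ConcentrationProbability.

Section Vanishing.
Variable R : realType.
Context (d : nat -> measure_display) (T : forall n, measurableType (d n)).
Variable P : forall n, probability (T n) R.

(** Outer measures are needed since posterior quantities may fail to be
    measurable in the sample. *)
Definition vanishing (U : forall n, set (T n)) : Prop :=
  (P n)^*%mu (U n) @[n --> \oo] --> 0%E.

Lemma vanishing_le (U : forall n, set (T n)) (c : nat -> \bar R) :
  (\forall n \near \oo, ((P n)^*%mu (U n) <= c n)%E) -> c @ \oo --> 0%E -> vanishing U.
Proof.
move=> Uc c0; apply: (@squeeze_cvge _ _ _ _ (fun=> 0%E) _ c) => //; last exact: cvg_cst.
near=> n; apply/andP; split; first exact: outer_measure_ge0.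
by near: n.
Unshelve. all: by end_near. Qed.

Lemma vanishing_sub (U W : forall n, set (T n)) :
  (\forall n \near \oo, U n `<=` W n) -> vanishing W -> vanishing U.
Proof.
move=> UW; apply: vanishing_le; near=> n; apply: le_mu_ext; by near: n.
Unshelve. all: by end_near. Qed.

Lemma vanishingU (U W : forall n, set (T n)) :
  vanishing U -> vanishing W -> vanishing (fun n => U n `|` W n).
Proof.
move=> U0 W0; apply: (@vanishing_le _ (fun n => (P n)^*%mu (U n) + (P n)^*%mu (W n))%E).
  by near=> n; exact: outer_measureU2.
by rewrite -[X in _ --> X]adde0; apply: cvgeD.
Unshelve. all: by end_near. Qed.

Lemma vanishing_seq (I : eqType) (s : seq I) (U : I -> forall n, set (T n)) :
  (forall t, t \in s -> vanishing (U t)) ->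
  vanishing (fun n => [set w | exists2 t, t \in s & U t n w]).
Proof.
elim: s => [_|t s IH H].
  apply: (@vanishing_le _ (fun=> 0%E)); last exact: cvg_cst.
  near=> n; rewrite (_ : [set w | _] = set0) ?outer_measure0 //.
  by apply/seteqP; split=> w // [].
apply: (@vanishing_sub _ (fun n => U t n `|` [set w | exists2 t, t \in s & U t n w])).
  near=> n => w [t']; rewrite inE => /orP[/eqP ->|ts] Uw; [by left|by right; exists t'].
apply: vanishingU; first by apply: H; rewrite mem_head.
by apply: IH => t' t's; apply: H; rewrite inE t's orbT.
Unshelve. all: by end_near. Qed.

End Vanishing.

(** * The limit theorem *)
Section Asymptotics.
Variable R : realType.

Lemma near_seq (I : eqType) (s : seq I) (Q : I -> nat -> Prop) :
  (forall t, t \in s -> \forall n \near \oo, Q t n) ->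
  \forall n \near \oo, forall t, t \in s -> Q t n.
Proof.
elim: s => [_|t s IH H]; first by near=> n.
have H1 : \forall n \near \oo, Q t n by apply: H; rewrite mem_head.
have H2 : \forall n \near \oo, forall t', t' \in s -> Q t' n.
  by apply: IH => t' t's; apply: H; rewrite inE t's orbT.
near=> n => t'; rewrite inE => /orP[/eqP ->|t's].
  by near: n.
by have : forall t', t' \in s -> Q t' n; [near: n|apply].
Unshelve. all: by end_near. Qed.

Lemma near_le_mul (e : nat -> R) (c K : R) : e @ \oo --> 0 -> 0 < K ->
  \forall n \near \oo, c * e n <= K.
Proof.
move=> e0 K0; have : (fun n => c * e n) @ \oo --> c * 0 by apply: cvgM; [exact: cvg_cst|].
by rewrite mulr0 => /cvgr_le; apply.
Qed.

Lemma bigO1_bound (f : nat -> R) : f =O_\oo (fun _ : nat => 1 : R) ->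
  exists C, \forall n \near \oo, f n <= C.
Proof.
move=> /eqO_exP[k k0 H]; exists k; near=> n.
have : `|f n| <= k * `|1 : R| by near: n.
by rewrite normr1 mulr1 => /(le_trans (ler_norm _)).
Unshelve. all: by end_near. Qed.

Lemma error_scale_cvg (p : nat -> nat) (delta : nat -> R) :
  (p n)%:R ^+ 2 / n%:R @[n --> \oo] --> (0 : R) -> delta @ \oo --> 0 ->
  (fun n => Num.sqrt ((p n)%:R / Num.sqrt n%:R + `|delta n|)) @ \oo --> 0.
Proof.
move=> p2 d0.
have sqrt0 (f : nat -> R) : f @ \oo --> 0 -> (fun n => Num.sqrt (f n)) @ \oo --> 0.
  move=> f0; have := continuous_cvg _ (@sqrt_continuous R 0) f0.
  by rewrite sqrtr0 => /(_ _); apply.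
apply: (sqrt0); rewrite -[X in _ --> X]addr0; apply: cvgD; last first.
  by rewrite -(normr0 R); exact: cvg_norm.
have := sqrt0 _ p2; apply: cvg_trans; apply: near_eq_cvg; near=> n.
by rewrite sqrtrM ?sqr_ge0 // sqrtr_sqr ger0_norm // sqrtrV.
Unshelve. all: by end_near. Qed.

Lemma pairwise_indep d (T : measurableType d) (P : probability T R) (E : normedModType R)
    (I : finType) (Z : I -> T -> borel E) (i k : I) (B B' : set (borel E)) :
  mutually_independent P Z -> i != k -> measurable B -> measurable B' ->
  (P (Z i @^-1` B `&` Z k @^-1` B') = P (Z i @^-1` B) * P (Z k @^-1` B'))%E.
Proof.
move=> ind ik mB mB'; pose BB j := if j == i then B else B'.
have mBB j : measurable (BB j) by rewrite /BB; case: ifP.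
have := ind [set i; k]%SET BB mBB.
rewrite big_setU1 ?inE // big_set1 /BB eqxx eq_sym (negPf ik) => <-.
congr (P _); apply/seteqP; split=> w /=.
  move=> [h1 h2] j /=; rewrite !inE => /orP[/eqP ->|/eqP ->]; first by rewrite eqxx.
  by rewrite eq_sym (negPf ik).
move=> H; split; first by have := H i; rewrite /= !inE eqxx => /(_ isT).
by have := H k; rewrite /= !inE eqxx orbT eq_sym (negPf ik) => /(_ isT).
Qed.

Lemma sup_norm_le (I : Type) (f : I -> R) (e : R) (i0 : I) :
  (forall i, `|f i| <= e) -> `|sup [set `|f i| | i in [set: I]]| <= e.
Proof.
move=> fe; have ub : ubound [set `|f i| | i in [set: I]] e by move=> _ [i _ <-].
rewrite ger0_norm.
  by apply: ge_sup => //; exists `|f i0|, i0.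
apply: le_trans (normr_ge0 (f i0)) _; apply: ub_le_sup; first by exists e.
by exists i0.
Qed.

End Asymptotics.

Theorem theorem4p1 (R : realType)
  (* dimension, fixed covariate vector and true parameter, all depending on n *)
  (p : nat -> nat)
  (z : forall n, 'cV[R]_(p n))
  (ths : forall n, param R (p n))
  (* sampling model *)
  (d : nat -> measure_display)
  (T : forall n, measurableType (d n))
  (P : forall n, probability (T n) R)
  (X Y : forall n, 'I_n -> {RV P n >-> borel 'cV[R]_(p n)})
  (* prior, localising sets and their radius *)
  (Pi : forall n, probability (paramB R (p n)) R)
  (A : forall n, set (param R (p n)))
  (delta : nat -> R)
  (p_infty : p @ \oo --> \oo)
  (Omega_posdef : forall n, posdef (Omega (ths n)))
  (X_normal : forall n (i : 'I_n),
     mvnormal (P n) (X n i) (muX (ths n)) (Sigma (ths n)))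
  (Y_normal : forall n (i : 'I_n),
     mvnormal (P n) (Y n i) (muY (ths n)) (Sigma (ths n)))
  (XY_indep : forall n, mutually_independent (P n)
     (fun k : 'I_n + 'I_n =>
        match k with inl i => X n i : T n -> _ | inr i => Y n i : T n -> _ end))
  (Pi_support : forall n, {ae Pi n, forall th, posdef (Omega th)})
  (norms_bounded :
     (fun n => Num.max (specnorm (Sigma (ths n))) (specnorm (Omega (ths n))))
       =O_\oo (fun _ : nat => 1 : R))
  (p2_small : (p n)%:R ^+ 2 / n%:R @[n --> \oo] --> (0 : R))
  (V_pos : forall n, 0 < V (z n) (ths n))
  (Vinv_bounded : (fun n => ((V (z n) (ths n))^-1)%R) =O_\oo (fun _ : nat => 1 : R))
  (A_measurable : forall n, measurable (A n : set (paramB R (p n))))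
  (delta_small : delta @ \oo --> 0)
  (A_nbhd : forall n, A n `<=` nbhd n (ths n) (delta n))
  (A_posterior : oP P (fun n w =>
     posterior (Pi n) (fun i => X n i w) (fun i => Y n i w) (A n) - 1))
  (A_shift : forall t : R, oP P (fun n w =>
     fine (\int[Pi n]_(th in A n)
             (expR (loglik (fun i => X n i w) (fun i => Y n i w)
                           (lda_shift (z n) n (ths n) t th)))%:E) /
     fine (\int[Pi n]_(th in A n)
             (expR (loglik (fun i => X n i w) (fun i => Y n i w) th))%:E) - 1)) :
  oP P (fun n w =>
    sup [set `| posterior (Pi n) (fun i => X n i w) (fun i => Y n i w)
                  [set th | Num.sqrt n%:R * (V (z n) (ths n))^-1 *
                            (Delta (z n) th -
                             Delta_hat (z n) (fun i => X n i w)
                                             (fun i => Y n i w)) <= t]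
                - fine (normal_prob 0 1 `]-oo, t]) | | t in [set: R]]).
Proof.
move=> eps eps0.
have [ts [zeta [zeta0 close_cdf]]] := gibbs_cdf_uniform eps0.
have [K1 K1n] := bigO1_bound norms_bounded.
have [K2 K2n] := bigO1_bound Vinv_bounded.
pose C := Num.max 1 (Num.max K1 K2).
have C1 : 1 <= C by rewrite /C le_max lexx.
(* The square root balances the two uses of e: the samples that are not
   concentrated have probability of order e, and on the other ones the expansion
   has an error of order e, for which e ^+ 2 must dominate p / sqrt n and delta. *)
pose e n : R := Num.sqrt ((p n)%:R / Num.sqrt n%:R + `|delta n|).
have e_cvg : e @ \oo --> 0 by exact: error_scale_cvg.
pose conc n (x : 'I_n -> 'cV[R]_(p n)) mu := concentrated (e n) x mu (Sigma (ths n))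
  (Omega (ths n) *m mean_gap (ths n)) (Omega (ths n) *m mean_mid (z n) (ths n)).
pose l n w := loglik (fun i => X n i w) (fun i => Y n i w).
pose S n w th := Num.sqrt n%:R * (V (z n) (ths n))^-1 *
  (Delta (z n) th - Delta_hat (z n) (fun i => X n i w) (fun i => Y n i w)).
pose lt n w t th := l n w (lda_shift (z n) n (ths n) t th).
(* bad1 and bad2 negate the two conditions on the prior, bad3 and bad4 the
   concentration of the two samples *)
pose bad1 n := [set w | zeta < `|posterior (Pi n) (fun i => X n i w) (fun i => Y n i w) (A n) - 1|].
pose bad2 t n := [set w | zeta < `|
     fine (\int[Pi n]_(th in A n) (expR (lt n w t th))%:E) /
     fine (\int[Pi n]_(th in A n) (expR (l n w th))%:E) - 1|].
pose bad3 n := [set w | ~ conc n (fun i => X n i w) (muX (ths n))].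
pose bad4 n := [set w | ~ conc n (fun i => Y n i w) (muY (ths n))].
have n_pos : \forall n \near \oo, (0 < n)%N by exact: nbhs_infty_gt.
have p_pos : \forall n \near \oo, (0 < p n)%N by exact: (p_infty _ (nbhs_infty_gt 0)).
have Om_C : \forall n \near \oo, opbound (Omega (ths n)) C.
  near=> n; apply: opboundW (specnorm_opbound _) _.
  have : Num.max (specnorm (Sigma (ths n))) (specnorm (Omega (ths n))) <= K1 by near: n.
  by rewrite ge_max => /andP[_ H]; rewrite /C !le_max H orbT.
have Sg_C : \forall n \near \oo, opbound (Sigma (ths n)) C.
  near=> n; apply: opboundW (specnorm_opbound _) _.
  have : Num.max (specnorm (Sigma (ths n))) (specnorm (Omega (ths n))) <= K1 by near: n.
  by rewrite ge_max => /andP[H _]; rewrite /C !le_max H orbT.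
have Sg_pos n : posdef (Sigma (ths n)) by exact: posdef_inv.
have e_pos : \forall n \near \oo, 0 < e n.
  near=> n; rewrite sqrtr_gt0 ltr_wpDr // divr_gt0 ?ltr0n ?sqrtr_gt0 //; first by near: n.
  by rewrite ltr0n; near: n.
have fail_cvg : (fun n => (4 * (1310 * C ^+ 2 * e n))%:E) @ \oo --> 0%E.
  apply: cvg_EFin; first by near=> n.
  rewrite [X in X @ _](_ : _ = fun n => (4 * (1310 * C ^+ 2)) * e n); last first.
    by apply/funext => n /=; rewrite -!mulrA.
  by rewrite -[X in _ --> X](mulr0 (4 * (1310 * C ^+ 2))); apply: cvgM; [exact: cvg_cst|].
have v3 : vanishing P bad3.
  apply: vanishing_le fail_cvg; near=> n; apply: concentrated_fails => //.
  - by near: n.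
  - by near: n.
  - by move=> i k ik B B' mB mB'; exact: (pairwise_indep (XY_indep n) (i := inl i) (k := inl k)).
  - by near: n.
  - by near: n.
have v4 : vanishing P bad4.
  apply: vanishing_le fail_cvg; near=> n; apply: concentrated_fails => //.
  - by near: n.
  - by near: n.
  - by move=> i k ik B B' mB mB'; exact: (pairwise_indep (XY_indep n) (i := inr i) (k := inr k)).
  - by near: n.
  - by near: n.
have v2 : vanishing P (fun n => [set w | exists2 t, t \in ts & bad2 t n w]).
  by apply: vanishing_seq => t _; exact: A_shift.
apply: vanishing_sub (vanishingU (A_posterior _ zeta0) (vanishingU v2 (vanishingU v3 v4))).
have rate_t : \forall n \near \oo, forall t, t \in ts ->
    4 * C ^+ 4 * `|t| * (6 * C ^+ 2 * e n) <= 2^-1 /\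
    shift_const C t * (6 * C ^+ 2 * e n) <= zeta.
  apply: near_seq => t _; near=> n; split; rewrite mulrA; near: n; exact: near_le_mul.
near=> n => w /= big; apply: contrapT => /not_orP[/negP nb1 /not_orP[nb2 /not_orP[nb3 nb4]]].
have {nb3} cX : conc n (fun i => X n i w) (muX (ths n)) by exact: contrapT nb3.
have {nb4} cY : conc n (fun i => Y n i w) (muY (ths n)) by exact: contrapT nb4.
have n0 : (0 < n)%N by near: n.
have en0 : 0 < e n by near: n.
have en1 : e n <= 1 by have : 1 * e n <= 1; [near: n; exact: near_le_mul|rewrite mul1r].
have en2 : C * (2 * e n) <= 2^-1 by rewrite mulrA; near: n; exact: near_le_mul.
have e2 : e n ^+ 2 = (p n)%:R / Num.sqrt n%:R + `|delta n|.
  by rewrite sqr_sqrtr // addr_ge0 // divr_ge0 // sqrtr_ge0.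
have close : tilt_close (Pi n) (A n) (l n w) (S n w) (lt n w) ts zeta.
  split; first by rewrite leNgt.
  - by move=> t tts; rewrite leNgt; apply/negP => H; apply: nb2; exists t.
  - move=> t tts th Ath.
    have : forall t, t \in ts -> 4 * C ^+ 4 * `|t| * (6 * C ^+ 2 * e n) <= 2^-1 /\
      shift_const C t * (6 * C ^+ 2 * e n) <= zeta by near: n.
    move=> /(_ t tts) [rt1 rt2]; apply: le_trans rt2.
    apply: (loglik_shift_concentrated (delta := delta n)) => //.
    + by near: n.
    + by near: n.
    + by near: n.
    + rewrite -ler_pdivrMr // div1r /C !le_max; apply/orP; right; apply/orP; right.
      by near: n.
    + by rewrite e2 lerDl.
    + by rewrite e2 (le_trans (ler_norm _)) // lerDr divr_ge0 // sqrtr_ge0.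
    + exact: A_nbhd.
have := close_cdf _ (paramB R (p n)) (Pi n) (A n) (l n w) (S n w) (lt n w)
  (A_measurable n) (loglik_measurable _ _) _ (fun t => loglik_shift_measurable _ _ _ _ _) close.
move=> H; move: big; apply/negP; rewrite -leNgt; apply: (@sup_norm_le _ _ _ _ 0).
apply: H; apply: measurable_funM; first exact: measurable_cst.
by apply: measurable_funB; [exact: Delta_measurable|exact: measurable_cst].
Unshelve. all: by end_near. Qed.
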